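(* Let $E$ be a self-adjoint operator on $\mathcal H$ such that $\{0,1\}\subset\sigma_{ess}(E)\subset[0,1]$. Let $\boldsymbol\lambda=(\lambda_j)_{j\in J}$ be the list of all eigenvalues of $E$ with multiplicity (possibly an empty list). Let $\boldsymbol d=(d_i)_{i\in I}$ be a real sequence such that \[f_{\boldsymbol d}(\alpha)\le f_{\boldsymbol\lambda}(\alpha)\qquad\text{for all }\alpha\in\mathbb R\setminus[0,1].\] Define \[\delta^L=\liminf_{\beta\nearrow 0}(f_{\boldsymbol\lambda}(\beta)-f_{\boldsymbol d}(\beta)),\qquad \delta^U=\liminf_{\beta\searrow 1}(f_{\boldsymbol\lambda}(\beta)-f_{\boldsymbol d}(\beta)).\] Assume that one of the following holds: (a) $\delta^L,\delta^U>0$ and $f_{\boldsymbol d}(\alpha)=\infty$ for some $\alpha\in(0,1)$; (b) $\delta^L>0$, $\delta^U=\infty$, and $\sum_{d_i>0}d_i=\infty$; (b') $\delta^L=0$, $\delta^U=\infty$, $\sum_{d_i>0}d_i=\infty$, and $d_i>0$ for all $i\in I$; (c) $\delta^U>0$, $\delta^L=\infty$, and $\sum_{d_i<1}(1-d_i)=\infty$; (c') $\delta^U=0$, $\delta^L=\infty$, $\sum_{d_i<1}(1-d_i)=\infty$, and $d_i<1$ for all $i\in I$; (d) $\delta^L=\delta^U=\infty$. Then $\boldsymbol d$ is a diagonal of $E$.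
   Context: Hilbert spaces are separable and infinite-dimensional, operators are bounded; $I$ is a countably infinite set. $(d_i)$ is a diagonal of a self-adjoint $E$ if $d_i=\langle Ee_i,e_i\rangle$ for all $i$, for some orthonormal basis $(e_i)$. Majorization function: for a countable real sequence $\boldsymbol d=(d_i)$ let $C_{\boldsymbol d}(\alpha)=\sum_{0\le d_i<\alpha}d_i$, $D_{\boldsymbol d}(\alpha)=\sum_{\alpha\le d_i\le1}(1-d_i)$, and $f_{\boldsymbol d}:\mathbb R\to[0,\infty]$, $f_{\boldsymbol d}(\alpha)=\sum_{d_i\le\alpha}(\alpha-d_i)$ for $\alpha\le0$; $f_{\boldsymbol d}(\alpha)=(1-\alpha)C_{\boldsymbol d}(\alpha)+\alpha D_{\boldsymbol d}(\alpha)$ for $\alpha\in(0,1)$; $f_{\boldsymbol d}(\alpha)=\sum_{d_i\ge\alpha}(d_i-\alpha)$ for $\alpha\ge1$. *)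

(* Defs.v *)
From HB Require Import structures.
From mathcomp Require Import all_boot all_order all_algebra.
From mathcomp Require Import sesquilinear complex.
From mathcomp Require Import all_classical all_reals all_analysis.

Set Implicit Arguments.
Unset Strict Implicit.
Unset Printing Implicit Defensive.

Import Order.TTheory GRing.Theory Num.Theory.
Import numFieldNormedType.Exports.

Local Open Scope classical_set_scope.
Local Open Scope ring_scope.

(* A complex Hilbert space is a complete normed space [H] over [R[i]] together
   with a form [ip : {dot H for Num.conj}] satisfying [norm_of_inner ip].  The
   form is linear in its first argument and conjugate-linear in its second. *)
Section Hilbert.
Context {R : realType} {H : completeNormedModType R[i]}.
Variable ip : {dot H for @Num.conj R[i]}.

Definition norm_of_inner : Prop := forall x : H, `|x| ^+ 2 = ip x x.

Definition separable_space : Prop :=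
  exists S : set H, countable S /\ dense S.

(* Finite linear combinations, without closure. *)
Definition linear_span (A : set H) : set H :=
  [set x | exists (n : nat) (c : 'I_n -> R[i]) (v : 'I_n -> H),
     (forall i, A (v i)) /\ x = \sum_(i < n) c i *: v i].

Definition finite_dim (V : set H) : Prop :=
  exists (n : nat) (v : 'I_n -> H), V `<=` linear_span (range v).

(* [(e i)_{i in A}] is an orthonormal basis of the closed subspace [V]; the
   values of [e] outside [A] are irrelevant.  [A] may be empty, in which case
   [V = [set 0]]. *)
Definition onb_on {T : Type} (V : set H) (A : set T) (e : T -> H) : Prop :=
  [/\ forall i, A i -> ip (e i) (e i) = 1,
      forall i j, A i -> A j -> i <> j -> ip (e i) (e j) = 0
    & closure (linear_span (e @` A)) = V].

Definition bounded_operator (T : H -> H) : Prop :=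
  exists M : R[i], forall x, `|T x| <= M * `|x|.

Definition self_adjoint (T : H -> H) : Prop :=
  forall x y, ip (T x) y = ip x (T y).

(* Finite-dimensional kernel, closed range, finite-dimensional cokernel. *)
Definition fredholm (T : H -> H) : Prop :=
  [/\ finite_dim [set x | T x = 0],
      closed (range T)
    & exists F : set H, finite_dim F /\
        forall x, exists y z, F z /\ x = T y + z].

Definition essential_spectrum (T : H -> H) : set R[i] :=
  [set mu | ~ fredholm (fun x => T x - mu *: x)].

Definition eigenspace (T : H -> H) (mu : R[i]) : set H :=
  [set x | T x = mu *: x].

(* Each complex number [mu] occurs in [lam] exactly as many times as the
   Hilbert dimension of its eigenspace (not at all if [mu] is no eigenvalue). *)
Definition eigenvalue_list {J : Type} (T : H -> H) (lam : J -> R) : Prop :=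
  forall mu : R[i], exists e : J -> H,
    onb_on (eigenspace T mu) [set j | (lam j)%:C%C = mu] e.

Definition is_diagonal {I : Type} (T : H -> H) (d : I -> R) : Prop :=
  exists e : I -> H,
    onb_on [set: H] [set: I] e /\
    forall i, ((d i)%:C)%C = ip (T (e i)) (e i).

End Hilbert.

Arguments separable_space {R} H.

Section Majorization.
Context {R : realType} {I : choiceType}.
Local Open Scope ereal_scope.

Definition maj_C (d : I -> R) (alpha : R) : \bar R :=
  (\esum_(i in [set i | (0 <= d i < alpha)%R]) (d i)%:E)%R.

Definition maj_D (d : I -> R) (alpha : R) : \bar R :=
  (\esum_(i in [set i | (alpha <= d i <= 1)%R]) (1 - d i)%:E)%R.

Definition maj_f (d : I -> R) (alpha : R) : \bar R :=
  if (alpha <= 0)%R then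
    (\esum_(i in [set i | (d i <= alpha)%R]) (alpha - d i)%:E)%R
  else if (alpha < 1)%R then
    (1 - alpha)%R%:E * maj_C d alpha + alpha%:E * maj_D d alpha
  else
    (\esum_(i in [set i | (alpha <= d i)%R]) (d i - alpha)%:E)%R.

End Majorization.

(* In the intended use [maj_f lam] is finite outside [0, 1], so no difference
   [+oo - +oo] occurs. *)
Definition delta_lower {R : realType} {I J : choiceType}
    (lam : J -> R) (d : I -> R) : \bar R :=
  limf_einf (fun beta : R => maj_f lam beta - maj_f d beta)%E (0 : R)^'-.

Definition delta_upper {R : realType} {I J : choiceType}
    (lam : J -> R) (d : I -> R) : \bar R :=
  limf_einf (fun beta : R => maj_f lam beta - maj_f d beta)%E (1 : R)^'+.

(* Main.v *)
(* One move does everything.  For orthonormal [p], [q] a phase removes the cross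
   term of [<E x, x>] on the plane of [p] and [q], so the diagonal entries of
   [p] and [q] can be traded for any [d] between them and the complementary
   value that keeps their sum.

   The demands [d i >= 1] are met by an infinite sequence of such moves
   (Schur-Horn) applied to the eigenvectors with eigenvalues above 1, listed in
   decreasing order and followed, if there are finitely many, by approximate
   eigenvectors for 1.  The positive slack between the majorization functions
   pays for infinitely many further vectors with entries at least 1.  The
   demands [d i <= 0] are met in the same way with [1 - E].

   What is left over is absorbed in the style of Mueller and Tomilov.  When
   [e i] is chosen, the component of a prescribed target vector that is still
   orthogonal to all earlier [e j] is mixed into it with weight at least a
   constant times [w i].  If the [w i] have infinite sum, every target ends up
   in the closed span.  For [0 < d i < 1] one can take [w i] of the order of
   [min (d i) (1 - d i)].  If the upper slack is infinite, one can also meet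
   the raised demands [d i + w i] instead of [d i], for some [w] with infinite
   sum, and mix down to [d i] afterwards. *)
Require Import Defs.
From HB Require Import structures.
From mathcomp Require Import all_boot all_order all_algebra.
From mathcomp Require Import sesquilinear complex.
From mathcomp Require Import all_classical all_reals all_analysis.
From mathcomp Require Import ring lra zify.

Set Implicit Arguments.
Unset Strict Implicit.
Unset Printing Implicit Defensive.

Import Order.TTheory GRing.Theory Num.Theory.
Import numFieldNormedType.Exports.

Local Open Scope classical_set_scope.
Local Open Scope ring_scope.

(** * Inner product *)

(** The Schur-Horn moves fix values but say nothing about completeness, so the vectors they produce
    are only raw material: each basis vector comes from one further mix, and the raw vectors are
    themselves targets of the absorption. Two defects of the reserve shape the estimates.
    Approximate eigenvectors for 1 may have values below 1; the deviations are [eps * 2^-1 ^+ n], so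
    their total is at most [2 * eps], and slack has to pay for it. Slack is known only at levels
    close to 1, that is, for long prefixes; on short prefixes all values belong to eigenvalues above
    1 and are exact. Moreover an infinite run of moves needs values that drop strictly below each
    demand, so demands equal to 1 are raised a little. Both sides must start from mutually
    orthogonal reserves although each may contain infinitely many eigenvectors. This is possible
    because eigenvalues below 0 keep distance 1 from the value 1, and those above 1 from 0. Only the
    property [quadratic] of the form is used in the constructions, so that replacing [E] by [1 - E]
    is free. *)

Section InnerProduct.
Context {R : realType} {H : completeNormedModType R[i]}.
Variable ip : {dot H for @Num.conj R[i]}.
Implicit Types (x y z : H) (a b c : R[i]).

Definition sqnorm x : R := complex.Re (ip x x).
Definition sqabs (c : R[i]) : R := complex.Re c ^+ 2 + complex.Im c ^+ 2.

Lemma ipDl x y z : ip (x + y) z = ip x z + ip y z.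
Proof. exact: linearDl. Qed.
Lemma ipBl x y z : ip (x - y) z = ip x z - ip y z.
Proof. exact: linearBl. Qed.
Lemma ipZl c x y : ip (c *: x) y = c * ip x y.
Proof. exact: linearZl_LR. Qed.
Lemma ipDr x y z : ip x (y + z) = ip x y + ip x z.
Proof. exact: linearDr. Qed.
Lemma ipBr x y z : ip x (y - z) = ip x y - ip x z.
Proof. exact: linearBr. Qed.
Lemma ipZr c x y : ip x (c *: y) = c^* * ip x y.
Proof. exact: linearZr_LR. Qed.
Lemma ip0l x : ip 0 x = 0. Proof. exact: linear0l. Qed.
Lemma ip0r x : ip x 0 = 0. Proof. exact: linear0r. Qed.
Lemma ipC x y : ip x y = (ip y x)^*.
Proof. by rewrite (hermC ip) expr0 mul1r. Qed.
Lemma ipC0 x y : ip x y = 0 -> ip y x = 0.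
Proof. by rewrite (ipC y) => ->; rewrite conjC0. Qed.
Lemma ip_suml (J : Type) (s : seq J) (F : J -> H) x :
  ip (\sum_(j <- s) F j) x = \sum_(j <- s) ip (F j) x.
Proof. by elim/big_ind2 : _ => [|? ? ? ? <- <-|]; rewrite ?ip0l ?ipDl. Qed.

Lemma complex_ReD a b : complex.Re (a + b) = complex.Re a + complex.Re b.
Proof. by case: a; case: b. Qed.
Lemma complex_ReN a : complex.Re (- a) = - complex.Re a.
Proof. by case: a. Qed.
Lemma complex_ReB a b : complex.Re (a - b) = complex.Re a - complex.Re b.
Proof. by rewrite complex_ReD complex_ReN. Qed.
Lemma complex_ReM a b : complex.Re (a * b) =
  complex.Re a * complex.Re b - complex.Im a * complex.Im b.
Proof. by case: a; case: b. Qed.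
Lemma complex_ImM a b : complex.Im (a * b) =
  complex.Re a * complex.Im b + complex.Im a * complex.Re b.
Proof. by case: a; case: b. Qed.
Lemma Re_conj a : complex.Re a^* = complex.Re a.
Proof. by case: a. Qed.
Lemma Im_conj a : complex.Im a^* = - complex.Im a.
Proof. by case: a. Qed.
Lemma Re_ipC x y : complex.Re (ip x y) = complex.Re (ip y x).
Proof. by rewrite ipC Re_conj. Qed.

Lemma sqabsM a b : sqabs (a * b) = sqabs a * sqabs b.
Proof. rewrite /sqabs complex_ReM complex_ImM; ring. Qed.
Lemma sqabs_real (r : R) : sqabs r%:C%C = r ^+ 2.
Proof. by rewrite /sqabs /= expr0n addr0. Qed.
Lemma sqabs_ge0 a : 0 <= sqabs a.
Proof. by rewrite addr_ge0 ?sqr_ge0. Qed.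
Lemma sqabs_conj a : sqabs a^* = sqabs a.
Proof. by rewrite /sqabs Re_conj Im_conj sqrrN. Qed.
Lemma sqabs_eq0 a : (sqabs a == 0) = (a == 0).
Proof.
by rewrite paddr_eq0 ?sqr_ge0 // !sqrf_eq0 eq_complex.
Qed.
Lemma mul_conj_sqabs a : a * a^* = (sqabs a)%:C%C.
Proof.
by case: a => r s; rewrite /sqabs; simpc; congr (_ +i* _)%C; ring.
Qed.

Lemma ip_sqnorm x : ip x x = (sqnorm x)%:C%C.
Proof.
have := dnorm_ge0 ip x; rewrite /sqnorm; case: (ip x x) => r s.
by rewrite lecE => /andP[/eqP /= ->].
Qed.
Lemma sqnorm_ge0 x : 0 <= sqnorm x.
Proof. by have := dnorm_ge0 ip x; rewrite ip_sqnorm lecR. Qed.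
Lemma sqnorm_eq0 x : (sqnorm x == 0) = (x == 0).
Proof.
by rewrite -(dnorm_eq0 ip x) ip_sqnorm eq_complex /= eqxx andbT.
Qed.
Lemma sqnorm0 : sqnorm 0 = 0.
Proof. by apply/eqP; rewrite sqnorm_eq0. Qed.
Lemma sqnorm_gt0 x : (0 < sqnorm x) = (x != 0).
Proof. by rewrite lt_def sqnorm_eq0 sqnorm_ge0 andbT. Qed.
Lemma sqnormD x y :
  sqnorm (x + y) = sqnorm x + sqnorm y + complex.Re (ip x y) *+ 2.
Proof.
by rewrite /sqnorm !ipDl !ipDr !complex_ReD (Re_ipC y x); ring.
Qed.
Lemma sqnormB x y :
  sqnorm (x - y) = sqnorm x + sqnorm y - complex.Re (ip x y) *+ 2.
Proof.
by rewrite /sqnorm !ipBl !ipBr !complex_ReB (Re_ipC y x); ring.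
Qed.
Lemma sqnormZ c x : sqnorm (c *: x) = sqabs c * sqnorm x.
Proof.
by rewrite /sqnorm ipZl ipZr mulrA mul_conj_sqabs complex_ReM /= mul0r subr0.
Qed.
Lemma sqnormN x : sqnorm (- x) = sqnorm x.
Proof. by rewrite /sqnorm linearNl linearNr opprK. Qed.
Lemma sqnormBC x y : sqnorm (x - y) = sqnorm (y - x).
Proof. by rewrite -opprB sqnormN. Qed.
Lemma sqnormDd x y : ip x y = 0 -> sqnorm (x + y) = sqnorm x + sqnorm y.
Proof. by rewrite sqnormD => -> /=; rewrite mul0rn addr0. Qed.
Lemma sqnorm_parallelogram x y :
  sqnorm (x + y) + sqnorm (x - y) = (sqnorm x + sqnorm y) *+ 2.
Proof. by rewrite sqnormD sqnormB; ring. Qed.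
Lemma sqnormD_le x y : sqnorm (x + y) <= (sqnorm x + sqnorm y) *+ 2.
Proof. by rewrite -sqnorm_parallelogram lerDl sqnorm_ge0. Qed.

Lemma sqnorm_proj x y : sqnorm y = 1 ->
  sqnorm (x - ip x y *: y) = sqnorm x - sqabs (ip x y).
Proof.
move=> y1; rewrite sqnormB sqnormZ y1 ipZr (mulrC _^*) mul_conj_sqabs /=.
ring.
Qed.

Lemma cauchy_schwarz x y : sqabs (ip x y) <= sqnorm x * sqnorm y.
Proof.
have [->|y0] := eqVneq y 0.
  by rewrite ip0r sqnorm0 mulr0 sqabs_real expr0n.
have ny : 0 < sqnorm y by rewrite sqnorm_gt0.
have := sqnorm_ge0 (x - (ip x y * ((sqnorm y)^-1)%:C%C) *: y).
rewrite sqnormB sqnormZ ipZr sqabsM sqabs_real.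
have -> : complex.Re ((ip x y * ((sqnorm y)^-1)%:C%C)^* * ip x y)
    = (sqnorm y)^-1 * sqabs (ip x y).
  rewrite complex_ReM Re_conj Im_conj complex_ReM complex_ImM /sqabs /=; ring.
set A := sqabs _; set n := sqnorm y => h.
rewrite -ler_pdivrMr// -subr_ge0.
suff <- : sqnorm x + A * n^-1 ^+ 2 * n - n^-1 * A *+ 2 = sqnorm x - A / n by [].
by field; rewrite gt_eqF.
Qed.

End InnerProduct.

(** * Two-dimensional moves and the Schur-Horn construction *)

Lemma dependent_choice_nat (T : Type) (P : nat -> T -> Prop)
    (Q : nat -> T -> T -> Prop) (x0 : T) :
  P 0%N x0 -> (forall n x, P n x -> exists y, P n.+1 y /\ Q n x y) ->
  exists f : nat -> T,
    f 0%N = x0 /\ forall n, P n (f n) /\ Q n (f n) (f n.+1).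
Proof.
move=> P0 step.
have /choice[g gP] : forall nx : nat * T, exists y,
    P nx.1 nx.2 -> P nx.1.+1 y /\ Q nx.1 nx.2 y.
  move=> [n x] /=; have [/step[y ?]|?] := pselect (P n x); first by exists y.
  by exists x.
pose f := fix f n := if n is m.+1 then g (m, f m) else x0.
have Pf n : P n (f n).
  by elim: n => //= n /(gP (n, f n))[].
by exists f; split => // n; split => //; exact: (gP (n, f n) (Pf n)).2.
Qed.

Section QuadraticForm.
Context {R : realType} {H : completeNormedModType R[i]}.
Variable ip : {dot H for @Num.conj R[i]}.
Notation sqnorm := (sqnorm ip).

(* The only property of [x |-> <E x, x>] that the constructions use: on a plane
   with orthogonal axes a suitable phase removes the cross term. *)
Definition quadratic (v : H -> R) : Prop :=
  forall p q, ip p q = 0 -> exists w : R[i], sqabs w = 1 /\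
    forall a b : R,
      v (a%:C%C *: p + (b%:C%C * w) *: q) = a ^+ 2 * v p + b ^+ 2 * v q.

Definition orthonormal_seq (Y : nat -> H) : Prop :=
  (forall k, sqnorm (Y k) = 1) /\ (forall j k, j <> k -> ip (Y j) (Y k) = 0).

Lemma quadratic_mix (v : H -> R) (p q : H) (d : R) : quadratic v ->
  sqnorm p = 1 -> sqnorm q = 1 -> ip p q = 0 -> v p <= d <= v q ->
  exists e e' : H,
  [/\ [/\ sqnorm e = 1, sqnorm e' = 1 & ip e e' = 0],
      v e = d /\ v e' = v p + v q - d,
      forall z, ip p z = 0 -> ip q z = 0 -> ip e z = 0 /\ ip e' z = 0,
      sqabs (ip e p) * (v q - v p) = v q - d
    & sqabs (ip e q) * (v q - v p) = d - v p].
Proof.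
move=> qv p1 q1 pq /andP[pd dq].
have [vE|vN] := eqVneq (v p) (v q).
  have dE : d = v p by apply/eqP; rewrite eq_le pd vE dq.
  exists p, q; split; [by []| | by [] | |].
  - by rewrite dE; split => //; ring.
  - by rewrite dE vE subrr mulr0.
  - by rewrite dE vE subrr mulr0.
have dpos : 0 < v q - v p by rewrite subr_gt0 lt_def eq_sym vN (le_trans pd dq).
(* The solution of [s * v p + (1 - s) * v q = d]. *)
pose s := (v q - d) / (v q - v p).
have s0 : 0 <= s by apply: divr_ge0; [rewrite subr_ge0|exact: ltW].
have s1 : 0 <= 1 - s by rewrite subr_ge0 ler_pdivrMr // mul1r lerD2l lerN2.
have [w [w1 wP]] := qv p q pq.
pose a := Num.sqrt s; pose b := Num.sqrt (1 - s).
have a2 : a ^+ 2 = s by rewrite sqr_sqrtr.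
have b2 : b ^+ 2 = 1 - s by rewrite sqr_sqrtr.
have sE : s * (v q - v p) = v q - d by rewrite divfK // gt_eqF.
have qp : ip q p = 0 by exact: ipC0.
have pp : ip p p = 1 by rewrite ip_sqnorm p1.
have qq : ip q q = 1 by rewrite ip_sqnorm q1.
have ort (x y : R[i]) : ip (x *: p) (y *: q) = 0 by rewrite ipZl ipZr pq !mulr0.
exists (a%:C%C *: p + (b%:C%C * w) *: q), (b%:C%C *: p + ((- a)%:C%C * w) *: q).
split.
- split.
  + rewrite sqnormDd // !sqnormZ sqabsM !sqabs_real p1 q1 w1 a2 b2; ring.
  + rewrite sqnormDd // !sqnormZ sqabsM !sqabs_real p1 q1 w1 sqrrN a2 b2; ring.
  + rewrite ipDl !ipDr !ipZl !ipZr pq qp pp qq !mulr0 addr0 add0r !mulr1.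
    have cr (r : R) : (r%:C%C)^* = (r%:C)%C :> R[i].
      by apply/eqP; rewrite eq_complex /= oppr0 !eqxx.
    have -> : b%:C%C * w * ((- a)%:C%C * w)^* = (b * - a)%:C%C.
      by rewrite [(_ * w)^*]rmorphM mulrACA mul_conj_sqabs w1 mulr1 /= cr -rmorphM.
    by rewrite cr -rmorphM -rmorphD /= mulrN mulrC subrr.
- rewrite !wP sqrrN a2 b2; split.
    by transitivity (v q - s * (v q - v p)); [ring|rewrite sE; ring].
  by transitivity (v p + s * (v q - v p)); [ring|rewrite sE; ring].
- by move=> z pz qz; rewrite !ipDl !ipZl pz qz !mulr0 addr0.
- by rewrite ipDl !ipZl pp qp mulr0 addr0 mulr1 sqabs_real a2.
- rewrite ipDl !ipZl pq qq mulr0 add0r mulr1 sqabsM sqabs_real w1 b2 mulr1.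
  by rewrite mulrBl mul1r sE; ring.
Qed.

Section SchurHorn.
Variables (v : H -> R) (qv : quadratic v) (dt : nat -> R).

(** Neither the demands nor the values along [Y] have to be sorted: any finite set of demands is
    compared with the prefix of [Y] of the same length. The last clause guarantees a place where the
    values cross a given demand. *)
Definition majorized_by (U : set nat) (Y : nat -> H) : Prop :=
  [/\ orthonormal_seq Y,
      forall F : seq nat, uniq F -> (forall i, i \in F -> U i) ->
        \sum_(i <- F) dt i <= \sum_(k < size F) v (Y k)
    & forall i, U i -> exists K, forall k, (K <= k)%N -> v (Y k) < dt i].

(** The neighbours [Y k], [Y k.+1] at the first crossing of the demand are mixed. The remainder [e']
    takes place [k] and the tail moves down by one. Prefixes of length at most [k] are unchanged; a
    longer one of length [n] has the old sum of length [n.+1] minus [dt i], and that old sum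
    dominated the demands with [i] included. *)
Lemma majorized_step (U : set nat) (Y : nat -> H) (i : nat) :
  majorized_by U Y -> U i -> exists (e : H) (Y' : nat -> H),
  [/\ sqnorm e = 1, v e = dt i, majorized_by (U `\ i) Y',
      forall k, ip e (Y' k) = 0
    & forall z, (forall k, ip (Y k) z = 0) ->
        ip e z = 0 /\ forall k, ip (Y' k) z = 0].
Proof.
move=> [[Y1 Yo] YF Yt] Ui; set d := dt i.
have [K KP] := Yt i Ui.
have Y0 : d <= v (Y 0%N).
  have := YF [:: i] isT; rewrite big_seq1 /= big_ord1; apply.
  by move=> j; rewrite inE => /eqP ->.
have [k [kP kd]] : exists k, (forall j, (j <= k)%N -> d <= v (Y j)) /\
    v (Y k.+1) < d.
  have ex : exists k, v (Y k) < d by exists K; exact: KP.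
  case: (ex_minnP ex) => -[|k] kd kmin; first by rewrite ltNge Y0 in kd.
  exists k; split => // j jk; rewrite leNgt; apply/negP => /kmin.
  by rewrite ltnNge jk.
have oSk : ip (Y k.+1) (Y k) = 0 by apply: Yo; lia.
have [|e [e' [[e1 e'1 ee'] [ve ve'] ez _ _]]] :=
    @quadratic_mix v (Y k.+1) (Y k) d qv (Y1 _) (Y1 _) oSk.
  by rewrite (ltW kd) kP.
pose Y' j := if (j < k)%N then Y j else if j == k then e' else Y j.+1.
have eY' j : j <> k -> ip e (Y' j) = 0 /\ ip e' (Y' j) = 0.
  rewrite /Y' => jk; case: ltnP => [|] jk'; last case: eqP => // _.
    by apply: ez; apply: Yo; lia.
  by apply: ez; apply: Yo; lia.
have Y'k : Y' k = e' by rewrite /Y' ltnn eqxx.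
exists e, Y'; split => //.
- split.
  + split=> [j|j l jl].
      by rewrite /Y'; do 2 case: ifP => _ //.
    have [jk|jk] := eqVneq j k.
      by rewrite jk Y'k; apply: (eY' _ _).2 => lk; apply: jl; rewrite jk lk.
    have [lk|lk] := eqVneq l k.
      by rewrite lk Y'k; apply: ipC0; apply: (eY' _ _).2; exact/eqP.
    rewrite /Y' (negbTE jk) (negbTE lk).
    by case: ifP; case: ifP => ? ?; apply: Yo; move: jk lk => /eqP ? /eqP ?; lia.
  + move=> F uF FU; have [Fk|kF] := leqP (size F) k.
      rewrite (le_trans (YF F uF _)) //; first by move=> j /FU [].
      rewrite ler_sum // => j _; rewrite /Y'.
      by rewrite (leq_trans (ltn_ord j) Fk).
    have := YF (i :: F); rewrite /= uF big_cons andbT.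
    have iF : i \notin F by apply/negP => /FU [_]; exact.
    move=> /(_ iF) h.
    have : dt i + \sum_(j <- F) dt j <= \sum_(j < (size F).+1) v (Y j).
      by apply: h => j; rewrite inE => /orP[/eqP -> //|/FU []].
    suff -> : \sum_(j < (size F).+1) v (Y j) =
        dt i + \sum_(j < size F) v (Y' j) by rewrite lerD2l.
    rewrite -!(big_mkord xpredT (fun j => v (Y j))).
    rewrite -(big_mkord xpredT (fun j => v (Y' j))).
    rewrite (big_cat_nat (n := k)) //=; last by lia.
    rewrite [in RHS](big_cat_nat (n := k)) //=; last by lia.
    rewrite [\sum_(k <= i0 < (size F).+1) _]big_ltn; last by lia.
    rewrite [\sum_(k.+1 <= i0 < (size F).+1) _]big_ltn; last by lia.
    rewrite [\sum_(k <= i0 < size F) _]big_ltn; last by lia.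
    rewrite Y'k ve' -/d big_add1 /=.
    rewrite (@eq_big_nat _ _ _ 0 k (fun j => v (Y' j)) (fun j => v (Y j))); last first.
      by move=> j /andP[_ jk]; rewrite /Y' jk.
    rewrite (@eq_big_nat _ _ _ k.+1 (size F) (fun j => v (Y' j))
      (fun j => v (Y j.+1))); last first.
      by move=> j /andP[kj _]; rewrite /Y' ltnNge (ltnW kj) /= gtn_eqF.
    ring.
  + move=> j [Uj _]; have [L LP] := Yt j Uj.
    exists (maxn L k.+1) => l; rewrite geq_max => /andP[Ll kl].
    rewrite /Y' ltnNge (ltnW kl) /= gtn_eqF //; apply: LP; lia.
- move=> j; have [->|jk] := eqVneq j k; first by rewrite Y'k.
  by apply: (eY' _ _).1; exact/eqP.
- move=> z Yz; split; first exact: (ez z _ _).1.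
  move=> j; rewrite /Y'; case: ifP => _ //; case: ifP => _ //.
  exact: (ez z _ _).2.
Qed.

(** Demands are met in index order, each from the sequence left over by the step before. Later
    vectors are orthogonal to [e i] because they are built from a remainder orthogonal to it. *)
Lemma schur_horn_family (U : set nat) (Y : nat -> H) : majorized_by U Y ->
  exists e : nat -> H,
  [/\ forall i, U i -> sqnorm (e i) = 1 /\ v (e i) = dt i,
      forall i, ~ U i -> e i = 0,
      forall i j, i <> j -> ip (e i) (e j) = 0
    & forall z, (forall k, ip (Y k) z = 0) -> forall i, ip (e i) z = 0].
Proof.
move=> Ymaj.
pose P n (s : (nat -> H) * H) := majorized_by [set i | U i /\ (n <= i)%N] s.1.
pose Q n (s t : (nat -> H) * H) :=
  [/\ U n -> sqnorm t.2 = 1 /\ v t.2 = dt n, ~ U n -> t.2 = 0,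
      forall k, ip t.2 (t.1 k) = 0
    & forall z, (forall k, ip (s.1 k) z = 0) ->
        ip t.2 z = 0 /\ forall k, ip (t.1 k) z = 0].
have [||f [f0 fP]] := @dependent_choice_nat _ P Q (Y, 0).
- rewrite /P /=; suff -> : [set i | U i /\ (0 <= i)%N] = U by [].
  by apply/seteqP; split => i //= [].
- move=> n s Ps; have [Un|Un] := pselect (U n).
    have [|e [Y' [e1 ve Y'm eY' Y'z]]] := majorized_step (i := n) Ps; first by [].
    exists (Y', e); split; last by split.
    rewrite /P /=; move: Y'm; congr (majorized_by _ _).
    apply/seteqP; split => i /=.
      by move=> [[Ui ni] /eqP ?]; split => //; lia.
    by move=> [Ui ni]; split; [split => //; lia|move=> /= h; lia].
  exists (s.1, 0); split; last first.
    by split => //= [k|z sz]; rewrite ?ip0l.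
  rewrite /P /=; move: Ps; congr (majorized_by _ _).
  apply/seteqP; split => i /= [Ui ni]; split => //; last by lia.
  rewrite ltn_neqAle ni andbT; apply/eqP => nE; apply: Un; by rewrite nE.
have down n m z : (n <= m)%N -> (forall k, ip ((f n).1 k) z = 0) ->
    forall k, ip ((f m).1 k) z = 0.
  move=> /subnK <-; elim: (m - n)%N => //= l IH h.
  by have [_ [_ _ _ /(_ z (IH h))[]]] := fP (l + n)%N.
have ort i j : (i < j)%N -> ip (f i.+1).2 (f j.+1).2 = 0.
  move=> ij; apply: ipC0.
  have [_ [_ _ fi _]] := fP i; have [_ [_ _ _ fj]] := fP j.
  by apply: (fj _ _).1; apply: (down i.+1) => // k; exact: ipC0.
exists (fun n => (f n.+1).2); split.
- by move=> i; have [_ []] := fP i.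
- by move=> i; have [_ []] := fP i.
- move=> i j ij; case: (ltngtP i j) => // h; first exact: ort.
  by apply: ipC0; exact: ort.
- move=> z Yz i; have [_ [_ _ _ fi]] := fP i.
  by apply: (fi _ _).1; apply: (down 0%N) => //; rewrite f0.
Qed.

End SchurHorn.
End QuadraticForm.

(** * Absorption *)

Section Schedule.
Context {R : realType}.

Definition divergent (w : nat -> R) : Prop :=
  forall B : R, exists n, B <= \sum_(0 <= i < n) w i.

Lemma divergent_tail (w : nat -> R) (m : nat) (B : R) :
  (forall i, 0 <= w i) -> divergent w ->
  exists n, (m < n)%N /\ B <= \sum_(m <= i < n) w i.
Proof.
move=> w0 dw; have [n nP] := dw (B + \sum_(0 <= i < m) w i).
exists (maxn m.+1 n); split; first by rewrite leq_maxl.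
rewrite -(lerD2r (\sum_(0 <= i < m) w i)) (le_trans nP) //.
rewrite [leRHS]addrC -big_cat_nat //=; last by rewrite leq_max leqnSn.
rewrite [leRHS](big_cat_nat (n := n)) //= ?leq_maxr // lerDl.
by apply: sumr_ge0.
Qed.

Lemma infinite_fibers :
  exists f : nat -> nat, forall k m, exists t, (m <= t)%N /\ f t = k.
Proof.
(* [logn 2] takes the value [k] at [2 ^ k] times any odd number. *)
exists (logn 2) => k m; exists (2 ^ k * m.*2.+1)%N; split.
  rewrite (@leq_trans m.*2.+1) //; first by rewrite -addnn; lia.
  by rewrite leq_pmull // expn_gt0.
rewrite lognM // ?expn_gt0 // pfactorK // lognE /=.
by rewrite dvdn2 /= odd_double addn0.
Qed.

(** The indices are cut into consecutive blocks of weight at least 1, and every [k] receives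
    infinitely many whole blocks. *)
Lemma schedule (w : nat -> R) : (forall i, 0 <= w i) -> divergent w ->
  exists s : nat -> nat,
    forall k, divergent (fun n => if s n == k then w n else 0).
Proof.
move=> w0 dw.
have /choice[g gP] m := divergent_tail m 1 w0 dw.
pose N t := iter t g 0%N.
have Nlt t : (N t < N t.+1)%N by exact: (gP (N t)).1.
have Nmono a b : (a <= b)%N -> (N a <= N b)%N.
  move=> /subnK <-; elim: (b - a)%N => // c IH.
  by rewrite addSn (leq_trans IH) // ltnW.
have Nge t : (t <= N t)%N by elim: t => // t IH; apply: leq_ltn_trans (Nlt t).
have /choice[blk blkP] n : exists t, (N t <= n < N t.+1)%N.
  elim: n => [|n [t /andP[h1 h2]]]; first by exists 0%N; rewrite (Nlt 0%N).
  have [h|h] := ltnP n.+1 (N t.+1); first by exists t; rewrite h (leqW h1).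
  exists t.+1; rewrite h /= (leq_ltn_trans h2) //.
have [f fP] := infinite_fibers.
have blkE n t : (N t <= n < N t.+1)%N -> blk n = t.
  move=> /andP[h1 h2]; have /andP[b1 b2] := blkP n.
  case: (ltngtP (blk n) t) => // c; have := Nmono _ _ c; lia.
exists (f \o blk) => k B.
suff [n nP] : exists n, (Num.truncn B).+1%:R <=
    \sum_(0 <= i < n) (if (f \o blk) i == k then w i else 0).
  exists n; rewrite (le_trans _ nP) //.
  have [B0|B0] := ltP B 0; first by rewrite (le_trans (ltW B0)).
  by apply: ltW; exact: Num.Theory.truncnS_gt.
elim: (Num.truncn B).+1 => [|b [n nP]].
  by exists 0%N; rewrite big_geq.
have [t [nt ft]] := fP k n; exists (N t.+1).
have nN : (n <= N t)%N by rewrite (leq_trans nt).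
rewrite (big_cat_nat (n := N t)) //=; last exact: ltnW.
rewrite -addn1 natrD lerD //.
  rewrite (le_trans nP) // (big_cat_nat (n := n) (p := N t)) //= lerDl.
  by apply: sumr_ge0 => i _; case: ifP.
rewrite (le_trans (gP (N t)).2) // le_eqVlt; apply/orP; left; apply/eqP.
by apply: eq_big_nat => i /blkE /= ->; rewrite ft eqxx.
Qed.

End Schedule.

Section Absorption.
Context {R : realType} {H : completeNormedModType R[i]}.
Variable ip : {dot H for @Num.conj R[i]}.
Notation sqnorm := (sqnorm ip).

Definition residual (e : nat -> H) (n : nat) (z : H) : H :=
  z - \sum_(0 <= i < n) ip z (e i) *: e i.

Lemma residual_recr e n z :
  residual e n.+1 z = residual e n z - ip z (e n) *: e n.
Proof. by rewrite /residual big_nat_recr //= opprD addrA. Qed.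

Lemma eq_residual e e' n z : (forall i, (i < n)%N -> e i = e' i) ->
  residual e n z = residual e' n z.
Proof.
move=> ee'; congr (_ - _); apply: eq_big_nat => i /andP[_ /ee' ->//].
Qed.

Lemma ip_residual e n z x : (forall i, (i < n)%N -> ip (e i) x = 0) ->
  ip (residual e n z) x = ip z x.
Proof.
move=> ex; rewrite /residual ipBl ip_suml big1_seq ?subr0 // => i.
by rewrite mem_index_iota => /andP[_ /andP[_ /ex h]]; rewrite ipZl h mulr0.
Qed.

Lemma residual_orth e n z j : (j < n)%N ->
  (forall i, (i < n)%N -> sqnorm (e i) = 1) ->
  (forall i k, (i < n)%N -> (k < n)%N -> i <> k -> ip (e i) (e k) = 0) ->
  ip (residual e n z) (e j) = 0.
Proof.
move=> jn e1 eo; rewrite /residual ipBl ip_suml.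
rewrite (bigD1_seq j) ?mem_index_iota ?iota_uniq //= ipZl ip_sqnorm e1 //.
rewrite mulr1 big1_seq ?addr0 ?subrr // => i /andP[/eqP ij].
by rewrite mem_index_iota => /andP[_ ik]; rewrite ipZl eo ?mulr0.
Qed.

Lemma sqnorm_residual_recr e n z : sqnorm (e n) = 1 ->
  (forall i, (i < n)%N -> ip (e i) (e n) = 0) ->
  sqnorm (residual e n.+1 z) =
    sqnorm (residual e n z) - sqabs (ip (residual e n z) (e n)).
Proof.
move=> e1 eo; rewrite residual_recr -(ip_residual z (x := e n) eo).
exact: sqnorm_proj.
Qed.

Variables (v : H -> R) (qv : quadratic ip v) (M : R).
Hypothesis vM : forall x, sqnorm x = 1 -> `|v x| <= M.
Variables (d w : nat -> R) (q u : nat -> H).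
Hypothesis w0 : forall i, 0 <= w i.
Hypothesis dw : divergent w.
Hypothesis qo : forall i j, i <> j -> ip (q i) (q j) = 0.
Hypothesis uo : orthonormal_seq ip u.
Hypothesis qu : forall i k, ip (q i) (u k) = 0.
Hypothesis lower : forall i, (sqnorm (q i) = 1 /\ v (q i) <= d i - w i) \/
  (forall m, exists k, (m <= k)%N /\ v (u k) <= d i - w i).
Hypothesis upper : forall i, (sqnorm (q i) = 1 /\ d i + w i <= v (q i)) \/
  (forall m, exists k, (m <= k)%N /\ d i + w i <= v (u k)).

Let M0 : 0 <= M.
Proof. by apply: le_trans (vM (uo.1 0%N)). Qed.

(** Orthogonality to the raw vectors that are still to be drawn. *)
Definition fresh (n m : nat) (x : H) : Prop :=
  (forall i, (n <= i)%N -> ip (q i) x = 0) /\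
  (forall k, (m <= k)%N -> ip (u k) x = 0).

(** If [d n <= v x], then [x] is mixed with a vector of value at most [d n - w n], otherwise with
    one of value at least [d n + w n]. The share of [x] in [e] is then at least [w n] divided by a
    difference of two values, which is at most [2 * M]. *)
Let mix_fresh n m x : sqnorm x = 1 -> fresh n m x ->
  exists (e p : H) (m' : nat),
  [/\ sqnorm e = 1 /\ v e = d n, (m <= m')%N /\ (n < m')%N, fresh n.+1 m' e,
      w n <= sqabs (ip x e) * (2 * M)
    & (p = q n \/ exists2 k, (m <= k)%N & p = u k) /\
      forall z, ip p z = 0 -> ip x z = 0 -> ip e z = 0].
Proof.
move=> x1 [qx ux].
have pickp (P : H -> Prop) : (sqnorm (q n) = 1 /\ P (q n)) \/
    (forall m, exists k, (m <= k)%N /\ P (u k)) ->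
    exists (p : H) (m' : nat),
    [/\ sqnorm p = 1 /\ P p, (m <= m')%N /\ (n < m')%N, fresh n.+1 m' p, ip p x = 0
      & p = q n \/ exists2 k, (m <= k)%N & p = u k].
  case=> [[q1 Pq]|/(_ m)[k [mk Pk]]].
    (* Taking [n.+1] into the maximum keeps the counter at least as large as the step number, so a
       target that is fresh from some index on is usable in all late steps. *)
    exists (q n), (maxn m n.+1); split=> //.
    - by rewrite leq_maxl leq_maxr.
    - by split=> i ni; [apply: qo; lia|exact/ipC0/qu].
    - exact: qx.
    - by left.
  exists (u k), (maxn k.+1 n.+1); split=> //.
  - by split=> //; apply: uo.1.
  - by rewrite leq_maxr leq_max (leqW mk).
  - split=> i ni; first exact: qu.
    by apply: uo.2; move: ni; rewrite geq_max => /andP[? _]; lia.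
  - exact: ux.
  - by right; exists k.
have bound (y z : H) : sqnorm y = 1 -> sqnorm z = 1 -> v y - v z <= 2 * M.
  move=> /vM /ler_normlP[_ h1] /vM /ler_normlP[h2 _].
  by rewrite mulrDl mul1r lerD // lerNl.
have [dx|xd] := leP (d n) (v x).
  have [p [m' [[p1 vp] mm' fp px pE]]] := pickp (fun p => v p <= d n - w n) (lower n).
  have [|e [e' [[e1 _ _] [ve _] ez _ es]]] := quadratic_mix (d := d n) qv p1 x1 px.
    by rewrite dx andbT (le_trans vp) // gerBl.
  exists e, p, m'; split => //.
  - split=> i ni; apply: ipC0; apply: (ez _ _ _).1.
    + by apply: ipC0; exact: fp.1.
    + by apply: ipC0; apply: qx; exact: ltnW.
    + by apply: ipC0; exact: fp.2.
    + by apply: ipC0; apply: ux; apply: leq_trans ni; exact: mm'.1.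
  - rewrite ipC sqabs_conj (@le_trans _ _ (d n - v p)) //.
      by rewrite lerBrDl -lerBrDr.
    by rewrite -es ler_wpM2l ?sqabs_ge0 ?bound.
  - by split => // z pz xz; exact: (ez _ _ _).1.
have [p [m' [[p1 vp] mm' fp px pE]]] := pickp (fun p => d n + w n <= v p) (upper n).
have xp := ipC0 px.
have [|e [e' [[e1 _ _] [ve _] ez es _]]] := quadratic_mix (d := d n) qv x1 p1 xp.
  by rewrite (ltW xd) /= (le_trans _ vp) // lerDl.
exists e, p, m'; split => //.
- split=> i ni; apply: ipC0; apply: (ez _ _ _).1.
  + by apply: ipC0; apply: qx; exact: ltnW.
  + by apply: ipC0; exact: fp.1.
  + by apply: ipC0; apply: ux; apply: leq_trans ni; exact: mm'.1.
  + by apply: ipC0; exact: fp.2.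
- rewrite ipC sqabs_conj (@le_trans _ _ (v p - d n)) //; first by rewrite lerBrDl.
  by rewrite -es ler_wpM2l ?sqabs_ge0 ?bound.
- by split => // z pz xz; exact: (ez _ _ _).1.
Qed.

Let invariant (n : nat) (st : (nat -> H) * nat) : Prop :=
  [/\ forall i, (i < n)%N -> sqnorm (st.1 i) = 1 /\ v (st.1 i) = d i,
      forall i j, (i < n)%N -> (j < n)%N -> i <> j -> ip (st.1 i) (st.1 j) = 0,
      forall i, (i < n)%N -> fresh n st.2 (st.1 i)
    & (n <= st.2)%N].

Let progress (z : nat -> H) (n : nat) (st st' : (nat -> H) * nat) : Prop :=
  [/\ forall i, (i < n)%N -> st'.1 i = st.1 i, (st.2 <= st'.2)%N
    & fresh n st.2 (z n) ->
      w n * sqnorm (residual st.1 n (z n)) <=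
      2 * M * (sqnorm (residual st.1 n (z n)) -
               sqnorm (residual st'.1 n.+1 (z n)))].

Let absorption_step z n st : invariant n st ->
  exists st', invariant n.+1 st' /\ progress z n st st'.
Proof.
case: st => e m [/= e1 eo ef nm].
set r := residual e n (z n).
pose ready := fresh n m (z n) /\ r != 0.
have [x [m0 [x1 mm0 xf xe xr]]] : exists (x : H) (m0 : nat),
    [/\ sqnorm x = 1, (m <= m0)%N, fresh n m0 x,
        forall i, (i < n)%N -> ip (e i) x = 0
      & ready -> r = (Num.sqrt (sqnorm r))%:C%C *: x].
  have [[zf r0]|nr] := pselect ready; last first.
    (* Without a usable target, a spare vector is mixed in its place. *)
    exists (u m), m.+1; split => //.
    - exact: uo.1.
    - by split=> [i _|k mk]; [exact: qu|apply: uo.2; lia].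
    - by move=> i ni; apply: ipC0; apply: (ef i ni).2.
  have sr : 0 < Num.sqrt (sqnorm r) by rewrite sqrtr_gt0 sqnorm_gt0.
  have fr i (y : H) : ip (z n) y = 0 -> (forall j, (j < n)%N -> ip (e j) y = 0) ->
      ip y (i *: r) = 0.
    move=> zy ey; rewrite ipZr (ipC0 (x := r)) ?mulr0 //.
    by rewrite /r ip_residual.
  exists ((Num.sqrt (sqnorm r))^-1%:C%C *: r), m; split => //.
  - rewrite sqnormZ sqabs_real exprVn sqr_sqrtr ?sqnorm_ge0 // mulVf //.
    by rewrite sqnorm_eq0.
  - split=> i ni; apply: fr.
    + by apply: ipC0; exact: zf.1.
    + by move=> j jn; apply: ipC0; exact: (ef j jn).1.
    + by apply: ipC0; exact: zf.2.
    + by move=> j jn; apply: ipC0; exact: (ef j jn).2.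
  - move=> i ni; rewrite ipZr (ipC0 (x := r)) ?mulr0 //.
    by apply: residual_orth => // j /e1[].
  - by move=> _; rewrite scalerA -rmorphM mulfV ?scale1r // gt_eqF.
have [y [p [m' [[y1 vy] [mm' nm'] fy wy [pE yz]]]]] := mix_fresh x1 xf.
have ey i : (i < n)%N -> ip (e i) y = 0.
  move=> ni; apply: ipC0; apply: yz; last by apply: ipC0; exact: xe.
  case: pE => [->|[k mk ->]]; first by apply: (ef i ni).1.
  by apply: (ef i ni).2; exact: leq_trans mk.
pose e' i := if i == n then y else e i.
have e'n : e' n = y by rewrite /e' eqxx.
have e'lt i : (i < n)%N -> e' i = e i by rewrite /e'; case: eqP => //; lia.
have e'y i : (i < n)%N -> ip (e' i) y = 0 by move=> ni; rewrite e'lt // ey.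
exists (e', m'); split; first split => //=.
- by move=> i; rewrite ltnS leq_eqVlt => /orP[/eqP ->|ni];
    rewrite ?e'n // e'lt //; exact: e1.
- move=> i j; rewrite !ltnS leq_eqVlt => /orP[/eqP ->|ni];
    rewrite leq_eqVlt => /orP[/eqP ->|nj] ij //; rewrite ?e'n.
  + by apply: ipC0; exact: e'y.
  + exact: e'y.
  + by rewrite !e'lt //; exact: eo.
- move=> i; rewrite ltnS leq_eqVlt => /orP[/eqP ->|ni]; rewrite ?e'n //.
  rewrite e'lt //; split=> k nk; first by apply: (ef i ni).1; exact: ltnW.
  by apply: (ef i ni).2; apply: leq_trans nk; apply: leq_trans mm'.
split=> //=; first exact: leq_trans mm'.
move=> zf; rewrite sqnorm_residual_recr ?e'n //.
rewrite (@eq_residual e' e) // -/r opprB addrC subrK.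
have [r0|r0] := eqVneq r 0.
  by rewrite r0 sqnorm0 mulr0 mulr_ge0 ?sqabs_ge0 // mulr_ge0.
have rE := xr (conj zf r0); rewrite [X in ip X _]rE ipZl sqabsM sqabs_real.
rewrite sqr_sqrtr ?sqnorm_ge0 // mulrC mulrA (mulrC (2 * M)) -mulrA.
by rewrite ler_wpM2l ?sqnorm_ge0 // mulrC.
Qed.

(** If the squared residuals [rho n] of a target stayed at least [eps], every step scheduled for it
    would give [w n * eps <= 2 * M * (rho n - rho n.+1)]. The right-hand sides telescope to a
    bounded sum, while the scheduled weights have infinite sum. *)
Lemma absorption (tg : nat -> H) :
  (forall k, exists m, fresh m m (tg k)) ->
  exists e : nat -> H, [/\ orthonormal_seq ip e, forall i, v (e i) = d i
    & forall k (eps : R), 0 < eps -> exists n, sqnorm (residual e n (tg k)) < eps].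
Proof.
move=> tgf; have [s sP] := schedule w0 dw.
have [||f [f0 fP]] := @dependent_choice_nat _ invariant
    (progress (fun n => tg (s n))) (fun=> 0, 0%N).
- by [].
- by move=> n st /absorption_step-/(_ (fun n => tg (s n))).
pose e n := (f n.+1).1 n.
have fe n i : (i < n)%N -> (f n).1 i = e i.
  elim: n => // n IH; rewrite ltnS leq_eqVlt => /orP[/eqP ->//|ni].
  by have [_ [-> // _ _]] := fP n; exact: IH.
have e1 i : sqnorm (e i) = 1 /\ v (e i) = d i.
  by have [[h _ _ _] _] := fP i.+1; exact: h.
have eo : orthonormal_seq ip e.
  split=> [i|i j ij]; first exact: (e1 i).1.
  have [[_ h _ _] _] := fP (maxn i j).+1.
  rewrite -(fe (maxn i j).+1 i) ?ltnS ?leq_maxl //.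
  by rewrite -(fe (maxn i j).+1 j) ?ltnS ?leq_maxr //; apply: h;
    rewrite ?ltnS ?leq_maxl ?leq_maxr.
exists e; split => // [i|k eps eps0]; first exact: (e1 i).2.
have [n0 n0f] := tgf k; pose rho n := sqnorm (residual e n (tg k)).
have rho_dec n : rho n.+1 <= rho n.
  rewrite /rho sqnorm_residual_recr; first by rewrite gerBl sqabs_ge0.
    exact: (e1 n).1.
  by move=> i ni; apply: eo.2; lia.
have step n : (n0 <= n)%N -> s n = k ->
    w n * rho n <= 2 * M * (rho n - rho n.+1).
  move=> nn sn; have [[_ _ _ nm] [_ _]] := fP n.
  rewrite sn (@eq_residual _ e) ?(@eq_residual (f n.+1).1 e); last exact: fe.
    apply; split=> i ni; [apply: n0f.1|apply: n0f.2].
      exact: leq_trans ni.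
    by apply: leq_trans ni; exact: leq_trans nm.
  exact: fe.
apply: contrapT => nlt.
have rho_ge n : eps <= rho n.
  by rewrite leNgt; apply/negP => h; apply: nlt; exists n.
(* One more than the total weight that the telescoped bound permits. *)
have [|n [n0n nP]] := @divergent_tail _ _ n0 (2 * M * rho n0 / eps + 1) _ (sP k).
  by move=> i; case: ifP.
have tele l : eps * \sum_(n0 <= i < n0 + l) (if s i == k then w i else 0) <=
    2 * M * (rho n0 - rho (n0 + l)%N).
  elim: l => [|l IH]; first by rewrite addn0 big_geq // subrr !mulr0.
  rewrite addnS big_nat_recr ?leq_addr //= mulrDr.
  have -> : rho n0 - rho (n0 + l).+1 =
      (rho n0 - rho (n0 + l)%N) + (rho (n0 + l)%N - rho (n0 + l).+1) by ring.
  rewrite [leRHS]mulrDr lerD //.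
  case: (eqVneq (s (n0 + l)%N) k) => [sl|_]; last first.
    by rewrite mulr0 mulr_ge0 ?subr_ge0 // mulr_ge0.
  apply: le_trans (step _ (leq_addr _ _) sl).
  by rewrite mulrC ler_wpM2l.
have := tele (n - n0)%N; rewrite subnKC; last exact: ltnW.
move=> h; move: nP; rewrite leNgt => /negP; apply.
rewrite -(ltr_pM2l eps0) (le_lt_trans h) //.
have -> : eps * (2 * M * rho n0 / eps + 1) = 2 * M * rho n0 + eps.
  by field; rewrite gt_eqF.
have : 0 <= 2 * M * rho n by rewrite !mulr_ge0 ?sqnorm_ge0.
by rewrite mulrBr; lra.
Qed.

End Absorption.

(** * Projections *)

Section HilbertTopology.
Context {R : realType} {H : completeNormedModType R[i]}.
Variable ip : {dot H for @Num.conj R[i]}.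
Hypothesis ip_norm : norm_of_inner ip.
Notation sqnorm := (sqnorm ip).

Lemma norm_sqnorm (x : H) : `|x| = (Num.sqrt (sqnorm x))%:C%C.
Proof.
apply/eqP; rewrite -(@eqrXn2 _ 2) // ?normr_ge0 //; last by rewrite lecR sqrtr_ge0.
by rewrite ip_norm ip_sqnorm -rmorphXn /= sqr_sqrtr // sqnorm_ge0.
Qed.

Lemma pos_complex (e : R[i]) : 0 < e -> exists2 r : R, 0 < r & e = r%:C%C.
Proof.
case: e => a b; rewrite ltcE /= => /andP[/eqP b0 a0]; exists a => //.
by rewrite b0.
Qed.

Lemma norm_lt_sqnorm (x : H) (r : R) : 0 < r ->
  (`|x| < r%:C%C) = (sqnorm x < r ^+ 2).
Proof.
move=> r0; rewrite norm_sqnorm ltcR -(@ltr_pXn2r _ 2) ?nnegrE ?sqrtr_ge0 ?(ltW r0) //.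
by rewrite sqr_sqrtr // sqnorm_ge0.
Qed.

(** Norms and radii of balls live in [R[i]]; this lets all later estimates be made with the real
    number [sqnorm]. *)
Lemma nbhs_sqnormP (x : H) (B : set H) :
  nbhs x B <-> exists2 r : R, 0 < r & forall y, sqnorm (x - y) < r -> B y.
Proof.
split=> [/nbhs_ballP[e /= e0 eB]|[r r0 rB]].
  have [r r0 eE] := pos_complex e0; exists (r ^+ 2); first by rewrite exprn_gt0.
  by move=> y h; apply: eB; rewrite -ball_normE /ball_ /= eE norm_lt_sqnorm.
apply/nbhs_ballP; exists (Num.sqrt r)%:C%C; first by rewrite /= ltcR sqrtr_gt0.
move=> y; rewrite -ball_normE /ball_ /= norm_lt_sqnorm ?sqrtr_gt0 //.
by rewrite sqr_sqrtr ?ltW // => /rB.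
Qed.

Lemma closure_sqnormP (A : set H) (x : H) :
  closure A x <-> forall r : R, 0 < r -> exists y, A y /\ sqnorm (x - y) < r.
Proof.
split=> [cA r r0|h B /nbhs_sqnormP[r r0 rB]].
  have [|y [Ay yB]] := cA [set y | sqnorm (x - y) < r].
    by apply/nbhs_sqnormP; exists r.
  by exists y.
by have [y [Ay /rB By]] := h r r0; exists y.
Qed.

Lemma dense_sqnormP (A : set H) (x : H) (r : R) : dense A -> 0 < r ->
  exists y, A y /\ sqnorm (x - y) < r.
Proof.
move=> dA r0; have o : open (interior [set y | sqnorm (x - y) < r]).
  exact: open_interior.
have [|y [yo Ay]] := dA _ _ o.
  by exists x; apply/nbhs_sqnormP; exists r.
by exists y; split => //; exact: (interior_subset yo).
Qed.

Definition converges (u : nat -> H) (l : H) : Prop :=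
  forall r : R, 0 < r -> exists N, forall n, (N <= n)%N -> sqnorm (u n - l) < r.

Lemma hilbert_complete (u : nat -> H) :
  (forall r : R, 0 < r -> exists N, forall m n, (N <= m)%N -> (N <= n)%N ->
    sqnorm (u m - u n) < r) -> exists l, converges u l.
Proof.
move=> cu; have : cvg (u @ \oo).
  apply/cauchy_cvgP/cauchy_ballP => e e0.
  have [r r0 eE] := pos_complex e0.
  have [|N NP] := cu (r ^+ 2); first by rewrite exprn_gt0.
  exists ([set u n | n in [set n | (N <= n)%N]], [set u n | n in [set n | (N <= n)%N]]).
    by split; exists N => // n /= Nn; exists n.
  move=> [x y] /= [[m Nm <-] [n Nn <-]].
  by rewrite -ball_normE /ball_ /= eE norm_lt_sqnorm // NP.
move=> /cvg_ex[l ul]; exists l => r r0.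
have := ul [set y | sqnorm (l - y) < r].
case; first by apply/nbhs_sqnormP; exists r.
by move=> N _ NP; exists N => n /NP /=; rewrite sqnormBC.
Qed.

Lemma closed_converges (A : set H) (u : nat -> H) (l : H) :
  closed A -> (forall n, A (u n)) -> converges u l -> A l.
Proof.
move=> cA Au ul; apply: cA; apply/closure_sqnormP => r /ul[N NP].
by exists (u N); split => //; rewrite sqnormBC; exact: NP.
Qed.

Lemma closure_converges (A : set H) (x : H) : closure A x ->
  exists u : nat -> H, (forall n, A (u n)) /\ converges u x.
Proof.
move=> /closure_sqnormP cA.
have /choice[u uP] n : exists y, A y /\ sqnorm (x - y) < n.+1%:R^-1.
  by apply: cA; rewrite invr_gt0.
exists u; split=> [n|r r0]; first exact: (uP n).1.
exists (Num.truncn r^-1) => n Nn; rewrite sqnormBC (lt_le_trans (uP n).2) //.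
rewrite -[r]invrK lef_pV2 ?posrE ?invr_gt0 // ltW //.
by rewrite (lt_le_trans (Num.Theory.truncnS_gt _)) // ler_nat.
Qed.

Lemma sqabsD_le (a b : R[i]) : sqabs (a + b) <= (sqabs a + sqabs b) *+ 2.
Proof.
case: a b => [a1 a2] [b1 b2]; rewrite /sqabs /= -subr_ge0.
have -> : (a1 ^+ 2 + a2 ^+ 2 + (b1 ^+ 2 + b2 ^+ 2)) *+ 2 -
   ((a1 + b1) ^+ 2 + (a2 + b2) ^+ 2) = (a1 - b1) ^+ 2 + (a2 - b2) ^+ 2 by ring.
by rewrite addr_ge0 ?sqr_ge0.
Qed.

Lemma converges_ip (u : nat -> H) l (y : H) : converges u l ->
  (forall r : R, 0 < r -> exists N, forall n, (N <= n)%N ->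
    sqabs (ip (u n) y) < r) -> ip l y = 0.
Proof.
move=> ul uy; apply/eqP; rewrite -sqabs_eq0 eq_le sqabs_ge0 andbT leNgt.
apply/negP; set a := sqabs _ => a0.
have y1 : 0 < sqnorm y + 1 by rewrite ltr_wpDl ?sqnorm_ge0.
have [|N NP] := ul (a / 4 / (sqnorm y + 1)); first by rewrite !divr_gt0.
have [|N' NP'] := uy (a / 4); first by rewrite !divr_gt0.
have {NP} h := NP _ (leq_maxl N N'); have {NP'} h' := NP' _ (leq_maxr N N').
set n := maxn N N' in h h'.
have := sqabsD_le (- ip (u n - l) y) (ip (u n) y).
have -> : - ip (u n - l) y + ip (u n) y = ip l y by rewrite ipBl; ring.
have -> : sqabs (- ip (u n - l) y) = sqabs (ip (u n - l) y).
  by rewrite /sqabs; case: (ip _ _) => b c /=; rewrite !sqrrN.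
have := cauchy_schwarz ip (u n - l) y; move: h; rewrite ltr_pdivlMr // -/a.
have := sqnorm_ge0 ip (u n - l); nra.
Qed.

Definition lin_subspace (V : set H) : Prop :=
  V 0 /\ forall (a : R[i]) x y, V x -> V y -> V (a *: x + y).

Lemma subspaceD V x y : lin_subspace V -> V x -> V y -> V (x + y).
Proof. by move=> [_ VD] Vx Vy; rewrite -[x]scale1r; exact: VD. Qed.

Lemma subspaceZ V a x : lin_subspace V -> V x -> V (a *: x).
Proof. by move=> [V0 VD] Vx; rewrite -[_ *: _]addr0; exact: VD. Qed.

Lemma subspaceB V x y : lin_subspace V -> V x -> V y -> V (x - y).
Proof.
by move=> sV Vx Vy; apply: subspaceD => //; rewrite -scaleN1r; exact: subspaceZ.
Qed.

Lemma subspace_sum V (J : Type) (s : seq J) (F : J -> H) : lin_subspace V ->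
  (forall j, V (F j)) -> V (\sum_(j <- s) F j).
Proof.
move=> sV VF; elim/big_ind : _ => //; first exact: sV.1.
by move=> x y; exact: subspaceD.
Qed.

Lemma orthogonal_projection (V : set H) (x : H) : lin_subspace V -> closed V ->
  exists p, V p /\ forall y, V y -> ip (x - p) y = 0.
Proof.
move=> sV cV; pose S := [set sqnorm (x - y) | y in V].
have iS : has_inf S.
  split; first by exists (sqnorm (x - 0)), 0 => //; exact: sV.1.
  by exists 0 => _ [y _ <-]; exact: sqnorm_ge0.
have ge_inf y : V y -> inf S <= sqnorm (x - y).
  by move=> Vy; apply: ge_inf; [exact: iS.2|exists y].
have /choice[u uP] n : exists y, V y /\ sqnorm (x - y) < inf S + n.+1%:R^-1.
  have [|_ [y Vy <-] ylt] := inf_adherent (eps := n.+1%:R^-1) _ iS.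
    by rewrite invr_gt0.
  by exists y.
have uV n := (uP n).1.
have small (r : R) : 0 < r -> exists N, forall n, (N <= n)%N -> n.+1%:R^-1 < r.
  move=> r0; exists (Num.truncn r^-1) => n Nn.
  rewrite -[r]invrK ltf_pV2 ?posrE ?invr_gt0 //.
  by rewrite (lt_le_trans (Num.Theory.truncnS_gt _)) // ler_nat.
have [|p up] := hilbert_complete (u := u).
  move=> r r0; have [|N NP] := small (r / 4); first by rewrite divr_gt0.
  exists N => m n Nm Nn.
  have := sqnorm_parallelogram ip (x - u m) (x - u n).
  have -> : x - u m - (x - u n) = - (u m - u n).
    by rewrite [LHS]addrC !opprB addrA subrK.
  have -> : x - u m + (x - u n) = 2%:R *: (x - 2%:R^-1 *: (u m + u n)).
    rewrite scalerBr scalerA mulfV ?pnatr_eq0 // scale1r scaler_nat mulr2n.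
    by rewrite opprD addrACA.
  rewrite sqnormN sqnormZ.
  have -> : sqabs (2%:R : R[i]) = 4 :> R.
    have -> : (2%:R : R[i]) = (2%:R)%:C%C by rewrite rmorph_nat.
    by rewrite sqabs_real; ring.
  have : inf S <= sqnorm (x - 2%:R^-1 *: (u m + u n)).
    by apply: ge_inf; apply: subspaceZ => //; exact: subspaceD.
  have := (uP m).2; have := (uP n).2; have := NP _ Nm; have := NP _ Nn.
  move: (n.+1%:R^-1) (m.+1%:R^-1) => a b; move: (inf S) => c; lra.
exists p; split=> [|y Vy]; first exact: closed_converges up.
(* Orthogonality is obtained along the minimizing sequence: moving [u n] in the direction of the
   unit vector [y1] cannot go below the infimum, which bounds the coefficient of [x - u n] along
   [y1]. *)
apply: (@converges_ip (fun n => x - u n)).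
  move=> r /up[N NP]; exists N => n /NP.
  by rewrite (sqnormBC ip (x - u n)) opprB [_ + (u n - x)]addrC addrA subrK.
have bnd n : sqabs (ip (x - u n) y) <= sqnorm y * n.+1%:R^-1.
  have [->|y0] := eqVneq y 0; first by rewrite ip0r sqnorm0 mul0r sqabs_real expr0n.
  have ny : 0 < sqnorm y by rewrite sqnorm_gt0.
  pose y1 := ((Num.sqrt (sqnorm y))^-1)%:C%C *: y.
  have y11 : sqnorm y1 = 1.
    rewrite sqnormZ sqabs_real exprVn sqr_sqrtr ?sqnorm_ge0 // mulVf //.
    by rewrite gt_eqF.
  have := sqnorm_proj (x - u n) y11; have := (uP n).2.
  have : inf S <= sqnorm (x - (u n + ip (x - u n) y1 *: y1)).
    by apply: ge_inf; apply: subspaceD => //; do 2 apply: subspaceZ => //.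
  rewrite opprD addrA => h1 h2 h3; have : sqabs (ip (x - u n) y1) <= n.+1%:R^-1.
    by move: (n.+1%:R^-1) h1 h2 h3 => ?; lra.
  rewrite ipZr sqabsM sqabs_conj sqabs_real exprVn sqr_sqrtr ?sqnorm_ge0 //.
  by rewrite mulrC ler_pdivrMr // mulrC.
move=> r r0; have [|N NP] := small (r / (sqnorm y + 1)).
  by rewrite divr_gt0 // ltr_wpDl ?sqnorm_ge0.
exists N => n /NP; rewrite ltr_pdivlMr ?ltr_wpDl ?sqnorm_ge0 // => h.
apply: le_lt_trans (bnd n) _; apply: le_lt_trans h.
by rewrite mulrC ler_wpM2l // lerDl.
Qed.

(** Zero vectors serve as padding, so that a family with gaps can be indexed by [nat]. *)
Definition orthogonal_family (z : nat -> H) : Prop :=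
  (forall k, sqnorm (z k) = 1 \/ z k = 0) /\
  (forall j k, j <> k -> ip (z j) (z k) = 0).

Lemma orthonormal_orthogonal_family z :
  orthonormal_seq ip z -> orthogonal_family z.
Proof. by move=> [z1 zo]; split => // k; left. Qed.

Lemma residualP z n a x y :
  residual ip z n (a *: x + y) = a *: residual ip z n x + residual ip z n y.
Proof.
rewrite /residual scalerBr addrACA -opprD; congr (_ - _).
rewrite scaler_sumr -big_split; apply: eq_bigr => i _ /=.
by rewrite ipDl ipZl scalerDl scalerA.
Qed.

Section FourierSpan.
Variable z : nat -> H.
Hypothesis zo : orthogonal_family z.

Lemma sqnorm_residual n x : sqnorm (residual ip z n x) =
  sqnorm x - \sum_(0 <= k < n) sqabs (ip x (z k)).
Proof.
elim: n => [|n IH]; first by rewrite /residual !big_geq // !subr0.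
rewrite big_nat_recr //= opprD addrA -IH.
have oz i : (i < n)%N -> ip (z i) (z n) = 0 by move=> ni; apply: zo.2; lia.
have [z1|z0] := zo.1 n.
  by rewrite sqnorm_residual_recr // ip_residual.
by rewrite residual_recr z0 ip0r scaler0 subr0 sqabs_real expr0n subr0.
Qed.

Lemma residual_mono m n x : (m <= n)%N ->
  sqnorm (residual ip z n x) <= sqnorm (residual ip z m x).
Proof.
move=> mn; rewrite !sqnorm_residual lerD2l lerN2.
rewrite [leRHS](big_cat_nat (n := m)) //= lerDl.
by apply: sumr_ge0 => i _; exact: sqabs_ge0.
Qed.

Lemma residual_le n x : sqnorm (residual ip z n x) <= sqnorm x.
Proof.
by rewrite sqnorm_residual gerBl; apply: sumr_ge0 => i _; exact: sqabs_ge0.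
Qed.

(** The closed span of [z]: residuals do not grow with [n], so a single small one replaces a
    statement about limits. *)
Definition fourier_span : set H :=
  [set x | forall r : R, 0 < r -> exists n, sqnorm (residual ip z n x) < r].

Lemma fourier_span_subspace : lin_subspace fourier_span.
Proof.
split=> [r r0|a x y Vx Vy r r0].
  by exists 0%N; rewrite /residual big_geq // subr0 sqnorm0.
have a1 : 0 < sqabs a + 1 by rewrite ltr_wpDl ?sqabs_ge0.
have [|n nP] := Vx (r / 4 / (sqabs a + 1)); first by rewrite !divr_gt0.
have [|m mP] := Vy (r / 4); first by rewrite divr_gt0.
exists (maxn n m); rewrite residualP.
have := le_lt_trans (residual_mono x (leq_maxl n m)) nP.
have := le_lt_trans (residual_mono y (leq_maxr n m)) mP.
set k := maxn n m => h1; rewrite ltr_pdivlMr // => h2.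
have := sqnormD_le ip (a *: residual ip z k x) (residual ip z k y).
rewrite sqnormZ; have := sqnorm_ge0 ip (residual ip z k x); nra.
Qed.

Lemma fourier_span_closed : closed fourier_span.
Proof.
move=> x /closure_sqnormP cx r r0.
have [|y [Vy xy]] := cx (r / 4); first by rewrite divr_gt0.
have [|n nP] := Vy (r / 4); first by rewrite divr_gt0.
exists n; have -> : x = 1 *: (x - y) + y by rewrite scale1r subrK.
rewrite residualP scale1r.
have := sqnormD_le ip (residual ip z n (x - y)) (residual ip z n y).
have := residual_le n (x - y); lra.
Qed.

Lemma fourier_span_mem k : fourier_span (z k).
Proof.
move=> r r0; exists k.+1; suff -> : residual ip z k.+1 (z k) = 0 by rewrite sqnorm0.
rewrite residual_recr /residual big1_seq ?subr0; last first.
  move=> i; rewrite mem_index_iota => /andP[_ /andP[_ ik]].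
  by rewrite zo.2 ?scale0r //; lia.
have [z1|->] := zo.1 k; last by rewrite scaler0 subr0.
by rewrite ip_sqnorm z1 scale1r subrr.
Qed.

Lemma fourier_span_sub (V : set H) : lin_subspace V -> closed V ->
  (forall k, V (z k)) -> fourier_span `<=` V.
Proof.
move=> sV cV Vz x xV; apply: cV; apply/closure_sqnormP => r /xV[n nP].
exists (x - residual ip z n x); split; last by rewrite subKr.
by rewrite subKr; apply: subspace_sum => // j; exact: subspaceZ.
Qed.

Lemma fourier_span_closure : fourier_span `<=` closure (linear_span (range z)).
Proof.
move=> x xV; apply/closure_sqnormP => r /xV[n nP].
exists (x - residual ip z n x); split; last by rewrite subKr.
exists n, (fun i => ip x (z i)), (fun i => z i); split=> [i|]; first by exists (val i).
by rewrite subKr -(big_mkord xpredT (fun i => ip x (z i) *: z i)).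
Qed.

Lemma fourier_decomposition (x : H) :
  exists p, [/\ fourier_span p, forall k, ip (x - p) (z k) = 0
    & forall y, (forall k, ip (z k) y = 0) -> ip p y = 0].
Proof.
have [p [Vp pP]] := orthogonal_projection x fourier_span_subspace fourier_span_closed.
exists p; split=> // [k|y zy]; first by apply: pP; exact: fourier_span_mem.
have : fourier_span `<=` [set x | ip x y = 0].
  apply: fourier_span_sub => //.
    split=> [|a x1 x2 /= h1 h2]; first exact: ip0l.
    by rewrite ipDl ipZl h1 h2 mulr0 addr0.
  move=> t /closure_converges[u [uy ut]]; apply: converges_ip ut _ => r r0.
  by exists 0%N => n _; rewrite uy sqabs_real expr0n.
exact.
Qed.

End FourierSpan.
End HilbertTopology.

(** * Fredholm operators and approximate eigenvectors *)

Section LinearSpan.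
Context {R : realType} {H : completeNormedModType R[i]}.

Lemma linear_span_mem (A : set H) : A `<=` linear_span A.
Proof.
move=> x Ax; exists 1%N, (fun=> 1), (fun=> x); split=> //.
by rewrite big_ord1 scale1r.
Qed.

Lemma linear_span_subspace (A : set H) : lin_subspace (linear_span A).
Proof.
split; first by exists 0%N, (fun=> 0), (fun=> 0); split=> [[//]|]; rewrite big_ord0.
move=> a x y [m [c [v [Av ->]]]] [n [e [w [Aw ->]]]].
exists (m + n)%N.
exists (fun i => match fintype.split i with inl j => a * c j | inr j => e j end).
exists (fun i => match fintype.split i with inl j => v j | inr j => w j end).
split=> [i|]; first by case: (fintype.split i).
rewrite big_split_ord /= scaler_sumr; congr (_ + _); apply: eq_bigr => i _.
  by rewrite (unsplitK (inl _ i)) scalerA.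
by rewrite (unsplitK (inr _ i)).
Qed.

Lemma linear_span_sub (A B : set H) : lin_subspace B -> A `<=` B ->
  linear_span A `<=` B.
Proof.
move=> sB AB x [n [c [v [Av ->]]]]; apply: subspace_sum => // i.
by apply: subspaceZ => //; exact: AB.
Qed.

Lemma finite_dim_add_line (V : set H) (x0 : H) : finite_dim V ->
  finite_dim [set x | exists y c, V y /\ x = y + c *: x0].
Proof.
move=> [n [v Vv]].
exists n.+1, (fun i => if unlift ord0 i is Some j then v j else x0).
move=> _ [y [c [/Vv yv ->]]]; have sS := linear_span_subspace.
apply: subspaceD; [exact: sS| |].
  apply: linear_span_sub yv; first exact: sS.
  move=> _ [j _ <-]; apply: linear_span_mem; exists (lift ord0 j) => //.
  by rewrite liftK.
apply: subspaceZ; first exact: sS.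
by apply: linear_span_mem; exists ord0 => //; rewrite unlift_none.
Qed.

End LinearSpan.

Section Fredholm.
Context {R : realType} {H : completeNormedModType R[i]}.
Variable ip : {dot H for @Num.conj R[i]}.
Hypothesis ip_norm : norm_of_inner ip.
Notation sqnorm := (sqnorm ip).
Notation converges := (converges ip).

Lemma subspace_orth (V : set H) (g : H) : lin_subspace V ->
  lin_subspace [set x | V x /\ ip x g = 0].
Proof.
move=> [V0 VD]; split=> [|a x y /= [Vx xg] [Vy yg]].
  by split => //; exact: ip0l.
by split; [exact: VD|rewrite ipDl ipZl xg yg mulr0 addr0].
Qed.

Lemma closed_orth (V : set H) (g : H) : closed V ->
  closed [set x | V x /\ ip x g = 0].
Proof.
move=> cV x /(closure_converges ip_norm)[u [uV ux]]; split.
  by apply: (closed_converges ip_norm cV _ ux) => n; exact: (uV n).1.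
apply: converges_ip ux _ => r r0; exists 0%N => n _.
by rewrite (uV n).2 sqabs_real expr0n.
Qed.

(* Subtracting a multiple of a vector of [V] not orthogonal to [g] maps [V]
   into the hyperplane [g^perp]. *)
Lemma split_hyperplane (V : set H) (g x0 : H) : lin_subspace V -> V x0 ->
  ip x0 g <> 0 -> forall x, V x -> exists y c,
    [/\ V y, ip y g = 0 & x = y + c *: x0].
Proof.
move=> sV Vx0 x0g x Vx; exists (x - (ip x g / ip x0 g) *: x0), (ip x g / ip x0 g).
split; [| |by rewrite subrK].
  by apply: subspaceB => //; exact: subspaceZ.
by rewrite ipBl ipZl divfK ?subrr //; exact/eqP.
Qed.

(** Each condition [ip x g = 0] lowers the dimension by at most one. *)
Lemma finite_dim_trivial_orth (G : seq H) (V : set H) : lin_subspace V ->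
  (forall x, V x -> (forall g, g \in G -> ip x g = 0) -> x = 0) ->
  finite_dim V.
Proof.
elim: G V => [|g G IH] V sV VG.
  exists 0%N, (fun=> 0) => x Vx; rewrite (VG x Vx) //.
  exact: (linear_span_subspace _).1.
have fV' : finite_dim [set x | V x /\ ip x g = 0].
  apply: IH; first exact: subspace_orth.
  move=> x [Vx xg] xG; apply: VG => // h; rewrite inE => /orP[/eqP -> //|].
  exact: xG.
have [[x0 [Vx0 x0g]]|nx0] := pselect (exists x0, V x0 /\ ip x0 g <> 0).
  have [n [v vP]] := finite_dim_add_line x0 fV'; exists n, v => x Vx.
  have [y [c [Vy yg ->]]] := split_hyperplane sV Vx0 x0g Vx.
  by apply: vP; exists y, c.
have [n [v vP]] := fV'; exists n, v => x Vx; apply: vP; split => //.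
by apply: contrapT => xg; apply: nx0; exists x.
Qed.

(** The component [r] of the limit [x] orthogonal to [A] and to [v] is orthogonal to the whole
    sequence, hence to [x], hence to itself. *)
Lemma closed_add_line (A : set H) (v : H) : lin_subspace A -> closed A ->
  closed [set x | exists a c, A a /\ x = a + c *: v].
Proof.
move=> sA cA x /(closure_converges ip_norm)[u [uS ux]].
have [pv [Apv pvP]] := orthogonal_projection ip_norm v sA cA.
have [p [Ap pP]] := orthogonal_projection ip_norm x sA cA.
have [v' v'E] : exists v', v' = v - pv by exists (v - pv).
rewrite -v'E in pvP.
pose c := if v' == 0 then 0 else ip x v' / ip v' v'.
pose r := x - p - c *: v'.
have rA a : A a -> ip r a = 0.
  by move=> Aa; rewrite /r ipBl pP // ipZl pvP // mulr0 subr0.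
have rv' : ip r v' = 0.
  rewrite /r /c; case: eqP => [->|/eqP v0]; first exact: ip0r.
  have pv'0 : ip p v' = 0 by apply: ipC0; exact: pvP.
  by rewrite ipBl ipBl ipZl pv'0 subr0 divfK ?subrr // dnorm_eq0.
have rv : ip r v = 0.
  by rewrite -(subrK pv v) -v'E ipDr rv' rA // addr0.
have ur n : ip (u n) r = 0.
  have [a [b [Aa ->]]] := uS n.
  by apply: ipC0; rewrite ipDr ipZr rv rA // mulr0 addr0.
have xr : ip x r = 0.
  by apply: converges_ip ux _ => t t0; exists 0%N => n _; rewrite ur sqabs_real expr0n.
have r0 : r = 0.
  apply/eqP; rewrite -(dnorm_eq0 ip); apply/eqP.
  by rewrite {1}/r !ipBl xr ipZl (ipC0 rv') (ipC0 (rA p Ap)) mulr0 !subr0.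
exists (p - c *: pv), c; split.
  by apply: subspaceB => //; exact: subspaceZ.
apply/eqP; rewrite -subr_eq0 -r0 /r v'E scalerBr.
by rewrite !opprD !opprK !addrA addrAC.
Qed.

Variable T : H -> H.
Hypothesis TP : forall a x y, T (a *: x + y) = a *: T x + T y.
Hypothesis T_sa : self_adjoint ip T.
Variable K : R.
Hypothesis TK : forall x, sqnorm (T x) <= K * sqnorm x.

Let T0 : T 0 = 0.
Proof. by have := TP (-1) 0 0; rewrite scaler0 addr0 scaleN1r addNr. Qed.
Let TB x y : T (x - y) = T x - T y.
Proof. by rewrite addrC -scaleN1r TP scaleN1r addrC. Qed.
Let TD x y : T (x + y) = T x + T y.
Proof. by rewrite -[x]scale1r TP !scale1r. Qed.
Let TZ a x : T (a *: x) = a *: T x.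
Proof. by rewrite -[_ *: x]addr0 TP T0 addr0. Qed.

Lemma operator_converges u l : converges u l -> converges (T \o u) (T l).
Proof.
move=> ul r r0; have K1 : 0 < `|K| + 1 by rewrite ltr_wpDl.
have [|N NP] := ul (r / (`|K| + 1)); first by rewrite divr_gt0.
exists N => n /NP; rewrite ltr_pdivlMr //= -TB => h.
apply: le_lt_trans (TK _) _; apply: le_lt_trans h; rewrite mulrC.
rewrite ler_wpM2l ?sqnorm_ge0 //; have := ler_norm K; lra.
Qed.

(** For empty [G], preimages of a convergent sequence are Cauchy. Each further [g] makes [W] at most
    a line larger than its part orthogonal to [g], so the image grows by at most a line and stays
    closed. *)
Lemma closed_image (G : seq H) (W : set H) (eps : R) : 0 < eps ->
  lin_subspace W -> closed W ->
  (forall x, W x -> (forall g, g \in G -> ip x g = 0) ->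
     eps * sqnorm x <= sqnorm (T x)) ->
  closed (T @` W).
Proof.
move=> eps0; elim: G W => [|g G IH] W sW cW WG.
  move=> y /(closure_converges ip_norm)[u [uW uy]].
  have /choice[w wP] n : exists x, W x /\ T x = u n.
    by have [x Wx <-] := uW n; exists x.
  have [|x wx] := hilbert_complete ip_norm (u := w).
    move=> r r0; have [|N NP] := uy (eps * r / 4); first by rewrite !(divr_gt0, mulr_gt0).
    exists N => m n Nm Nn; rewrite -(ltr_pM2l eps0).
    have /le_lt_trans : eps * sqnorm (w m - w n) <= sqnorm (T (w m - w n)).
      by apply: WG => //; apply: subspaceB => //; apply: (wP _).1.
    apply; rewrite TB (wP m).2 (wP n).2.
    have -> : u m - u n = (u m - y) + - (u n - y) by rewrite opprB addrA subrK.
    have := sqnormD_le ip (u m - y) (- (u n - y)); rewrite sqnormN.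
    have := NP _ Nm; have := NP _ Nn; lra.
  exists x; first by apply: (closed_converges ip_norm cW _ wx) => n; exact: (wP n).1.
  have Twx := operator_converges wx.
  apply/eqP; rewrite -subr_eq0 -(dnorm_eq0 ip); apply/eqP.
  apply: (@converges_ip _ _ _ (fun n => u n - y)).
    move=> r /Twx[N NP]; exists N => n /NP /=; rewrite (wP n).2.
    by rewrite opprB addrA subrK.
  move=> r r0; have d1 : 0 < sqnorm (T x - y) + 1 by rewrite ltr_wpDl ?sqnorm_ge0.
  have [|N NP] := uy (r / (sqnorm (T x - y) + 1)); first by rewrite divr_gt0.
  exists N => n /NP; rewrite ltr_pdivlMr //; apply: le_lt_trans.
  apply: le_trans (cauchy_schwarz _ _ _) _.
  by rewrite ler_wpM2l ?sqnorm_ge0 // lerDl.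
have cTW' : closed (T @` [set x | W x /\ ip x g = 0]).
  apply: IH; [exact: subspace_orth|exact: closed_orth|].
  move=> x [Wx xg] xG; apply: WG => // h; rewrite inE => /orP[/eqP -> //|].
  exact: xG.
have [[x0 [Wx0 x0g]]|nx0] := pselect (exists x0, W x0 /\ ip x0 g <> 0); last first.
  suff -> : W = [set x | W x /\ ip x g = 0] by [].
  apply/seteqP; split=> x /= => [Wx|[]//]; split => //.
  by apply: contrapT => xg; apply: nx0; exists x.
suff -> : T @` W = [set x | exists a c,
    (T @` [set x | W x /\ ip x g = 0]) a /\ x = a + c *: T x0].
  apply: closed_add_line => //; split.
    by exists 0 => //; split; [exact: sW.1|exact: ip0l].
  move=> a _ _ [x Wx <-] [y Wy <-]; exists (a *: x + y) => //.
  by apply: (subspace_orth _ sW).2.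
apply/seteqP; split=> [_ [x Wx <-]|_ [_ [c [[y [Wy yg] <-] ->]]]].
  have [y [c [Wy yg ->]]] := split_hyperplane sW Wx0 x0g Wx.
  by exists (T y), c; split; [exists y|rewrite TD TZ].
exists (y + c *: x0); last by rewrite TD TZ.
by apply: subspaceD => //; exact: subspaceZ.
Qed.

Lemma fredholm_bounded_below (G : seq H) (eps : R) : 0 < eps ->
  (forall x, (forall g, g \in G -> ip x g = 0) -> eps * sqnorm x <= sqnorm (T x)) ->
  fredholm T.
Proof.
move=> eps0 GT; have sT : lin_subspace [set: H] by [].
have sK : lin_subspace [set x | T x = 0].
  by split=> [|a x y /= Tx Ty]; rewrite ?T0 // TP Tx Ty scaler0 addr0.
have fK : finite_dim [set x | T x = 0].
  apply: (@finite_dim_trivial_orth G) => // x /= Tx xG.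
  have := GT x xG; rewrite Tx sqnorm0 pmulr_rle0 // => h; apply/eqP.
  by rewrite -(sqnorm_eq0 ip) eq_le h sqnorm_ge0.
have cR : closed (range T).
  apply: (@closed_image G [set: H] eps) => // x _; exact: GT.
(* By self-adjointness the orthogonal complement of the range is the kernel, so the
   finite-dimensional kernel also serves as complement of the range. *)
split => //; exists [set x | T x = 0]; split => // x.
have sR : lin_subspace (range T).
  split; first by exists 0.
  by move=> a _ _ [y _ <-] [z _ <-]; exists (a *: y + z).
have [p [[y _ <-] pP]] := orthogonal_projection ip_norm x sR cR.
exists y, (x - T y); split; last by rewrite addrC subrK.
apply/eqP; rewrite /= -(dnorm_eq0 ip); apply/eqP; rewrite T_sa; apply: pP.
by exists (T (x - T y)).
Qed.

(** Without such a vector, [T] would be bounded below on the orthogonal complement of [G], hence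
    Fredholm. *)
Lemma weyl_vector (G : seq H) (eps : R) : ~ fredholm T -> 0 < eps ->
  exists u, [/\ sqnorm u = 1, forall g, g \in G -> ip u g = 0
    & sqnorm (T u) <= eps].
Proof.
move=> nf eps0; apply: contrapT => nu; apply: nf.
apply: (fredholm_bounded_below (G := G) eps0) => x xG.
have [->|x0] := eqVneq x 0; first by rewrite sqnorm0 mulr0 sqnorm_ge0.
rewrite leNgt; apply/negP => h; apply: nu.
have nx : 0 < sqnorm x by rewrite sqnorm_gt0.
have s2 : sqabs ((Num.sqrt (sqnorm x))^-1)%:C%C = (sqnorm x)^-1 :> R.
  by rewrite sqabs_real exprVn sqr_sqrtr // sqnorm_ge0.
exists (((Num.sqrt (sqnorm x))^-1)%:C%C *: x); split.
- by rewrite sqnormZ s2 mulVf // gt_eqF.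
- by move=> g gG; rewrite ipZl xG // mulr0.
- by rewrite TZ sqnormZ s2 ler_pdivrMl // mulrC ltW.
Qed.

End Fredholm.

(** Course-of-values choice; the first premise says that [good n f] depends only on the values of
    [f] below [n]. *)
Lemma sequential_choice (T : Type) (x0 : T) (good : nat -> (nat -> T) -> T -> Prop) :
  (forall n f f' x, (forall i, (i < n)%N -> f i = f' i) -> good n f x -> good n f' x) ->
  (forall n f, (forall i, (i < n)%N -> good i f (f i)) -> exists x, good n f x) ->
  exists t : nat -> T, forall n, good n t (t n).
Proof.
move=> ext ex.
pose P n (f : nat -> T) := forall i, (i < n)%N -> good i f (f i).
pose Q n (f f' : nat -> T) := forall i, (i < n)%N -> f' i = f i.
have [||F [F0 FP]] := @dependent_choice_nat _ P Q (fun=> x0).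
- by [].
- move=> n f Pf; have [x gx] := ex n f Pf.
  pose f' i := if i == n then x else f i.
  have f'lt i : (i < n)%N -> f' i = f i by rewrite /f'; case: eqP => //; lia.
  exists f'; split=> // i; rewrite ltnS leq_eqVlt => /orP[/eqP ->|ni].
    by rewrite /f' eqxx; apply: ext gx => j jn; rewrite -/(f' j) f'lt.
  rewrite f'lt //; apply: ext (Pf i ni) => j ji; rewrite f'lt //; lia.
pose t n := F n.+1 n.
have Ft n i : (i < n)%N -> F n i = t i.
  elim: n => // n IH; rewrite ltnS leq_eqVlt => /orP[/eqP ->//|ni].
  by rewrite (FP n).2 //; exact: IH.
exists t => n; apply: (ext n (F n.+1)).
  by move=> i ni; rewrite Ft // ltnW.
exact: (FP n.+1).1.
Qed.

Lemma infinite_set_avoid (T : choiceType) (A : set T) (f : nat -> T) (n : nat) :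
  infinite_set A -> exists x, A x /\ forall i, (i < n)%N -> f i <> x.
Proof.
move=> iA; apply: contrapT => h; apply: iA.
apply: (@sub_finite_set _ _ [set` [seq f i | i <- iota 0 n]]).
  move=> x Ax /=; apply: contrapT => xf; apply: h; exists x; split=> // i ni fi.
  by apply: xf; apply/mapP; exists i; rewrite ?mem_iota.
exact: finite_seq.
Qed.

Lemma injective_choice (J : choiceType) (A : nat -> set J) :
  (forall n, infinite_set (A n)) ->
  exists f : nat -> J, injective f /\ forall n, A n (f n).
Proof.
move=> iA; have [j0 _] : exists j, A 0%N j.
  apply: contrapT => n0; apply: (iA 0%N); suff -> : A 0%N = set0 by [].
  by apply/seteqP; split=> // x Ax; apply: n0; exists x.
have [||f fP] := @sequential_choice J j0
    (fun n f x => A n x /\ forall i, (i < n)%N -> f i <> x).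
- move=> n f f' x ff' [Ax fx]; split=> // i ni; rewrite -ff' //; exact: fx.
- by move=> n f _; exact: infinite_set_avoid.
exists f; split=> [m n mn|n]; last exact: (fP n).1.
case: (ltngtP m n) => // h.
  by have := (fP n).2 m h mn.
by have := (fP m).2 n h (esym mn).
Qed.

(** * Isolation of eigenvalues and Weyl sequences orthogonal to eigenvectors *)

Section Eigenvalues.
Context {R : realType} {H : completeNormedModType R[i]}.
Variable ip : {dot H for @Num.conj R[i]}.
Hypothesis ip_norm : norm_of_inner ip.
Notation sqnorm := (sqnorm ip).

Lemma linear_span_range n (v : 'I_n -> H) x : linear_span (range v) x ->
  exists c : 'I_n -> R[i], x = \sum_(j < n) c j *: v j.
Proof.
pose B := [set x | exists c : 'I_n -> R[i], x = \sum_(j < n) c j *: v j].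
suff : linear_span (range v) `<=` B by exact.
apply: linear_span_sub.
  split; first by exists (fun=> 0); rewrite big1 // => j _; rewrite scale0r.
  move=> a _ _ [c ->] [e ->]; exists (fun j => a * c j + e j).
  rewrite scaler_sumr -big_split; apply: eq_bigr => j _ /=.
  by rewrite scalerDl scalerA.
move=> _ [j _ <-]; exists (fun i => (i == j)%:R).
rewrite (bigD1 j) //= eqxx scale1r big1 ?addr0 // => i /negbTE ->.
by rewrite scale0r.
Qed.

(** The coefficient matrix of [n.+1] vectors in a span of [n] has a nonzero left kernel vector, a
    linear dependence among orthonormal vectors. *)
Lemma finite_dim_no_orthonormal (V : set H) (z : nat -> H) :
  finite_dim V -> orthonormal_seq ip z -> (forall k, V (z k)) -> False.
Proof.
move=> [n [v Vv]] [z1 zo] zV.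
have /choice[C CP] (i : 'I_n.+1) :
    exists c : 'I_n -> R[i], z i = \sum_(j < n) c j *: v j.
  by apply: linear_span_range; apply: Vv.
pose M := \matrix_(i < n.+1, j < n) C i j.
have kM : kermx M != 0.
  rewrite -mxrank_eq0 mxrank_ker -lt0n subn_gt0.
  exact: leq_ltn_trans (rank_leq_col M) _.
have [a aM a0] : exists2 a : 'rV_n.+1, a *m M = 0 & a != 0.
  exists (nz_row (kermx M)); last by rewrite nz_row_eq0.
  by apply/eqP; rewrite -sub_kermx nz_row_sub.
have s0 : \sum_(i < n.+1) a 0 i *: z i = 0.
  under eq_bigr => i _ do rewrite CP scaler_sumr.
  rewrite exchange_big big1 //= => j _.
  transitivity ((a *m M) 0 j *: v j); last by rewrite aM mxE scale0r.
  rewrite mxE scaler_suml; apply: eq_bigr => i _.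
  by rewrite mxE scalerA.
move/eqP: a0; apply; apply/rowP => k; rewrite mxE.
have : ip (\sum_(i < n.+1) a 0 i *: z i) (z k) = 0 by rewrite s0 ip0l.
rewrite ip_suml (bigD1 k) //= ipZl ip_sqnorm z1 mulr1 big1 ?addr0 //.
move=> i ik; rewrite ipZl zo ?mulr0 // => /val_inj ik'.
by rewrite ik' eqxx in ik.
Qed.

Variable E : H -> H.
Hypothesis EP : forall a x y, E (a *: x + y) = a *: E x + E y.
Hypothesis E_sa : self_adjoint ip E.
Variable K : R.
Hypothesis EK : forall x, sqnorm (E x) <= K * sqnorm x.

Lemma operator_shift (m : R) :
  [/\ forall a x y, E (a *: x + y) - m%:C%C *: (a *: x + y) =
        a *: (E x - m%:C%C *: x) + (E y - m%:C%C *: y),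
      self_adjoint ip (fun x => E x - m%:C%C *: x)
    & forall x, sqnorm (E x - m%:C%C *: x) <= 2 * (`|K| + m ^+ 2) * sqnorm x].
Proof.
split=> [a x y|x y|x].
- rewrite EP scalerDr opprD addrACA scalerBr; congr (_ - _ + _).
  by rewrite !scalerA mulrC.
- rewrite ipBl ipBr E_sa ipZl ipZr; congr (_ - _ * _).
  by apply/eqP; rewrite eq_complex /= oppr0 !eqxx.
- have := sqnormD_le ip (E x) (- (m%:C%C *: x)).
  rewrite sqnormN sqnormZ sqabs_real => h; apply: le_trans h _.
  have : sqnorm (E x) <= `|K| * sqnorm x.
    by apply: le_trans (EK x) _; rewrite ler_wpM2r ?sqnorm_ge0 ?ler_norm.
  lra.
Qed.

Section Isolated.
Variables (J : choiceType) (lam : J -> R) (v : J -> H).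
Hypothesis v1 : forall j, sqnorm (v j) = 1.
Hypothesis vo : forall i j, i <> j -> ip (v i) (v j) = 0.
Hypothesis Ev : forall j, E (v j) = (lam j)%:C%C *: v j.

Lemma orthonormal_series (z : nat -> H) (c : nat -> R) :
  orthonormal_seq ip z -> (forall n, c n ^+ 2 <= 2^-1 ^+ n) ->
  exists y, converges ip (fun n => \sum_(0 <= k < n) (c k)%:C%C *: z k) y /\
    forall k, ip y (z k) = (c k)%:C%C.
Proof.
move=> [z1 zo] cs; pose S n := \sum_(0 <= k < n) (c k)%:C%C *: z k.
have nS n m : sqnorm (\sum_(n <= k < n + m) (c k)%:C%C *: z k) <=
    2 * 2^-1 ^+ n - 2 * 2^-1 ^+ (n + m).
  elim: m => [|m IH]; first by rewrite addn0 big_geq // sqnorm0 subrr.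
  rewrite addnS big_nat_recr ?leq_addr //= sqnormDd; last first.
    rewrite ip_suml big1_seq // => i; rewrite mem_index_iota => /andP[_ /andP[_ h]].
    by rewrite ipZl ipZr zo ?mulr0 //; lia.
  rewrite sqnormZ z1 mulr1 sqabs_real.
  have -> : 2^-1 ^+ (n + m).+1 = 2^-1 * 2^-1 ^+ (n + m) :> R by rewrite exprS.
  have := cs (n + m)%N; lra.
have tail n m : (n <= m)%N -> sqnorm (S m - S n) <= 2 * 2^-1 ^+ n.
  move=> nm; rewrite /S (big_cat_nat (n := n) (p := m)) //= addrC addrK.
  rewrite -(subnKC nm); apply: le_trans (nS _ _) _.
  by rewrite gerBl mulr_ge0 // exprn_ge0 // invr_ge0.
have half (r : R) : 0 < r -> exists N, 2 * 2^-1 ^+ N < r.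
  move=> r0; exists (Num.truncn (2 / r)).+1.
  rewrite exprVn ltr_pdivrMr ?exprn_gt0 // mulrC -ltr_pdivrMr //.
  apply: lt_le_trans (Num.Theory.truncnS_gt _) _.
  by rewrite -natrX ler_nat ltnW // ltn_expl.
have half_mono (N n : nat) : (N <= n)%N -> 2 * 2^-1 ^+ n <= 2 * 2^-1 ^+ N :> R.
  move=> Nn; rewrite ler_wpM2l // ler_wiXn2l // ?invr_ge0 //.
  by rewrite invf_le1 // ler1n.
have [|y Sy] := hilbert_complete ip_norm (u := S).
  move=> r /half[N NP]; exists N => m n Nm Nn.
  case: (leqP n m) => h; last rewrite sqnormBC.
    by apply: le_lt_trans (tail n m h) _; apply: le_lt_trans NP; exact: half_mono.
  by apply: le_lt_trans (tail m n (ltnW h)) _; apply: le_lt_trans NP; exact: half_mono.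
exists y; split=> // k.
have zk : ip (z k) (z k) = 1 by rewrite ip_sqnorm z1.
have : ip (y - (c k)%:C%C *: z k) (z k) = 0.
  apply: (@converges_ip _ _ _ (fun n => S n - (c k)%:C%C *: z k)).
    by move=> r /Sy[N NP]; exists N => n /NP; rewrite opprB addrA subrK.
  move=> r r0; exists k.+1 => n kn.
  rewrite ipBl ipZl zk mulr1 /S ip_suml.
  rewrite (bigD1_seq k) ?mem_index_iota ?iota_uniq //= ipZl zk mulr1.
  rewrite big1 ?addr0 ?subrr ?sqabs_real ?expr0n // => i /eqP ik.
  by rewrite ipZl zo ?mulr0.
by rewrite ipBl ipZl zk mulr1 => /eqP; rewrite subr_eq0 => /eqP.
Qed.

(** The finite-dimensional kernel excludes infinitely many [j] with [lam j = m]. If other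
    eigenvalues accumulated at [m], eigenvectors [z k] could be chosen with nonzero, square-summable
    [t k = lam - m]. Then the sum of [t k *: z k] is a limit of images of [T], so it equals [T x]
    for some [x]; all coefficients [ip x (z k)] would be 1, against Bessel's inequality. *)
Lemma isolated_eigenvalue (m : R) : fredholm (fun x => E x - m%:C%C *: x) ->
  exists2 eps : R, 0 < eps & finite_set [set j | `|lam j - m| < eps].
Proof.
set T := fun x => _; move=> [fK cR _].
have [TP0 T_sa0 _] := operator_shift m.
have TP a x y : T (a *: x + y) = a *: T x + T y := TP0 a x y.
have T_sa x y : ip (T x) y = ip x (T y) := T_sa0 x y.
have Tv j : T (v j) = (lam j - m)%:C%C *: v j.
  by rewrite /T Ev -scalerBl -rmorphB.
have f0 : finite_set [set j | lam j = m].
  apply: contrapT => inf0.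
  have [f [finj fP]] := injective_choice (fun=> inf0).
  apply: (finite_dim_no_orthonormal (z := v \o f) fK).
    by split=> [k|i j ij]; [exact: v1|apply: vo => /finj].
  by move=> k /=; rewrite /T Ev fP subrr.
apply: contrapT => nfin.
have inf_n (n : nat) :
    infinite_set [set j | (lam j - m) ^+ 2 <= 2^-1 ^+ n /\ lam j <> m].
  move=> fin; apply: nfin; exists (2^-1 ^+ n); first by rewrite exprn_gt0 ?invr_gt0.
  apply: sub_finite_set (_ : _ `<=` [set j | lam j = m] `|`
    [set j | (lam j - m) ^+ 2 <= 2^-1 ^+ n /\ lam j <> m]) _.
    move=> j /= h; have [|jm] := pselect (lam j = m); [by left|right; split=> //].
    rewrite -real_normK ?num_real // expr2.
    apply: le_trans (ltW h); rewrite ler_piMr // (le_trans (ltW h)) //.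
    by rewrite exprn_ile1 ?invr_ge0 // invf_le1 // ler1n.
  by rewrite finite_setU.
have [f [finj fP]] := injective_choice inf_n.
have zo : orthonormal_seq ip (v \o f).
  by split=> [k|i j ij]; [exact: v1|apply: vo => /finj].
have [y [Sy yz]] := orthonormal_series zo (fun n => (fP n).1).
have [x _ xy] : range T y.
  apply: (closed_converges ip_norm cR _ Sy) => n.
  exists (\sum_(0 <= k < n) v (f k)) => //.
  have T0 : T 0 = 0 by have := TP (-1) 0 0; rewrite scaler0 addr0 scaleN1r addNr.
  elim: n => [|n IH]; first by rewrite !big_geq.
  rewrite !big_nat_recr //= -IH addrC -[v (f n)]scale1r TP scale1r Tv.
  by rewrite scale1r addrC.
have xz k : ip x (v (f k)) = 1.
  have := yz k; rewrite -xy T_sa Tv ipZr.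
  have -> : ((lam (f k) - m)%:C%C)^* = (lam (f k) - m)%:C%C :> R[i].
    by apply/eqP; rewrite eq_complex /= oppr0 !eqxx.
  move=> /eqP; rewrite -subr_eq0 -[X in _ - X]mulr1 -mulrBr mulf_eq0 => /orP[|].
    rewrite eq_complex /= eqxx andbT subr_eq0 => /eqP h; exfalso.
    exact: (fP k).2.
  by rewrite subr_eq0 => /eqP.
pose N := (Num.truncn (sqnorm x)).+1.
have := sqnorm_residual (orthonormal_orthogonal_family zo) N x.
rewrite (eq_bigr (fun=> 1)); last by move=> k _; rewrite xz sqabs_real expr1n.
have := sqnorm_ge0 ip (residual ip (v \o f) N x).
rewrite sumr_const_nat subn0 => + h; rewrite h subr_ge0 leNgt.
by rewrite Num.Theory.truncnS_gt.
Qed.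

End Isolated.

(** Otherwise the supremum of the levels exceeded infinitely often would be an accumulation point of
    [g] that is at least [a]. *)
Lemma finite_levels (J : choiceType) (g : J -> R) (a B : R) :
  (forall j, g j <= B) ->
  (forall m, a <= m -> exists2 eps : R, 0 < eps &
     finite_set [set j | `|g j - m| < eps]) ->
  finite_set [set j | a <= g j].
Proof.
move=> gB iso; apply: contrapT => inf_a.
pose S := [set c | infinite_set [set j | c <= g j]].
have Sa : S a by [].
have hS : has_sup S.
  split; first by exists a.
  exists B => c Sc; rewrite leNgt; apply/negP => Bc; apply: Sc.
  suff -> : [set j | c <= g j] = set0 by [].
  apply/seteqP; split=> // j /= cg.
  by have := lt_le_trans Bc (le_trans cg (gB j)); rewrite ltxx.
have [|eps eps0 fin] := iso (sup S); first exact: ub_le_sup hS.2 _ Sa.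
have [c Sc ceps] := sup_adherent eps0 hS.
have fS : finite_set [set j | sup S + eps <= g j].
  apply: contrapT => /(ub_le_sup hS.2); rewrite gerDl leNgt eps0 //.
apply: Sc; apply: sub_finite_set (_ : _ `<=` [set j | sup S + eps <= g j] `|`
  [set j | `|g j - sup S| < eps]) _; last by rewrite finite_setU.
move=> j /= cg; have [|h] := leP (sup S + eps) (g j); [by left|right].
rewrite ltr_norml; apply/andP; split; lra.
Qed.

(* [t k = lam_k - m], where the eigenvalues [lam_k] are at distance at least 1
   from [m]: an approximate [m]-eigenvector is then almost orthogonal to the
   whole closed span of the [z k], so projecting that span away is harmless. *)
Lemma weyl_vector_orth (m : R) (z : nat -> H) (t : nat -> R) (G : seq H) (eps : R) :
  ~ fredholm (fun x => E x - m%:C%C *: x) ->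
  orthogonal_family ip z ->
  (forall k, E (z k) - m%:C%C *: z k = (t k)%:C%C *: z k) ->
  (forall k, 1 <= t k ^+ 2) -> 0 < eps ->
  exists u, [/\ sqnorm u = 1, forall g, g \in G -> ip u g = 0,
    forall k, ip u (z k) = 0 & `|complex.Re (ip (E u) u) - m| <= eps].
Proof.
move=> nf zo zt t1 eps0; have [TP0 T_sa0 TK0] := operator_shift m.
set T := fun x => _ in nf; set K' := 2 * _ in TK0.
have TP a x y : T (a *: x + y) = a *: T x + T y := TP0 a x y.
have T_sa x y : ip (T x) y = ip x (T y) := T_sa0 x y.
have TK x : sqnorm (T x) <= K' * sqnorm x := TK0 x.
have K'0 : 0 <= K' by rewrite mulr_ge0 // addr_ge0 ?sqr_ge0.
have /choice[P PP] := fourier_decomposition ip_norm zo.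
(* The first bound leaves [sqnorm (u - p) >= 1 / 2]; the second makes [sqnorm (T (u - p))] at most
   [eps ^+ 2 / 2], so normalizing [u - p] costs no more than [eps]. *)
pose dl := Num.min (1 / 2) (eps ^+ 2 / (4 * (1 + K'))).
have dl0 : 0 < dl.
  by rewrite lt_min !(divr_gt0, mulr_gt0, exprn_gt0, ltr_wpDr).
(* Orthogonality of [u] to [g - P g], rather than to [g], is what makes the corrected vector
   [u - P u] orthogonal to [g]. *)
have [u [u1 uG Tu]] := weyl_vector ip_norm TP T_sa TK [seq g - P g | g <- G] nf dl0.
set p := P u; have [pV pz pperp] := PP u.
(* [T] multiplies [z k] by [t k] and [t k ^+ 2 >= 1], so the coefficients of [p] are at most those
   of [T u]; Bessel's inequality then bounds [p] by [T u]. *)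
have np : sqnorm p <= dl.
  apply/ler_addgt0Pr => r r0; have [n nr] := pV r r0.
  have := sqnorm_residual zo n p.
  have := sqnorm_residual zo n (T u).
  have : \sum_(0 <= k < n) sqabs (ip p (z k)) <=
      \sum_(0 <= k < n) sqabs (ip (T u) (z k)).
    apply: ler_sum => k _; rewrite T_sa.
    have -> : T (z k) = (t k)%:C%C *: z k by exact: zt.
    rewrite ipZr sqabsM sqabs_conj sqabs_real.
    have -> : ip p (z k) = ip u (z k).
      by have /eqP := pz k; rewrite ipBl subr_eq0 => /eqP.
    by rewrite ler_peMl // sqabs_ge0.
  have := sqnorm_ge0 ip (residual ip z n (T u)); lra.
have pu : ip (u - p) p = 0.
  by apply: ipC0; apply: pperp => k; exact/ipC0/pz.
have nu : sqnorm (u - p) = 1 - sqnorm p.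
  have := sqnormDd pu; rewrite subrK u1 => ->; ring.
have dl2 : dl <= 1 / 2 by rewrite ge_min lexx.
have nu2 : 1 / 2 <= sqnorm (u - p) by rewrite nu; lra.
have nu0 : 0 < sqnorm (u - p) by apply: lt_le_trans nu2; lra.
have s2 : sqabs ((Num.sqrt (sqnorm (u - p)))^-1)%:C%C = (sqnorm (u - p))^-1 :> R.
  by rewrite sqabs_real exprVn sqr_sqrtr // ltW.
have nT : sqnorm (T (u - p)) <= 2 * (1 + K') * dl.
  have -> : T (u - p) = T u + - T p.
    by rewrite addrC -scaleN1r TP scaleN1r addrC.
  have := sqnormD_le ip (T u) (- T p); rewrite sqnormN.
  have := TK p; have : K' * sqnorm p <= K' * dl by rewrite ler_wpM2l.
  rewrite -/(T p); lra.
exists (((Num.sqrt (sqnorm (u - p)))^-1)%:C%C *: (u - p)); split.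
- by rewrite sqnormZ s2 mulVf // gt_eqF.
- move=> g gG; rewrite ipZl; suff -> : ip (u - p) g = 0 by rewrite mulr0.
  have [_ gz gperp] := PP g.
  have h1 : ip u (g - P g) = 0 by apply: uG; apply: map_f.
  have h2 : ip p (g - P g) = 0 by apply: pperp => k; exact/ipC0/gz.
  have h3 : ip (u - p) (P g) = 0.
    by apply: ipC0; apply: gperp => k; exact/ipC0/pz.
  by rewrite -(subrK (P g) g) ipDr h3 ipBl h1 h2 subrr addr0.
- by move=> k; rewrite ipZl pz mulr0.
set w := _ *: (u - p).
have w1 : sqnorm w = 1 by rewrite sqnormZ s2 mulVf // gt_eqF.
have -> : complex.Re (ip (E w) w) - m = complex.Re (ip (T w) w).
  by rewrite /T ipBl ipZl (ip_sqnorm ip w) w1 complex_ReB mulr1.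
have Tw : T w = ((Num.sqrt (sqnorm (u - p)))^-1)%:C%C *: T (u - p).
  have T0 : T 0 = 0 by have := TP (-1) 0 0; rewrite scaler0 addr0 scaleN1r addNr.
  by rewrite /w -[_ *: (u - p)]addr0 TP -/(T 0) T0 addr0.
rewrite -ler_sqr ?nnegrE ?(ltW eps0) // real_normK ?num_real //.
have : sqabs (ip (T w) w) <= sqnorm (T w).
  by have := cauchy_schwarz ip (T w) w; rewrite w1 mulr1.
have : complex.Re (ip (T w) w) ^+ 2 <= sqabs (ip (T w) w).
  by rewrite lerDl sqr_ge0.
move=> h1 h2; apply: (le_trans (le_trans h1 h2)).
rewrite Tw sqnormZ s2 ler_pdivrMl //.
apply: le_trans nT _.
have : dl <= eps ^+ 2 / (4 * (1 + K')) by rewrite ge_min lexx orbT.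
rewrite ler_pdivlMr; last by rewrite mulr_gt0 // ltr_wpDr.
move=> h; have : 1 / 2 * eps ^+ 2 <= sqnorm (u - p) * eps ^+ 2.
  by rewrite ler_wpM2r ?sqr_ge0.
lra.
Qed.

End Eigenvalues.

Lemma ler_sum_subset (R : realType) (T : eqType) (s1 s2 : seq T) (F : T -> R) :
  (forall x, 0 <= F x) -> uniq s1 -> {subset s1 <= s2} ->
  \sum_(x <- s1) F x <= \sum_(x <- s2) F x.
Proof.
move=> F0; elim: s1 s2 => [|x s1 IH] s2 /=.
  by move=> _ _; rewrite big_nil; apply: sumr_ge0.
move=> /andP[xs1 us1] sub.
have xs2 : x \in s2 by apply: sub; rewrite inE eqxx.
rewrite big_cons (perm_big _ (perm_to_rem xs2)) big_cons lerD2l.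
apply: IH => // y ys1; have : y \in s2 by apply: sub; rewrite inE ys1 orbT.
rewrite (perm_mem (perm_to_rem xs2)) inE => /orP[/eqP yx|//].
by rewrite -yx ys1 in xs1.
Qed.

(** * Eigenvalues outside the unit interval *)

Section SortedEnumeration.
Context {R : realType} {J : choiceType}.
Variable g : J -> R.
Hypothesis g_levels : forall a : R, 1 < a -> finite_set [set j | a <= g j].

Lemma seq_argmax (s : seq J) j0 : j0 \in s ->
  exists j, j \in s /\ forall i, i \in s -> g i <= g j.
Proof.
elim: s j0 => // x s IH j0 _; case: s IH => [|y s] IH.
  by exists x; rewrite inE eqxx; split=> // i; rewrite inE => /eqP ->.
have [|j [js jmax]] := IH y; first by rewrite inE eqxx.
have [jx|xj] := leP (g j) (g x).
  exists x; rewrite inE eqxx; split=> // i; rewrite inE => /orP[/eqP -> //|/jmax].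
  by move=> /le_trans; apply.
exists j; rewrite inE js orbT; split=> // i; rewrite inE => /orP[/eqP ->|/jmax //].
exact: ltW.
Qed.

(** A largest remaining value exists since only finitely many lie above any level greater than 1;
    [None] marks exhaustion. *)
Definition next_largest (n : nat) (s : nat -> option J) (o : option J) : Prop :=
  match o with
  | Some j => [/\ 1 < g j, forall i, (i < n)%N -> s i <> Some j
      & forall k, 1 < g k -> (forall i, (i < n)%N -> s i <> Some k) -> g k <= g j]
  | None => forall k, 1 < g k -> exists i, (i < n)%N /\ s i = Some k
  end.

Lemma sorted_enumeration : exists s : nat -> option J,
  forall n, next_largest n s (s n).
Proof.
apply: (sequential_choice None) => [n f f' [j|] ff'|n f _] /=.
- move=> [gj fj jmax]; split=> // [i ni|k gk fk]; first by rewrite -ff' //; exact: fj.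
  by apply: jmax => // i ni; rewrite ff' //; exact: fk.
- by move=> h k /h[i [ni fi]]; exists i; rewrite -ff'.
have [[k [gk fk]]|none] := pselect (exists k, 1 < g k /\
    forall i, (i < n)%N -> f i <> Some k); last first.
  exists None => k gk; apply: contrapT => h; apply: none; exists k; split=> // i ni fi.
  by apply: h; exists i.
have /finite_seqP[s sE] := g_levels gk.
pose s' := [seq j <- s | Some j \notin [seq f i | i <- iota 0 n]].
have memN j : Some j \notin [seq f i | i <- iota 0 n] <->
    forall i, (i < n)%N -> f i <> Some j.
  split=> [/mapP h i ni fi|h]; first by apply: h; exists i; rewrite ?mem_iota.
  by apply/mapP => -[l]; rewrite mem_iota => /= /h fi /esym /fi.
have mem_s j : j \in s <-> g k <= g j.
  by have := congr1 (fun A => A j) sE => /= ->.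
have ks' : k \in s' by rewrite mem_filter; apply/andP; split; [exact/memN|exact/mem_s].
have [j [js' jmax]] := seq_argmax ks'.
have kj := jmax k ks'; move: js'; rewrite mem_filter => /andP[/memN fj _].
exists (Some j); split=> // [|i gi fi]; first exact: lt_le_trans kj.
have [ki|/ltW ik] := leP (g k) (g i); last exact: le_trans kj.
by apply: jmax; rewrite mem_filter; apply/andP; split; [exact/memN|exact/mem_s].
Qed.

(* [rho] lists the values of [g] above 1 in decreasing order, padded with 1. *)
Definition level_enumeration (rho : nat -> R) : Prop :=
  [/\ forall n, 1 <= rho n,
      forall m n, (m <= n)%N -> rho n <= rho m,
      forall c, 1 < c -> exists N, rho N < c
    & forall (a : R) N (G : seq J), 1 < a -> rho N <= a -> uniq G ->
        \sum_(j <- G) Num.max (g j - a) 0 <=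
        \sum_(0 <= n < N) Num.max (rho n - a) 0].

Variable s : nat -> option J.
Hypothesis sP : forall n, next_largest n s (s n).

Lemma enumeration_inj m n j : s m = Some j -> s n = Some j -> m = n.
Proof.
move=> sm sn; case: (ltngtP m n) => // h.
  by have := sP n; rewrite sn => -[_ /(_ m h)].
by have := sP m; rewrite sm => -[_ /(_ n h)].
Qed.

Lemma enumeration_above n j : s n = Some j -> 1 < g j.
Proof. by move=> sn; have := sP n; rewrite sn => -[]. Qed.

Lemma enumeration_exhausted n : s n = None -> finite_set [set j | 1 < g j].
Proof.
move=> sn; apply: (@sub_finite_set _ _ [set` pmap s (iota 0 n)]); last exact: finite_seq.
move=> j /= gj; have := sP n; rewrite sn => /(_ j gj)[i [ni si]].
by rewrite mem_pmap -si map_f // mem_iota.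
Qed.

Lemma level_enumeration_sorted :
  level_enumeration (fun n => if s n is Some j then g j else 1).
Proof.
set rho := fun n => _.
have rho1 n : 1 <= rho n.
  by rewrite /rho; case E : (s n) => [j|//]; exact: ltW (enumeration_above E).
have mono m n : (m <= n)%N -> rho n <= rho m.
  rewrite leq_eqVlt => /orP[/eqP -> //|mn]; rewrite {1}/rho.
  case E : (s n) => [j|]; last exact: rho1.
  have := sP n; rewrite E => -[gj sj _]; rewrite /rho; have := sP m.
  case F : (s m) => [k|]; first by move=> [_ _]; apply=> // i im; apply: sj; lia.
  by move=> /(_ j gj)[i [im si]]; exfalso; apply: (sj i); [lia|].
split=> // [c c1|a N G a1 rN uG].
  apply: contrapT => h.
  have ge n : c <= rho n by rewrite leNgt; apply/negP => hn; apply: h; exists n.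
  have /finite_seqP[l lE] := g_levels c1.
  have /choice[f fP] n : exists j, s n = Some j.
    have := ge n; rewrite /rho; case: (s n) => [j|]; first by exists j.
    by rewrite leNgt c1.
  have uf : uniq [seq f i | i <- iota 0 (size l).+1].
    rewrite map_inj_uniq ?iota_uniq // => m n fmn.
    by apply: enumeration_inj (fP m) _; rewrite fP fmn.
  have /(uniq_leq_size uf) : {subset [seq f i | i <- iota 0 (size l).+1] <= l}.
    move=> _ /mapP[i _ ->]; have := congr1 (fun A => A (f i)) lE => /= <-.
    by have := ge i; rewrite /rho fP.
  by rewrite size_map size_iota ltnn.
(* Both sides become sums of one nonnegative function over lists of options and are compared by
   inclusion: an index with [a < g j] not listed before [N] would contradict [rho N <= a]. *)
pose F (o : option J) := if o is Some j then Num.max (g j - a) 0 else 0.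
have F0 o : 0 <= F o by case: o => //= j; rewrite le_max lexx orbT.
have -> : \sum_(0 <= n < N) Num.max (rho n - a) 0 = \sum_(o <- map s (iota 0 N)) F o.
  rewrite big_map /index_iota subn0; apply: eq_bigr => i _; rewrite /rho.
  by case: (s i) => //=; apply/max_idPr; lra.
have -> : \sum_(j <- G) Num.max (g j - a) 0 =
    \sum_(o <- map Some [seq j <- G | a < g j]) F o.
  rewrite big_map big_filter [LHS](bigID (fun j => a < g j)) /= addrC big1 ?add0r //.
  by move=> j; rewrite -leNgt => h; apply/max_idPr; lra.
apply: ler_sum_subset => //.
  by rewrite map_inj_uniq ?filter_uniq // => ? ? [].
move=> _ /mapP[j jG ->]; move: jG; rewrite mem_filter => /andP[aj _].
have j1 := lt_trans a1 aj; apply: contrapT => /negP /mapP h.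
have nos i : (i < N)%N -> s i <> Some j.
  by move=> iN si; apply: h; exists i; rewrite ?mem_iota.
have := sP N; move: rN; rewrite /rho; case: (s N) => [k|].
  by move=> ka [_ _ /(_ j j1 nos)]; rewrite leNgt (le_lt_trans ka).
by move=> _ /(_ j j1)[i [iN si]]; exact: (nos i iN).
Qed.

End SortedEnumeration.

(** * Mutually orthogonal reserves for the two ends of the unit interval *)

Section Reserves.
Context {R : realType} {H : completeNormedModType R[i]}.
Variable ip : {dot H for @Num.conj R[i]}.
Hypothesis ip_norm : norm_of_inner ip.
Notation sqnorm := (sqnorm ip).
Variable E : H -> H.
Hypothesis EP : forall a x y, E (a *: x + y) = a *: E x + E y.
Hypothesis E_sa : self_adjoint ip E.
Variable K : R.
Hypothesis EK : forall x, sqnorm (E x) <= K * sqnorm x.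
Hypothesis nf0 : ~ fredholm (fun x => E x - 0%:C%C *: x).
Hypothesis nf1 : ~ fredholm (fun x => E x - 1%:C%C *: x).
Hypothesis f_above : forall m : R, 1 < m -> fredholm (fun x => E x - m%:C%C *: x).
Hypothesis f_below : forall m : R, m < 0 -> fredholm (fun x => E x - m%:C%C *: x).
Variables (J : countType) (lam : J -> R) (v : J -> H).
Hypothesis v1 : forall j, sqnorm (v j) = 1.
Hypothesis vo : forall i j, i <> j -> ip (v i) (v j) = 0.
Hypothesis Ev : forall j, E (v j) = (lam j)%:C%C *: v j.

Definition diag (x : H) : R := complex.Re (ip (E x) x).

Lemma diag_eigenvector j : diag (v j) = lam j.
Proof. by rewrite /diag Ev ipZl ip_sqnorm v1 mulr1. Qed.

Let E0 : E 0 = 0.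
Proof. by have := EP (-1) 0 0; rewrite scaler0 addr0 scaleN1r addNr. Qed.

Lemma eigenvalue_bound j : lam j ^+ 2 <= K.
Proof. by have := EK (v j); rewrite Ev sqnormZ v1 sqabs_real !mulr1. Qed.

Lemma eigenvalue_abs j : `|lam j| <= K + 1.
Proof.
have := eigenvalue_bound j; rewrite -real_normK ?num_real // => h.
have := sqr_ge0 (`|lam j| - 1); have := normr_ge0 (lam j); nra.
Qed.

Lemma finite_levels_above (a : R) : 1 < a -> finite_set [set j | a <= lam j].
Proof.
move=> a1; apply: (finite_levels (B := K + 1)) => [j|m am].
  exact: le_trans (ler_norm _) (eigenvalue_abs j).
apply: (isolated_eigenvalue ip_norm EP E_sa EK v1 vo Ev).
by apply: f_above; exact: lt_le_trans am.
Qed.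

Lemma finite_levels_below (a : R) : 1 < a -> finite_set [set j | a <= 1 - lam j].
Proof.
move=> a1; apply: (finite_levels (B := K + 2)) => [j|m am].
  by have := eigenvalue_abs j; rewrite ler_norml => /andP[? ?]; lra.
have [|eps eps0 fin] := isolated_eigenvalue ip_norm EP E_sa EK v1 vo Ev (m := 1 - m).
  by apply: f_below; lra.
exists eps => //; move: fin; congr finite_set; apply/seteqP; split=> j /=;
  by rewrite -normrN; congr (`|_| < _); ring.
Qed.

(** The eigenvectors in [B] may be infinite in number but their eigenvalues are far from [m]; those
    in [C] may be close to [m] but are finite in number and join the list [G]. *)
Lemma weyl_vector_eigen (m : R) (B C : set J) (G : seq H) (eps : R) :
  ~ fredholm (fun x => E x - m%:C%C *: x) ->
  (forall j, B j -> 1 <= (lam j - m) ^+ 2) -> finite_set C -> 0 < eps ->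
  exists u, [/\ sqnorm u = 1, forall g, g \in G -> ip u g = 0,
    forall j, B j \/ C j -> ip u (v j) = 0 & `|diag u - m| <= eps].
Proof.
move=> nf B1 /finite_seqP[c cE] eps0.
(* Indices in [B] are spread over [nat] by [pickle]. At the gaps [z] is [0] and [t] is [1], which
   respects the lower bound on [t]. *)
pose pick k := if pickle_inv k is Some j then if `[< B j >] then Some j else None else None.
pose z k := if pick k is Some j then v j else 0.
pose t k := if pick k is Some j then lam j - m else 1.
have pickP k j : pick k = Some j -> B j /\ pickle j = k.
  rewrite /pick; case: (pickle_inv k) (@pickle_invK J k) => //= a ak.
  by case: asboolP => // Ba [<-].
have zo : orthogonal_family ip z.
  split=> [k|i k ik]; first by rewrite /z; case: (pick k); [left|right].
  rewrite /z; case Ei : (pick i) => [a|]; last exact: ip0l.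
  case Ek : (pick k) => [b|]; last exact: ip0r.
  apply: vo => ab; apply: ik; have [_ <-] := pickP _ _ Ei; have [_ <-] := pickP _ _ Ek.
  by rewrite ab.
have zt k : E (z k) - m%:C%C *: z k = (t k)%:C%C *: z k.
  rewrite /z /t; case: (pick k) => [a|]; last by rewrite E0 !scaler0 subr0.
  by rewrite Ev -scalerBl -rmorphB.
have t1 k : 1 <= t k ^+ 2.
  rewrite /t; case Ek : (pick k) => [a|]; last by rewrite expr1n.
  by apply: B1; exact: (pickP _ _ Ek).1.
have [u [u1 uG uz ud]] := weyl_vector_orth ip_norm EP E_sa EK (G ++ map v c)
  nf zo zt t1 eps0.
exists u; split=> // [g gG|j [Bj|Cj]].
- by apply: uG; rewrite mem_cat gG.
- have := uz (pickle j); rewrite /z /pick pickleK_inv.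
  by case: asboolP.
- apply: uG; rewrite mem_cat map_f ?orbT //.
  by have := congr1 (fun A => A j) cE => /= <-.
Qed.

(** Even indices aim at the value 1, odd ones at 0. A side with infinitely many eigenvalues beyond
    it needs no padding, and the zero vector is accepted there. *)
Let near_essential (eps : R) (n : nat) (f : nat -> H) (x : H) : Prop :=
  [/\ forall i, (i < n)%N -> ip (f i) x = 0,
      forall j, 1 < lam j \/ lam j < 0 -> ip x (v j) = 0,
      ~~ odd n -> finite_set [set j | 1 < lam j] ->
        sqnorm x = 1 /\ `|diag x - 1| <= eps * 2^-1 ^+ n
    & odd n -> finite_set [set j | lam j < 0] ->
        sqnorm x = 1 /\ `|diag x| <= eps * 2^-1 ^+ n].

Let essential_pool (eps : R) : 0 < eps ->
  exists t : nat -> H, forall n, near_essential eps n t (t n).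
Proof.
move=> eps0; apply: (sequential_choice 0) => [n f f' x ff' [xf xv xe xo]|n f _].
  by split=> // i ni; rewrite -ff' //; exact: xf.
have en0 : 0 < eps * 2^-1 ^+ n by rewrite mulr_gt0 // exprn_gt0 // invr_gt0.
have memf i : (i < n)%N -> f i \in [seq f i | i <- iota 0 n].
  by move=> ni; rewrite map_f // mem_iota.
have [[on fin]|nc] := pselect (~~ odd n /\ finite_set [set j | 1 < lam j]).
  have [||u [u1 uG uv ud]] := weyl_vector_eigen (m := 1) (B := [set j | lam j < 0])
      [seq f i | i <- iota 0 n] _ _ fin en0; first exact: nf1.
    by move=> j /= h; nra.
  exists u; split=> // [i ni|j [h|h]|h]; last by rewrite h in on.
  - by apply: ipC0; apply: uG; exact: memf.
  - by apply: uv; right.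
  - by apply: uv; left.
have [[on fin]|nc'] := pselect (odd n /\ finite_set [set j | lam j < 0]).
  have [||u [u1 uG uv ud]] := weyl_vector_eigen (m := 0) (B := [set j | 1 < lam j])
      [seq f i | i <- iota 0 n] _ _ fin en0; first exact: nf0.
    by move=> j /= h; nra.
  exists u; split=> [i ni|j [h|h]|h|_ _]; last by rewrite subr0 in ud.
  - by apply: ipC0; apply: uG; exact: memf.
  - by apply: uv; left.
  - by apply: uv; right.
  - by rewrite on in h.
exists 0; split=> [i _|j _|on fin|on fin]; rewrite ?ip0l ?ip0r //.
  by exfalso; apply: nc.
by exfalso; apply: nc'.
Qed.

(** Eigenvectors first, then vectors of one common pool, even places for [Y] and odd ones for [X].
    As the pool is orthogonal to all eigenvectors involved, the two sides are orthogonal to each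
    other. *)
Lemma reserves (eps : R) : 0 < eps -> exists (X Y : nat -> H) (xi rho : nat -> R),
  [/\ orthonormal_seq ip X /\ orthonormal_seq ip Y, forall i k, ip (X i) (Y k) = 0,
      level_enumeration (fun j => 1 - lam j) xi /\ level_enumeration lam rho,
      forall n, `|1 - diag (X n) - xi n| <= eps * 2^-1 ^+ n /\
        (1 < xi n -> 1 - diag (X n) = xi n)
    & forall n, `|diag (Y n) - rho n| <= eps * 2^-1 ^+ n /\
        (1 < rho n -> diag (Y n) = rho n)].
Proof.
move=> eps0; have [t tP] := essential_pool eps0.
have [s sP] := sorted_enumeration finite_levels_above.
have [s' s'P] := sorted_enumeration finite_levels_below.
have to i k : i <> k -> ip (t i) (t k) = 0.
  move=> ik; case: (ltngtP i k) => // h; first by have [+ _ _ _] := tP k; apply.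
  by apply: ipC0; have [+ _ _ _] := tP i; apply.
have tv i j : 1 < lam j \/ lam j < 0 -> ip (t i) (v j) = 0.
  by have [_ + _ _] := tP i; apply.
have vt i j : 1 < lam j \/ lam j < 0 -> ip (v j) (t i) = 0.
  by move=> h; apply: ipC0; exact: tv.
pose Y n := if s n is Some j then v j else t n.*2.
pose X n := if s' n is Some j then v j else t n.*2.+1.
have s_above n j : s n = Some j -> 1 < lam j by exact: enumeration_above sP _ _.
have s'_below n j : s' n = Some j -> lam j < 0.
  by move=> /(enumeration_above s'P) /=; lra.
have tY n : s n = None -> sqnorm (t n.*2) = 1 /\ `|diag (t n.*2) - 1| <= eps * 2^-1 ^+ n.*2.
  move=> sn; have [_ _ + _] := tP n.*2; rewrite odd_double; apply=> //.
  exact: (enumeration_exhausted sP sn).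
have tX n : s' n = None ->
    sqnorm (t n.*2.+1) = 1 /\ `|diag (t n.*2.+1)| <= eps * 2^-1 ^+ n.*2.+1.
  move=> sn; have [_ _ _] := tP n.*2.+1; rewrite /= odd_double; apply=> //.
  suff <- : [set j | 1 < 1 - lam j] = [set j | lam j < 0].
    exact: (enumeration_exhausted s'P sn).
  by apply/seteqP; split=> j /= h; lra.
have small m n : (m <= n)%N -> eps * 2^-1 ^+ n <= eps * 2^-1 ^+ m.
  move=> mn; rewrite ler_wpM2l ?(ltW eps0) // ler_wiXn2l // ?invr_ge0 //.
  by rewrite invf_le1 // ler1n.
exists X, Y, (fun n => if s' n is Some j then 1 - lam j else 1),
  (fun n => if s n is Some j then lam j else 1); split.
- split; split.
  + by move=> n; rewrite /X; case Es : (s' n) => [j|]; [exact: v1|exact: (tX n Es).1].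
  + move=> m n mn; rewrite /X; case Em : (s' m) => [j|]; case En : (s' n) => [k|].
    * apply: vo => jk; apply: mn; rewrite jk in Em; exact: enumeration_inj s'P _ _ _ Em En.
    * by apply: vt; right; exact: s'_below Em.
    * by apply: tv; right; exact: s'_below En.
    * by apply: to => h; apply: mn; lia.
  + by move=> n; rewrite /Y; case Es : (s n) => [j|]; [exact: v1|exact: (tY n Es).1].
  + move=> m n mn; rewrite /Y; case Em : (s m) => [j|]; case En : (s n) => [k|].
    * apply: vo => jk; apply: mn; rewrite jk in Em; exact: enumeration_inj sP _ _ _ Em En.
    * by apply: vt; left; exact: s_above Em.
    * by apply: tv; left; exact: s_above En.
    * by apply: to => h; apply: mn; lia.
- move=> m n; rewrite /X /Y; case Em : (s' m) => [j|]; case En : (s n) => [k|].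
  + apply: vo => jk; have := s'_below _ _ Em; have := s_above _ _ En; rewrite jk; lra.
  + by apply: vt; right; exact: s'_below Em.
  + by apply: tv; left; exact: s_above En.
  + by apply: to; lia.
- split; first exact: level_enumeration_sorted finite_levels_below _ s'P.
  exact: level_enumeration_sorted finite_levels_above _ sP.
- move=> n; rewrite /X; case Es : (s' n) => [j|]; last first.
    split; last by rewrite ltxx.
    have -> : 1 - diag (t n.*2.+1) - 1 = - diag (t n.*2.+1) by ring.
    rewrite normrN; apply: le_trans (tX n Es).2 _; apply: small; lia.
  rewrite diag_eigenvector subrr normr0; split=> //.
  by rewrite mulr_ge0 ?(ltW eps0) // exprn_ge0 // invr_ge0.
- move=> n; rewrite /Y; case Es : (s n) => [j|]; last first.
    split; last by rewrite ltxx.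
    apply: le_trans (tY n Es).2 _; apply: small; lia.
  rewrite diag_eigenvector subrr normr0; split=> //.
  by rewrite mulr_ge0 ?(ltW eps0) // exprn_ge0 // invr_ge0.
Qed.

End Reserves.

(** * Majorization *)

Lemma sum_sub_const (R : realType) (T : Type) (s : seq T) (f : T -> R) (a : R) :
  \sum_(i <- s) (f i - a) = \sum_(i <- s) f i - (size s)%:R * a.
Proof.
elim: s => [|x s IH]; first by rewrite !big_nil /= mul0r subr0.
by rewrite !big_cons IH /= -natr1; ring.
Qed.

Lemma sum_geometric_seq (R : realType) (F : seq nat) : uniq F ->
  \sum_(i <- F) 2^-1 ^+ i <= 2 :> R.
Proof.
move=> uF; pose N := (\max_(i <- F) i).+1.
have p0 (i : nat) : 0 <= 2^-1 ^+ i :> R by rewrite exprn_ge0 // invr_ge0.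
have /(ler_sum_subset p0 uF) h : {subset F <= index_iota 0 N}.
  move=> i iF; rewrite mem_index_iota /= ltnS.
  by rewrite (big_rem i) //= leq_maxl.
apply: le_trans h _.
have -> n : \sum_(0 <= i < n) 2^-1 ^+ i = 2 - 2 * 2^-1 ^+ n :> R.
  elim: n => [|n IH]; first by rewrite big_geq // expr0; ring.
  by rewrite big_nat_recr //= IH exprS; field.
by rewrite gerBl mulr_ge0.
Qed.

Section Demands.
Context {R : realType}.
Variables d rho : nat -> R.
Hypothesis rho1 : forall n, 1 <= rho n.
Hypothesis rho_mono : forall m n, (m <= n)%N -> rho n <= rho m.
Hypothesis rho_lim : forall c, 1 < c -> exists N, rho N < c.

(* Even indices carry the demands [d i]; each odd index asks for one more
   vector with value (slightly above) 1, which later serves as room near 1. *)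
Definition demand (i : nat) : R := if odd i then 1 else Num.max (d i./2) 1.

(** The inequality [f_d(a) + c <= f_lam(a)] for levels [a] between 1 and [a0], in finite form: the
    right-hand sum may stop once [rho] has sunk to [a]. *)
Definition slack (c a0 : R) : Prop :=
  forall a, 1 < a < a0 -> forall N F, rho N <= a -> uniq F ->
    \sum_(i <- F) Num.max (d i - a) 0 + c <= \sum_(0 <= n < N) Num.max (rho n - a) 0.

Lemma demand_ge1 i : 1 <= demand i.
Proof. by rewrite /demand; case: ifP => // _; rewrite le_max lexx orbT. Qed.

(** At levels [a >= 1], neither the additional demands for 1 nor raising [d i] to 1 contributes
    anything positive. *)
Lemma demand_excess (a : R) (F : seq nat) : 1 <= a -> uniq F ->
  exists F', uniq F' /\
    \sum_(i <- F) (demand i - a) <= \sum_(i <- F') Num.max (d i - a) 0.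
Proof.
move=> a1 uF; exists [seq i./2 | i <- F & ~~ odd i]; split.
  rewrite map_inj_in_uniq ?filter_uniq // => i j.
  rewrite !mem_filter => /andP[oi _] /andP[oj _] ij.
  by rewrite -(odd_double_half i) -(odd_double_half j) ij (negbTE oi) (negbTE oj).
rewrite big_map big_filter (bigID odd) /=.
rewrite -[leRHS]add0r lerD //.
  by apply: sumr_le0 => i oi; rewrite /demand oi subr_le0.
apply: ler_sum => i oi; rewrite /demand (negbTE oi) le_max.
have [h|h] := leP (d i./2) 1; first by rewrite subr_le0 a1 orbT.
by rewrite lexx.
Qed.

(** Levels are traded for partial sums: at the level [a = rho (size F).-1], both sums become plain
    sums minus [size F] times [a]. If [rho (size F) = 1], levels tending to 1 are used instead. *)
Lemma slack_sum (c a0 : R) (F : seq nat) : slack c a0 -> uniq F ->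
  (rho (size F) = 1 /\ 1 < a0) \/
    ((0 < size F)%N /\ 1 < rho (size F).-1 < a0) ->
  \sum_(i <- F) demand i + c <= \sum_(0 <= k < size F) rho k.
Proof.
move=> sl uF; set n := size F; move=> [[rn a01]|[n0 /andP[rn rna]]]; last first.
  have [F' [uF' FF']] := demand_excess (ltW rn) uF.
  have := sl (rho n.-1) _ n.-1 F' (lexx _) uF'; rewrite rn rna => /(_ isT) h.
  have : \sum_(0 <= k < n.-1) Num.max (rho k - rho n.-1) 0 =
         \sum_(0 <= k < n) rho k - n%:R * rho n.-1.
    have nR : n%:R = n.-1%:R + 1 :> R by rewrite natr1 prednK.
    have -> : \sum_(0 <= k < n) rho k = \sum_(0 <= k < n.-1) rho k + rho n.-1.
      by rewrite -{1}(prednK n0) big_nat_recr.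
    rewrite nR.
    have -> : \sum_(0 <= k < n.-1) Num.max (rho k - rho n.-1) 0 =
        \sum_(k <- index_iota 0 n.-1) (rho k - rho n.-1).
      apply: eq_big_nat => k /andP[_ kn]; apply/max_idPl.
      by rewrite subr_ge0; apply: rho_mono; exact: ltnW.
    by rewrite sum_sub_const size_iota subn0; ring.
  by move: FF' h; rewrite sum_sub_const -/n; lra.
apply/ler_addgt0Pr => e e0.
(* Small enough to keep [1 + t] below [a0] and to cost at most [e] over all [n] terms. *)
pose t := Num.min ((a0 - 1) / 2) (e / n.+1%:R).
have t0 : 0 < t by rewrite lt_min !divr_gt0 // subr_gt0.
have ta : 1 + t < a0.
  have : t <= (a0 - 1) / 2 by rewrite ge_min lexx.
  lra.
have te : n%:R * t <= e.
  have : t <= e / n.+1%:R by rewrite ge_min lexx orbT.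
  rewrite ler_pdivlMr // -natr1; have := ler0n R n; lra.
have a1 : 1 <= 1 + t by rewrite lerDl ltW.
have [F' [uF' FF']] := demand_excess a1 uF.
have := sl (1 + t) _ n F' _ uF'; rewrite ta ltrDl t0 rn a1 => /(_ isT isT) h.
have : \sum_(0 <= k < n) Num.max (rho k - (1 + t)) 0 <=
       \sum_(k <- index_iota 0 n) (rho k - 1).
  apply: ler_sum => k _; have := rho1 k; rewrite ge_max; lra.
move: FF' h; rewrite !sum_sub_const size_iota subn0 -/n mulr1 mulrDr mulr1; lra.
Qed.

(** Slack near the level 1 reaches only prefixes of length at least [n0]. On shorter ones every
    [rho k] exceeds 1, where the reserve has exact values. *)
Lemma slack_from (c a0 : R) : slack c a0 -> 1 < a0 ->
  exists n0, (forall k, (k < n0)%N -> 1 < rho k) /\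
    forall F, uniq F -> (n0 <= size F)%N ->
      \sum_(i <- F) demand i + c <= \sum_(0 <= k < size F) rho k.
Proof.
move=> sl a01.
have ex : exists n, (rho n == 1) || ((0 < n)%N && (rho n.-1 < a0)).
  by have [N Na] := rho_lim a01; exists N.+1; rewrite /= Na orbT.
have [n0 n0P n0min] := ex_minnP ex; exists n0; split=> [k kn|F uF nF].
  rewrite lt_def rho1 andbT; apply/negP => h.
  by have := n0min k; rewrite h => /(_ isT); lia.
apply: (slack_sum sl uF).
have [rF|rF] := eqVneq (rho (size F)) 1; first by left.
right; have rF1 : 1 < rho (size F) by rewrite lt_def rF rho1.
have r01 : 1 < rho n0 by apply: lt_le_trans rF1 _; exact: rho_mono.
move: n0P; rewrite gt_eqF //= => /andP[n00 ra].
split; first exact: leq_trans nF.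
apply/andP; split; first by apply: lt_le_trans rF1 _; apply: rho_mono; exact: leq_pred.
by apply: le_lt_trans ra; apply: rho_mono; rewrite -!subn1 leq_sub2r.
Qed.

Lemma no_slack_sum (F : seq nat) : (forall a0, slack 0 a0) -> uniq F ->
  \sum_(i <- F) demand i <= \sum_(0 <= k < size F) rho k.
Proof.
move=> sl uF; rewrite -[leLHS]addr0.
have [/size0nil ->|n0] := posnP (size F); first by rewrite big_nil addr0 big_geq.
apply: (slack_sum (sl (rho 0%N + 1)) uF).
have [h|h] := eqVneq (rho (size F).-1) 1.
  left; split; last by have := rho1 0; lra.
  apply/eqP; rewrite eq_le rho1 andbT -h; apply: rho_mono; lia.
right; split=> //; rewrite lt_def h rho1 /=.
have : rho (size F).-1 <= rho 0%N by exact: rho_mono.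
lra.
Qed.

Variables (r : nat -> R) (eps : R).
Hypothesis r_rho : forall n, `|r n - rho n| <= eps * 2^-1 ^+ n /\
  (1 < rho n -> r n = rho n).
Hypothesis eps0 : 0 < eps.

(** From length [n0] on, slack pays for the raises [y] and for the deviations of [r] from [rho].
    Below [n0] there is no slack, but the values are exact and at least [1 + kappa], which covers
    every raised demand. Raising all served demands above 1 secures the tail condition, as the
    values end up close to or below 1. *)
Lemma perturbed_majorization (U : set nat) (y : nat -> R) (n0 : nat) (kappa : R) :
  (forall a0, slack 0 a0) ->
  (forall i, 0 <= y i) -> (forall k, (k < n0)%N -> 1 + kappa <= rho k) ->
  (forall i, 0 < y i -> demand i + y i <= 1 + kappa) -> 0 < kappa ->
  (forall F, uniq F -> (n0 <= size F)%N ->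
     \sum_(i <- F) demand i + \sum_(i <- F) y i + 2 * eps
       <= \sum_(0 <= k < size F) rho k) ->
  (forall i, U i -> 1 < demand i + y i) ->
  (forall F : seq nat, uniq F -> (forall i, i \in F -> U i) ->
        \sum_(i <- F) (demand i + y i) <= \sum_(k < size F) r k) /\
  (forall i, U i -> exists K, forall k, (K <= k)%N -> r k < demand i + y i).
Proof.
move=> sl y0 k0 yk kap0 big1 U1; split=> [F uF _|i /U1 h]; last first.
  pose e := demand i + y i - 1; have e0 : 0 < e by rewrite subr_gt0.
  have [|N NP] := rho_lim (c := 1 + e / 2); first by rewrite ltrDl divr_gt0.
  (* From here on both [rho k - 1] and the deviation of [r k] are below [e / 2]. *)
  exists (maxn N (Num.truncn (2 * eps / e)).+1) => k.
  rewrite geq_max => /andP[Nk tk].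
  have := (r_rho k).1; rewrite ler_norml => /andP[_ h1].
  have h2 := rho_mono Nk.
  have : eps * 2^-1 ^+ k < e / 2.
    rewrite exprVn ltr_pdivrMr ?exprn_gt0 //.
    have : 2 * eps / e < 2 ^+ k.
      apply: lt_le_trans (Num.Theory.truncnS_gt _) _.
      rewrite -natrX ler_nat (leq_trans tk) // ltnW // ltn_expl //.
    by rewrite ltr_pdivrMr //; lra.
  have -> : demand i + y i = 1 + e by rewrite /e; ring.
  lra.
rewrite -(big_mkord xpredT r); have [nF|nF] := leqP n0 (size F).
  have : \sum_(0 <= k < size F) (rho k - eps * 2^-1 ^+ k) <=
         \sum_(0 <= k < size F) r k.
    by apply: ler_sum => k _; have := (r_rho k).1; rewrite ler_norml => /andP[]; lra.
  have : \sum_(0 <= k < size F) eps * 2^-1 ^+ k <= 2 * eps.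
    rewrite -mulr_sumr mulrC ler_wpM2r ?(ltW eps0) //.
    exact: sum_geometric_seq (iota_uniq _ _).
  by have := big1 F uF nF; rewrite sumrB big_split /=; lra.
have -> : \sum_(0 <= k < size F) r k = \sum_(0 <= k < size F) rho k.
  apply: eq_big_nat => k /andP[_ kF]; apply: (r_rho k).2.
  by apply: lt_le_trans (k0 k _); [rewrite ltrDl|exact: ltn_trans nF].
(* The unraised demands are compared with the first [size F1] values; each raised one is at most
   [1 + kappa] and takes one of the remaining values. *)
pose F1 := [seq i <- F | y i == 0].
have s1 : \sum_(i <- F1) demand i <= \sum_(0 <= k < size F1) rho k.
  by apply: no_slack_sum => //; rewrite filter_uniq.
have sF : (size F1 <= size F)%N by rewrite size_filter count_size.
rewrite (big_cat_nat (n := size F1)) //= (bigID (fun i => y i == 0)) /= lerD //.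
  rewrite -big_filter (eq_big_seq demand) // => i.
  by rewrite mem_filter => /andP[/eqP -> _]; rewrite addr0.
rewrite -big_filter; set F2 := [seq i <- F | _].
apply: (@le_trans _ _ (\sum_(i <- F2) (1 + kappa))).
  rewrite big_seq [leRHS]big_seq; apply: ler_sum => i.
  by rewrite mem_filter => /andP[yi _]; apply: yk; rewrite lt_def yi y0.
have -> : \sum_(i <- F2) (1 + kappa) = \sum_(size F1 <= k < size F) (1 + kappa).
  rewrite big_const_seq count_predT sumr_const_nat iter_addr_0.
  congr (_ *+ _); rewrite !size_filter -(count_predC (fun i => y i == 0) F).
  by rewrite addKn.
apply: ler_sum_nat => k /andP[_ kF].
by apply: k0; exact: ltn_trans nF.
Qed.

End Demands.

(** Each new term is [a] divided by about [M k], where [k] is the number of multiples of [a] reached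
    by the running sum [C]. Thus a finite set can have a sum of order [a * k] only if its size is at
    least [M k]. *)
Lemma slow_divergent (R : realType) (P : set nat) (M : nat -> nat) (a : R) :
  0 < a -> infinite_set P -> exists y : nat -> R,
  [/\ forall i, 0 <= y i <= a, forall i, ~ P i -> y i = 0,
      forall i, P i -> 0 < y i, divergent y
    & forall F, uniq F -> \sum_(i <- F) y i <= a \/
        exists k, (M k <= size F)%N /\ \sum_(i <- F) y i <= a * (k%:R + 3)].
Proof.
move=> a0 iP.
pose inc i (C : R) := if `[< P i >] then a / (M (Num.truncn (C / a))).+1%:R else 0.
pose C := fix C n := if n is i.+1 then C i + inc i (C i) else 0.
pose y i := inc i (C i).
have CE n : C n = \sum_(0 <= i < n) y i.
  elim: n => [|n IH]; first by rewrite big_geq.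
  by rewrite big_nat_recr //= -IH.
have yM i : P i -> y i = a / (M (Num.truncn (C i / a))).+1%:R.
  by rewrite /y /inc; case: asboolP.
have yP i : P i -> 0 < y i by move=> /yM ->; rewrite divr_gt0.
have yN i : ~ P i -> y i = 0 by rewrite /y /inc; case: asboolP.
have y0 i : 0 <= y i.
  by have [/yP/ltW//|/yN ->] := pselect (P i).
have ya i : y i <= a.
  have [/yM ->|/yN ->] := pselect (P i); last exact: ltW.
  by rewrite ler_pdivrMr // ler_peMr ?(ltW a0) // ler1n.
exists y; split=> //.
- by move=> i; rewrite y0 ya.
- move=> B; apply: contrapT => nB.
  have CB n : C n < B.
    by rewrite ltNge CE; apply/negP => h; apply: nB; exists n.
  (* If the running sum stayed below [B], only finitely many [M k] would occur, and the terms on [P]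
     would be bounded away from 0. *)
  pose L := (\max_(k < (Num.truncn (B / a)).+1) M k).+1.
  have yL i : P i -> a / L%:R <= y i.
    move=> Pi; rewrite yM // ler_pM2l // lef_pV2 ?posrE // ler_nat ltnS.
    have kB : (Num.truncn (C i / a) < (Num.truncn (B / a)).+1)%N.
      by rewrite ltnS; apply: le_truncn; rewrite ler_pM2r ?invr_gt0 // ltW.
    exact: (@leq_bigmax _ (fun k : 'I__ => M k) (Ordinal kB)).
  have [f [finj fP]] := injective_choice (fun=> iP).
  pose n := (Num.truncn (B / (a / L%:R))).+1.
  pose s := [seq f i | i <- index_iota 0 n].
  have us : uniq s by rewrite map_inj_uniq ?iota_uniq.
  have sub : {subset s <= index_iota 0 (\max_(i <- s) i).+1}.
    move=> i si; rewrite mem_index_iota /= ltnS (big_rem i) //=.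
    by rewrite leq_maxl.
  have := CB (\max_(i <- s) i).+1; rewrite ltNge CE => /negP; apply.
  apply: le_trans (ler_sum_subset y0 us sub).
  have aL : 0 < a / L%:R by rewrite divr_gt0.
  apply: (@le_trans _ _ (n%:R * (a / L%:R))).
    by rewrite -ler_pdivrMr //; exact/ltW/Num.Theory.truncnS_gt.
  have -> : n%:R * (a / L%:R) = \sum_(0 <= i < n) a / L%:R.
    by rewrite sumr_const_nat subn0 mulr_natl.
  by rewrite big_map; apply: ler_sum => i _; exact/yL/fP.
- move=> F uF; set n := size F.
  (* The terms outside [small] are at most [a / n.+1] each, so at most [a] together. The others are
     bounded by the running sum up to the last of them. *)
  pose small i := `[< P i >] && (M (Num.truncn (C i / a)) <= n)%N.
  have big_le : \sum_(i <- F | ~~ small i) y i <= a.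
    apply: (@le_trans _ _ (\sum_(i <- F | ~~ small i) a / n.+1%:R)).
      apply: ler_sum => i; rewrite negb_and -ltnNge => /orP[/asboolPn/yN -> |h].
        by rewrite divr_ge0 // ltW.
      have [Pi|/yN ->] := pselect (P i); last by rewrite divr_ge0 // ltW.
      by rewrite yM // ler_pM2l // lef_pV2 ?posrE // ler_nat ltnS ltnW.
    apply: (@le_trans _ _ (\sum_(i <- F) a / n.+1%:R)).
      rewrite [leRHS](bigID (fun i => ~~ small i)) /= lerDl.
      by apply: sumr_ge0 => i _; rewrite divr_ge0 // ltW.
    rewrite big_const_seq count_predT iter_addr_0 -/n -[_ *+ n]mulr_natl mulrCA.
    by rewrite ler_piMr ?(ltW a0) // ler_pdivrMr // mul1r ler_nat -/n.
  have [/hasP[i0 i0F si0]|nosmall] := boolP (has small F); last first.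
    left; apply: le_trans big_le; rewrite [leLHS](bigID small) /=.
    rewrite big_hasC ?add0r //.
  right; have [|m [mF mmax]] := @seq_argmax R nat (fun i => i%:R) [seq i <- F | small i] i0.
    by rewrite mem_filter si0.
  move: mF; rewrite mem_filter => /andP[/andP[/asboolP Pm Mm] mF].
  exists (Num.truncn (C m / a)); split=> //.
  have km : C m <= a * (Num.truncn (C m / a)).+1%:R.
    by rewrite mulrC -ler_pdivrMr //; exact/ltW/Num.Theory.truncnS_gt.
  have sm : \sum_(i <- F | small i) y i <= C m + y m.
    rewrite CE -big_nat_recr //= -big_filter; apply: ler_sum_subset => //.
      by rewrite filter_uniq.
    by move=> i /mmax; rewrite ler_nat mem_index_iota ltnS.
  rewrite (bigID small) /=; have := ya m; move: km; rewrite -natr1; lra.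
Qed.

(** * Vectors serving the demands, together with spare ones *)

Section ServedDemands.
Context {R : realType} {H : completeNormedModType R[i]}.
Variable ip : {dot H for @Num.conj R[i]}.
Notation sqnorm := (sqnorm ip).
Variables (v : H -> R) (qv : quadratic ip v).

(* [q i] has at least the value demanded by [b i]; the [u k] are spare vectors
   with values at least 1.  Both lie in the closed span of [Y], which is
   expressed by orthogonality to everything orthogonal to [Y]. *)
Definition served (U : set nat) (b : nat -> R) (Y q u : nat -> H) : Prop :=
  [/\ (forall i, U i -> sqnorm (q i) = 1 /\ b i <= v (q i)) /\
        (forall i, ~ U i -> q i = 0),
      forall i j, i <> j -> ip (q i) (q j) = 0,
      orthonormal_seq ip u /\ (forall k, 1 <= v (u k)),
      forall i k, ip (q i) (u k) = 0
    & forall z, (forall k, ip (Y k) z = 0) ->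
        (forall i, ip (q i) z = 0) /\ (forall k, ip (u k) z = 0)].

Variables (d : nat -> R) (U : set nat) (Y : nat -> H).

Lemma served_of_majorized (y : nat -> R) : (forall i, 0 <= y i) ->
  majorized_by ip v (fun i => demand d i + y i) [set i | odd i \/ U i./2] Y ->
  exists q u, served U (fun i => d i + y i.*2) Y q u.
Proof.
move=> y0 /(schur_horn_family qv)[e [e1 e0 eo eY]].
exists (fun i => e i.*2), (fun k => e k.*2.+1); split.
- split=> i Ui; last first.
    by apply: e0 => /=; rewrite odd_double doubleK => -[].
  have [|-> ->] := e1 i.*2; first by right; rewrite doubleK.
  split=> //; rewrite lerD2r /demand odd_double doubleK le_max lexx //.
- by move=> i j ij; apply: eo => h; apply: ij; exact: double_inj.
- split; last first.
    move=> k; have [|_ ->] := e1 k.*2.+1; first by left; rewrite /= odd_double.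
    by have := demand_ge1 d k.*2.+1; have := y0 k.*2.+1; lra.
  split=> [k|j k jk]; last by apply: eo => -[/double_inj].
  by have [|-> _] := e1 k.*2.+1; first by left; rewrite /= odd_double.
- by move=> i k; apply: eo => h; have := congr1 odd h; rewrite /= !odd_double.
- by move=> z /eY h; split=> k; exact: h.
Qed.

Hypothesis Yo : orthonormal_seq ip Y.
Variables (rho : nat -> R) (eps : R).
Hypothesis rho1 : forall n, 1 <= rho n.
Hypothesis rho_mono : forall m n, (m <= n)%N -> rho n <= rho m.
Hypothesis rho_lim : forall c, 1 < c -> exists N, rho N < c.
Hypothesis Y_rho : forall n, `|v (Y n) - rho n| <= eps * 2^-1 ^+ n /\
  (1 < rho n -> v (Y n) = rho n).
Hypothesis eps0 : 0 < eps.
Hypothesis sl0 : forall a0, slack d rho 0 a0.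

Lemma served_of_perturbation (y : nat -> R) (n0 : nat) (kappa : R) :
  (forall i, 0 <= y i) -> (forall k, (k < n0)%N -> 1 + kappa <= rho k) ->
  (forall i, 0 < y i -> demand d i + y i <= 1 + kappa) -> 0 < kappa ->
  (forall F, uniq F -> (n0 <= size F)%N ->
     \sum_(i <- F) demand d i + \sum_(i <- F) y i + 2 * eps
       <= \sum_(0 <= k < size F) rho k) ->
  (forall i, odd i \/ U i./2 -> 1 < demand d i + y i) ->
  exists q u, served U (fun i => d i + y i.*2) Y q u.
Proof.
move=> y0 k0 yk kap0 big1 U1; apply: (served_of_majorized y0).
have [|? ?] := perturbed_majorization (r := v \o Y) (U := [set i | odd i \/ U i./2])
  rho1 rho_mono rho_lim Y_rho eps0 sl0 y0 k0 yk kap0 big1 _; first by move=> i /U1.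
by split.
Qed.

Lemma gap_below (n0 : nat) : (forall k, (k < n0)%N -> 1 < rho k) ->
  exists2 kappa : R, 0 < kappa & forall k, (k < n0)%N -> 1 + kappa <= rho k.
Proof.
case: n0 => [|n] h; first by exists 1.
exists (rho n - 1); first by rewrite subr_gt0 h.
by move=> k kn; rewrite addrC subrK; exact: rho_mono.
Qed.

Lemma served_with_slack (delta a0 : R) : 0 < delta -> 4 * eps <= delta ->
  1 < a0 -> slack d rho delta a0 -> U = [set i | 1 <= d i] ->
  exists q u, served U d Y q u.
Proof.
move=> delta0 eps_delta a01 sl UE.
have [n0 [n0P n0F]] := slack_from rho1 rho_mono rho_lim sl a01.
have [kappa kap0 kapP] := gap_below n0P.
(* [kappa] keeps the raised demands within the exact values; with [delta / 4] all raises cost at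
   most half of the slack, leaving the other half for the deviations. *)
pose b := Num.min kappa (delta / 4).
have b0 : 0 < b by rewrite lt_min kap0 divr_gt0.
(* Values tending to 1 need not drop below a demand equal to 1, so exactly these demands are
   raised. *)
pose y i := if demand d i == 1 then b * 2^-1 ^+ i else 0.
have g0 i : 0 < 2^-1 ^+ i :> R by rewrite exprn_gt0 // invr_gt0.
have y0 i : 0 <= y i by rewrite /y; case: ifP => // _; rewrite mulr_ge0 // ltW.
have [|||q [u [q1 qo uo qu qY]]] := served_of_perturbation (y := y) y0 kapP _ kap0.
- move=> i; rewrite /y; case: eqP => [->|_]; last by rewrite ltxx.
  move=> _; rewrite lerD2l (@le_trans _ _ b) //; last by rewrite ge_min lexx.
  by rewrite ler_piMr ?(ltW b0) // exprn_ile1 ?invr_ge0 // invf_le1 // ler1n.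
- move=> F uF nF; have := n0F F uF nF.
  have : \sum_(i <- F) y i <= b * 2.
    apply: (@le_trans _ _ (\sum_(i <- F) b * 2^-1 ^+ i)).
      apply: ler_sum => i _; rewrite /y; case: ifP => // _.
      by rewrite mulr_ge0 // ltW.
    by rewrite -mulr_sumr ler_wpM2l ?(ltW b0) // sum_geometric_seq.
  have : b <= delta / 4 by rewrite ge_min lexx orbT.
  lra.
- move=> i _; have := demand_ge1 d i; rewrite /y le_eqVlt eq_sym.
  by case: eqP => [-> _|_ /= h]; rewrite ?addr0 // ltrDl mulr_gt0.
exists q, u; split=> //; split; last exact: q1.2.
move=> i /q1.1[h1 h2]; split=> //; apply: le_trans h2.
by rewrite lerDl.
Qed.

Lemma finite_large_demands (c : R) : 1 < c -> finite_set [set i | c < d i].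
Proof.
move=> c1; apply: contrapT => inf.
pose a := (1 + c) / 2.
have a1 : 1 < a by rewrite /a; lra.
have ac : a < c by rewrite /a; lra.
have [N Na] := rho_lim a1.
pose B := \sum_(0 <= n < N) Num.max (rho n - a) 0.
have [f [finj fP]] := injective_choice (fun=> inf).
pose n := (Num.truncn (B / (c - a))).+1.
have us : uniq [seq f i | i <- index_iota 0 n] by rewrite map_inj_uniq ?iota_uniq.
have a1' : 1 < a < a + 1 by rewrite a1 ltrDl ltr01.
have sl : slack d rho 0 (a + 1) by exact: sl0.
have := sl a a1' N _ (ltW Na) us; rewrite addr0.
rewrite leNgt => /negP; apply.
apply: (@lt_le_trans _ _ (n%:R * (c - a))).
  by rewrite -ltr_pdivrMr ?subr_gt0 //; exact: Num.Theory.truncnS_gt.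
have -> : n%:R * (c - a) = \sum_(0 <= i < n) (c - a).
  by rewrite sumr_const_nat subn0 mulr_natl.
rewrite big_map; apply: ler_sum => i _; rewrite le_max; apply/orP; left.
by have := fP i => /= h; lra.
Qed.

(** Infinite slack admits raises with infinite sum if they accumulate slowly: [M k] is a prefix
    length from which slack [k + 6] is available, and [slow_divergent] stays within this budget. *)
Lemma served_divergent : 4 * eps <= 1 ->
  (forall c, exists2 a0, 1 < a0 & slack d rho c a0) ->
  U = [set i | 1 / 2 <= d i] -> infinite_set U ->
  exists (q u : nat -> H) (y : nat -> R),
    [/\ forall i, 0 <= y i <= 1 / 4, forall i, ~ U i -> y i = 0, divergent y
      & served U (fun i => d i + y i) Y q u].
Proof.
move=> eps1 sl UE infU.
(* At most [k + 3] is spent on the divergent raises; the rest covers the raises at odd indices and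
   the deviations of the reserve. *)
have /choice[M MP] (k : nat) : exists n, forall F, uniq F -> (n <= size F)%N ->
    \sum_(i <- F) demand d i + (k%:R + 6) <= \sum_(0 <= k < size F) rho k.
  have [a0 a01 s] := sl (k%:R + 6).
  by have [n [_ nP]] := slack_from rho1 rho_mono rho_lim s a01; exists n.
have [a0 a01 s1] := sl 1.
have [n0 [n0P n0F]] := slack_from rho1 rho_mono rho_lim s1 a01.
have [kappa kap0 kapP] := gap_below n0P.
(* Only these demands can be raised within [1 + kappa]; the larger ones are finite in number and
   exceed 1 anyway. *)
pose P := [set i | U i /\ d i <= 1 + kappa / 2].
have infP : infinite_set P.
  move=> fP; apply: infU; apply: sub_finite_set (_ : _ `<=` P `|`
    [set i | 1 + kappa / 2 < d i]) _.
    by move=> i Ui /=; have [|] := leP (d i) (1 + kappa / 2); [left|right].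
  by rewrite finite_setU; split=> //; apply: finite_large_demands; lra.
pose a := Num.min (kappa / 4) (1 / 8).
have a_pos : 0 < a by rewrite lt_min !divr_gt0.
have ak : a <= kappa / 4 by rewrite ge_min lexx.
have a8 : a <= 1 / 8 by rewrite ge_min lexx orbT.
have [y0 [y0a y0N y0P y0d y0F]] := slow_divergent M a_pos infP.
have g0 i : 0 < 2^-1 ^+ i :> R by rewrite exprn_gt0 // invr_gt0.
pose y i := if odd i then a * 2^-1 ^+ i else y0 i./2.
have y_ge0 i : 0 <= y i.
  rewrite /y; case: ifP => _; first by rewrite mulr_ge0 // ltW.
  by have /andP[] := y0a i./2.
have [|||q [u qu]] := served_of_perturbation (y := y) y_ge0 kapP _ kap0.
- move=> i; rewrite /y /demand; case: ifP => _.
    have : 2^-1 ^+ i <= 1 :> R.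
      by rewrite exprn_ile1 ?invr_ge0 // invf_le1 // ler1n.
    move=> h _; have : a * 2^-1 ^+ i <= a by rewrite ler_piMr // ltW.
    lra.
  have [[_ Pi]|/y0N ->] := pselect (P i./2); last by rewrite ltxx.
  have /andP[_ h] := y0a i./2; move=> _.
  have : Num.max (d i./2) 1 <= 1 + kappa / 2 by rewrite ge_max Pi /=; lra.
  lra.
- move=> F uF nF; pose F' := [seq i./2 | i <- F & ~~ odd i].
  have uF' : uniq F'.
    rewrite map_inj_in_uniq ?filter_uniq // => i j.
    rewrite !mem_filter => /andP[oi _] /andP[oj _] ij.
    by rewrite -(odd_double_half i) -(odd_double_half j) ij (negbTE oi) (negbTE oj).
  have sF : (size F' <= size F)%N by rewrite size_map size_filter count_size.
  have : \sum_(i <- F) y i <= 2 * a + \sum_(i <- F') y0 i.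
    rewrite (bigID odd) /= lerD //.
      apply: (@le_trans _ _ (\sum_(i <- F) a * 2^-1 ^+ i)).
        rewrite [leRHS](bigID odd) /= -[leLHS]addr0 lerD //.
          by apply: ler_sum => i oi; rewrite /y oi.
        by apply: sumr_ge0 => i _; rewrite mulr_ge0 // ltW.
      by rewrite -mulr_sumr mulrC ler_wpM2r ?(ltW a_pos) // sum_geometric_seq.
    rewrite big_map big_filter; apply: ler_sum => i oi.
    by rewrite /y (negbTE oi).
  have [h|[k [Mk h]]] := y0F F' uF'.
    by have := n0F F uF nF; lra.
  have := MP k F uF (leq_trans Mk sF).
  have : a * (k%:R + 3) <= k%:R + 3.
    by rewrite ler_piMl ?addr_ge0 ?ler0n //; lra.
  lra.
- move=> i; have := demand_ge1 d i; rewrite /y /demand.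
  case: (boolP (odd i)) => [_ _ _|oi D1].
    by rewrite ltrDl mulr_gt0.
  case=> // Ui; have [Pi|NP] := pselect (P i./2).
    by have := y0P _ Pi; lra.
  have : 1 + kappa / 2 < d i./2 by rewrite ltNge; apply/negP => h; apply: NP.
  have : d i./2 <= Num.max (d i./2) 1 by rewrite le_max lexx.
  have /andP[] := y0a i./2; lra.
exists q, u, y0; split=> //.
- by move=> i; have /andP[-> h] := y0a i; lra.
- by move=> i Ui; apply: y0N => -[].
- move: qu; congr served; apply/funext => i; by rewrite /y odd_double doubleK.
Qed.

End ServedDemands.

(** * Orthonormal bases with prescribed diagonal *)

Section Realization.
Context {R : realType} {H : completeNormedModType R[i]}.
Variable ip : {dot H for @Num.conj R[i]}.
Hypothesis ip_norm : norm_of_inner ip.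
Hypothesis H_sep : separable_space H.
Notation sqnorm := (sqnorm ip).

Lemma dense_sequence : exists x : nat -> H, forall V : set H,
  closed V -> (forall k, V (x k)) -> forall y, V y.
Proof.
have [S [/countable_injP[f finj] dS]] := H_sep.
have /choice[x xP] (n : nat) : exists y : H, forall s, S s -> f s = n -> y = s.
  have [[s [Ss fs]]|none] := pselect (exists s, S s /\ f s = n); last first.
    by exists 0 => s Ss fs; exfalso; apply: none; exists s.
  by exists s => t St ft; apply: finj; rewrite ?inE // fs ft.
exists x => V cV xV y; apply: cV; apply/(closure_sqnormP ip_norm) => r r0.
have [s [Ss sr]] := dense_sqnormP ip_norm y dS r0.
by exists s; split=> //; rewrite -(xP (f s) s).
Qed.

Definition realizes (v : H -> R) (d : nat -> R) : Prop :=
  exists e : nat -> H, [/\ orthonormal_seq ip e,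
    closure (linear_span (range e)) = [set: H] & forall i, v (e i) = d i].

(** The form of [1 - E]. It is again [quadratic], so results about large values also yield those
    about small ones. *)
Definition complement (v : H -> R) (x : H) : R := sqnorm x - v x.

Lemma quadratic_complement v : quadratic ip v -> quadratic ip (complement v).
Proof.
move=> qv p q pq; have [w [w1 wP]] := qv p q pq; exists w; split=> // a b.
rewrite /complement wP sqnormDd; last by rewrite ipZl ipZr pq !mulr0.
by rewrite !sqnormZ sqabsM !sqabs_real w1; ring.
Qed.

Lemma realizes_complement v d :
  realizes (complement v) (fun i => 1 - d i) -> realizes v d.
Proof.
move=> [e [[e1 eo] ecl ed]]; exists e; split=> // i.
by have := ed i; rewrite /complement e1; lra.
Qed.

Section TwoSides.
Variables (v : H -> R) (qv : quadratic ip v) (M : R).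
Hypothesis vM : forall x, sqnorm x = 1 -> `|v x| <= M.
Variable d : nat -> R.

(* The mirror image of [served] for the demands [d i <= 0]; the spare vectors
   have values that are negative or arbitrarily small. *)
Definition lower_ready (X q u : nat -> H) : Prop :=
  [/\ (forall i, d i <= 0 -> sqnorm (q i) = 1 /\ v (q i) <= d i) /\
        (forall i, 0 < d i -> q i = 0),
      forall i j, i <> j -> ip (q i) (q j) = 0,
      orthonormal_seq ip u /\
        (forall c m, 0 < c -> exists k, (m <= k)%N /\ v (u k) <= c),
      forall i k, ip (q i) (u k) = 0
    & forall z, (forall k, ip (X k) z = 0) ->
        (forall i, ip (q i) z = 0) /\ (forall k, ip (u k) z = 0)].

(** Room below [d i] comes from [q0 i] if [d i <= 0] and otherwise from low spare vectors; room
    above comes from [q1 i] if [U i] and otherwise from high spare vectors. *)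
Lemma realizes_two_sides (X Y q0 u0 q1 u1 : nat -> H) (U : set nat) (b w : nat -> R) :
  (forall i k, ip (X i) (Y k) = 0) ->
  lower_ready X q0 u0 -> served ip v U b Y q1 u1 ->
  (forall i, 0 <= w i) -> divergent w ->
  (forall i, d i <= 0 -> w i = 0) -> (forall i, 0 < d i -> w i <= d i / 2) ->
  (forall i, 0 < d i -> U i -> d i + w i <= b i) ->
  (forall i, ~ U i -> d i + w i <= 1) ->
  (forall i, U i -> 0 < d i) ->
  realizes v d.
Proof.
move=> XY [[q01 q00] q0o [u0o u0r] qu0 X0] [[q11 q10] q1o [u1o u1r] qu1 Y1].
move=> w0 dw wn wp Ub Uc Upos.
have Xy k : (forall i, ip (q1 i) (X k) = 0) /\ (forall i, ip (u1 i) (X k) = 0).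
  by apply: Y1 => i; exact/ipC0/XY.
have c00 i k : ip (q0 i) (q1 k) = 0.
  by apply: (X0 _ _).1 => j; apply: ipC0; exact: (Xy j).1.
have c01 i k : ip (q0 i) (u1 k) = 0.
  by apply: (X0 _ _).1 => j; apply: ipC0; exact: (Xy j).2.
have c10 i k : ip (u0 i) (q1 k) = 0.
  by apply: (X0 _ _).2 => j; apply: ipC0; exact: (Xy j).1.
have c11 i k : ip (u0 i) (u1 k) = 0.
  by apply: (X0 _ _).2 => j; apply: ipC0; exact: (Xy j).2.
pose q i := if d i <= 0 then q0 i else q1 i.
pose u k := if odd k then u1 k./2 else u0 k./2.
have qo i j : i <> j -> ip (q i) (q j) = 0.
  move=> ij; rewrite /q; case: ifP => _; case: ifP => _; [exact: q0o|exact: c00| |exact: q1o].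
  exact/ipC0/c00.
have half_inj (j k : nat) : odd j = odd k -> j <> k -> j./2 <> k./2.
  by move=> o jk h; apply: jk; rewrite -(odd_double_half j) -(odd_double_half k) o h.
have uo : orthonormal_seq ip u.
  split=> [k|j k jk]; first by rewrite /u; case: ifP => _; [exact: u1o.1|exact: u0o.1].
  rewrite /u; case: ifP => oj; case: ifP => ok.
  - by apply: u1o.2; apply: half_inj => //; rewrite oj ok.
  - exact/ipC0/c11.
  - exact: c11.
  - by apply: u0o.2; apply: half_inj => //; rewrite oj ok.
have qu i k : ip (q i) (u k) = 0.
  rewrite /q /u; case: ifP => _; case: ifP => _; [exact: c01|exact: qu0|exact: qu1|].
  exact/ipC0/c10.
have room0 i : 0 < d i -> forall m, exists k, (m <= k)%N /\ v (u k) <= d i - w i.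
  move=> di m; have [|k [mk vk]] := u0r (d i - w i) m; first by have := wp i di; lra.
  exists k.*2; rewrite /u odd_double doubleK; split=> //; lia.
have room1 i : d i + w i <= 1 -> forall m, exists k, (m <= k)%N /\ d i + w i <= v (u k).
  move=> di m; exists m.*2.+1; rewrite /u /= odd_double uphalf_double; split; first lia.
  exact: le_trans (u1r m).
have lower i : (sqnorm (q i) = 1 /\ v (q i) <= d i - w i) \/
    (forall m, exists k, (m <= k)%N /\ v (u k) <= d i - w i).
  have [di|di] := leP (d i) 0; last by right; exact: room0.
  by left; rewrite /q di wn // subr0; exact: q01.
have upper i : (sqnorm (q i) = 1 /\ d i + w i <= v (q i)) \/
    (forall m, exists k, (m <= k)%N /\ d i + w i <= v (u k)).
  have [Ui|nU] := pselect (U i); last by right; exact/room1/Uc.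
  have di := Upos i Ui; have [h1 h2] := q11 i Ui.
  by left; rewrite /q leNgt di; split=> //; exact: le_trans (Ub i di Ui) h2.
have q_unit i : sqnorm (q i) = 1 \/ q i = 0.
  rewrite /q; have [di|di] := leP (d i) 0; first by left; exact: (q01 i di).1.
  have [Ui|nU] := pselect (U i); first by left; exact: (q11 i Ui).1.
  by right; exact: q10.
pose z k := if odd k then u k./2 else q k./2.
have zo : orthogonal_family ip z.
  split=> [k|j k jk].
    by rewrite /z; case: ifP => _; [left; exact: uo.1|exact: q_unit].
  rewrite /z; case: ifP => oj; case: ifP => ok.
  - by apply: uo.2; apply: half_inj => //; rewrite oj ok.
  - exact/ipC0/qu.
  - exact: qu.
  - by apply: qo; apply: half_inj => //; rewrite oj ok.
have zq i : z i.*2 = q i by rewrite /z odd_double doubleK.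
have zu i : z i.*2.+1 = u i by rewrite /z /= odd_double uphalf_double.
have [x xP] := dense_sequence.
have /choice[P PP] := fourier_decomposition ip_norm zo.
(* The targets are all raw vectors, which the mixing need not use up, and the components of a dense
   sequence orthogonal to them. A closed subspace containing these targets is the whole space. *)
pose tg n := if odd n then x n./2 - P (x n./2) else z n./2.
have [|e [eo ed er]] := absorption qv vM w0 dw qo uo qu lower upper (tg := tg).
  move=> k; rewrite /tg; case: ifP => _.
    have [_ xz _] := PP (x k./2).
    exists 0%N; split=> j _; apply: ipC0; first by rewrite -zq.
    by rewrite -zu.
  exists (k./2).+1; split=> j kj; [rewrite -zq|rewrite -zu]; apply: zo.2;
    rewrite -?addnn; lia.
have efo := orthonormal_orthogonal_family eo.
have sV := fourier_span_subspace efo.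
have cV := fourier_span_closed ip_norm efo.
have Vtg n : fourier_span ip e (tg n) by move=> r r0; exact: er.
have Vz k : fourier_span ip e (z k).
  by have := Vtg k.*2; rewrite /tg odd_double doubleK.
exists e; split=> //; apply/seteqP; split=> // y _.
apply: (fourier_span_closure ip_norm); apply: (xP _ cV) => k.
rewrite -(subrK (P (x k)) (x k)); apply: (subspaceD sV).
  by have := Vtg k.*2.+1; rewrite /tg /= odd_double uphalf_double.
by apply: (fourier_span_sub ip_norm sV cV Vz); have [] := PP (x k).
Qed.

Lemma lower_ready_served (X q u : nat -> H) :
  served ip (complement v) [set i | 1 <= 1 - d i] (fun i => 1 - d i) X q u ->
  lower_ready X q u.
Proof.
move=> [[q1 q0] qo [uo ur] qu Xz]; split=> //.
- split=> [i di|i di]; last by apply: q0 => /=; lra.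
  have [|h1 h2] := q1 i; first by rewrite /=; lra.
  by move: h2; rewrite /complement h1; split=> //; lra.
- split=> // c m c0; exists m; split=> //.
  by have := ur m; rewrite /complement uo.1; lra.
Qed.

Lemma lower_ready_trivial (X : nat -> H) (xi : nat -> R) (eps : R) :
  (forall i, 0 < d i) -> orthonormal_seq ip X ->
  (forall n, 1 <= xi n) -> 0 < eps ->
  (forall n, `|complement v (X n) - xi n| <= eps * 2^-1 ^+ n) ->
  lower_ready X (fun=> 0) X.
Proof.
move=> d0 Xo xi1 eps0 Xxi; split=> //.
- by split=> // i; rewrite leNgt d0.
- by move=> *; exact: ip0l.
- split=> // c m c0; exists (maxn m (Num.truncn (eps / c)).+1).
  split; first exact: leq_maxl.
  set k := maxn _ _; have := Xxi k; rewrite /complement Xo.1 ler_norml => /andP[h _].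
  have : eps * 2^-1 ^+ k <= c.
    rewrite exprVn ler_pdivrMr ?exprn_gt0 // mulrC -ler_pdivrMr //.
    apply: le_trans (ltW (Num.Theory.truncnS_gt _)) _.
    by rewrite -natrX ler_nat (@leq_trans k) ?leq_maxr // ltnW // ltn_expl.
  by have := xi1 k; lra.
- by move=> *; exact: ip0l.
- by move=> z Xz; split=> // i; exact: ip0l.
Qed.

(** Nonzero only for [0 < d i < 1]. The half keeps [d i - w i] at least [d i / 2], above the values
    of suitable low spare vectors. *)
Definition interior_weight (i : nat) : R :=
  Num.max 0 (Num.min (d i) (1 - d i)) / 2.

Lemma interior_weight_ge0 i : 0 <= interior_weight i.
Proof. by rewrite divr_ge0 // le_max lexx. Qed.

Lemma realizes_interior (X Y q0 u0 q1 u1 : nat -> H) :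
  (forall i k, ip (X i) (Y k) = 0) -> lower_ready X q0 u0 ->
  served ip v [set i | 1 <= d i] d Y q1 u1 -> divergent interior_weight ->
  realizes v d.
Proof.
move=> XY lX sY dw; apply: (realizes_two_sides XY lX sY interior_weight_ge0 dw) => i /=;
  rewrite /interior_weight.
- move=> di; rewrite (max_idPl _) ?mul0r // ge_min di //.
- move=> di; rewrite ler_pM2r ?invr_gt0 // ge_max (ltW di) ge_min lexx //.
- move=> di Ui; rewrite (max_idPl _) ?mul0r ?addr0 // ge_min subr_le0 Ui orbT //.
- move=> /negP; rewrite -ltNge => di.
  have : Num.max 0 (Num.min (d i) (1 - d i)) <= 1 - d i.
    by rewrite ge_max subr_ge0 (ltW di) /= ge_min lexx orbT.
  lra.
- lra.
Qed.

(** The room above [d i] is built into [q1 i] by the raised demand; below, [d i >= 1 / 2] and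
    [y i <= 1 / 4] leave enough. *)
Lemma realizes_reserved (X Y q0 u0 q1 u1 : nat -> H) (y : nat -> R) :
  (forall i k, ip (X i) (Y k) = 0) -> lower_ready X q0 u0 ->
  served ip v [set i | 1 / 2 <= d i] (fun i => d i + y i) Y q1 u1 ->
  (forall i, 0 <= y i <= 1 / 4) -> (forall i, ~ (1 / 2 <= d i) -> y i = 0) ->
  divergent y -> realizes v d.
Proof.
move=> XY lX sY y14 y0 dy; have yge i : 0 <= y i by have /andP[] := y14 i.
apply: (realizes_two_sides XY lX sY yge dy) => i //=.
- by move=> di; apply: y0; lra.
- move=> di; have /andP[_ h] := y14 i.
  have [h'|h'] := leP (1 / 2) (d i); first lra.
  by rewrite y0; lra.
- by move=> h; rewrite y0 //; move: h => /negP; rewrite -ltNge; lra.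
- lra.
Qed.

End TwoSides.
End Realization.

Section QuadraticDiagonal.
Context {R : realType} {H : completeNormedModType R[i]}.
Variable ip : {dot H for @Num.conj R[i]}.
Notation sqnorm := (sqnorm ip).
Variable E : H -> H.
Hypothesis EP : forall a x y, E (a *: x + y) = a *: E x + E y.
Hypothesis E_sa : self_adjoint ip E.
Variable K : R.
Hypothesis EK : forall x, sqnorm (E x) <= K * sqnorm x.

Lemma diag_quadratic : quadratic ip (diag ip E).
Proof.
move=> p q pq; set z := ip (E p) q.
have [w [w1 wz]] : exists w : R[i], sqabs w = 1 /\
    complex.Re w * complex.Re z + complex.Im w * complex.Im z = 0.
  have [z0|z0] := eqVneq z 0.
    exists 1; rewrite z0 /= !mulr0 addr0; split=> //.
    by rewrite /sqabs /= expr1n expr0n addr0.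
  have s0 : 0 < sqabs z by rewrite lt_def sqabs_eq0 z0 sqabs_ge0.
  pose t := (Num.sqrt (sqabs z))^-1.
  (* This is [w = i z / |z|], for which the cross term [2 a b Re (conj w * z)] vanishes. *)
  exists (Complex (- complex.Im z * t) (complex.Re z * t)); split; last by rewrite /=; ring.
  rewrite /sqabs /= !exprMn -mulrDl sqrrN addrC -/(sqabs z) exprVn sqr_sqrtr ?(ltW s0) //.
  by rewrite mulfV // gt_eqF.
exists w; split=> // a b.
have E0 : E 0 = 0 by have := EP (-1) 0 0; rewrite scaler0 addr0 scaleN1r addNr.
rewrite /diag.
have -> : E (a%:C%C *: p + (b%:C%C * w) *: q) = a%:C%C *: E p + (b%:C%C * w) *: E q.
  by rewrite EP -[_ *: q]addr0 EP E0 addr0.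
have zE : ip (E q) p = z^* by rewrite E_sa ipC.
rewrite ipDl !ipDr !ipZl !ipZr -/z zE.
move: (ip (E p) p) (ip (E q) q) => P Q; move: w1 wz; rewrite /sqabs.
case: w => wr wi; case: (z) => zr zi; case: P => pr pi; case: Q => qr qi /= w1 wz.
transitivity (a ^+ 2 * pr + b ^+ 2 * (wr ^+ 2 + wi ^+ 2) * qr +
  2 * (a * b) * (wr * zr + wi * zi)); first ring.
by rewrite w1 wz; ring.
Qed.

Lemma diag_bound x : sqnorm x = 1 -> `|diag ip E x| <= K + 1.
Proof.
move=> x1; have := cauchy_schwarz ip (E x) x; have := EK x.
rewrite x1 !mulr1 /sqabs -/(diag ip E x); set im := complex.Im _; set re := diag _ _ _.
rewrite -[re ^+ 2]real_normK ?num_real // => h1 h2.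
have := sqr_ge0 (`|re| - 1); have := sqr_ge0 im; have := normr_ge0 re; nra.
Qed.

Lemma diag_real x : ip (E x) x = (diag ip E x)%:C%C.
Proof.
have : ip (E x) x = (ip (E x) x)^* by rewrite {1}E_sa ipC.
rewrite /diag; case: (ip _ _) => a b /eqP; rewrite eq_complex /= eqxx /=.
by rewrite -subr_eq0 opprK -mulr2n mulrn_eq0 /= => /eqP ->.
Qed.

End QuadraticDiagonal.

(** * The cases, for a quadratic form with reserves *)

Section CoreCases.
Context {R : realType} {H : completeNormedModType R[i]}.
Variable ip : {dot H for @Num.conj R[i]}.
Hypothesis ip_norm : norm_of_inner ip.
Hypothesis H_sep : separable_space H.
Notation sqnorm := (sqnorm ip).
Variable eps : R.
Hypothesis eps0 : 0 < eps.
Hypothesis eps1 : 4 * eps <= 1.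

Definition reserve_for (v : H -> R) (d : nat -> R) (Y : nat -> H)
    (rho : nat -> R) : Prop :=
  [/\ orthonormal_seq ip Y /\ (forall a0, slack d rho 0 a0), forall n, 1 <= rho n,
      forall m n, (m <= n)%N -> rho n <= rho m,
      forall c, 1 < c -> exists N, rho N < c
    & forall n, `|v (Y n) - rho n| <= eps * 2^-1 ^+ n /\
        (1 < rho n -> v (Y n) = rho n)].

(* The values of the reserve deviate from [rho] by at most [2 * eps] in total,
   which is to cost no more than half of the slack. *)
Definition positive_slack (d rho : nat -> R) : Prop :=
  exists delta a0, [/\ 0 < delta, 4 * eps <= delta, 1 < a0 & slack d rho delta a0].

Definition infinite_slack (d rho : nat -> R) : Prop :=
  forall c, exists2 a0, 1 < a0 & slack d rho c a0.

Lemma infinite_positive_slack d rho : infinite_slack d rho -> positive_slack d rho.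
Proof. by move=> /(_ 1)[a0 a01 s]; exists 1, a0. Qed.

Section Fixed.
Variables (v : H -> R) (qv : quadratic ip v) (M : R).
Hypothesis vM : forall x, sqnorm x = 1 -> `|v x| <= M.
Variables (d : nat -> R) (X Y : nat -> H) (xi rho : nat -> R).
Hypothesis XY : forall i k, ip (X i) (Y k) = 0.
Hypothesis resX : reserve_for (complement ip v) (fun i => 1 - d i) X xi.
Hypothesis resY : reserve_for v d Y rho.

Lemma lower_ready_slack : positive_slack (fun i => 1 - d i) xi ->
  exists q u, lower_ready ip v d X q u.
Proof.
move=> [delta [a0 [delta0 ed a01 sl]]]; have [[Xo sl0] x1 xm xl Xx] := resX.
have [q [u qu]] := served_with_slack (quadratic_complement qv) Xo x1 xm xl Xx eps0 sl0
  delta0 ed a01 sl erefl.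
by exists q, u; exact: lower_ready_served qu.
Qed.

Lemma upper_served : positive_slack d rho ->
  exists q u, served ip v [set i | 1 <= d i] d Y q u.
Proof.
move=> [delta [a0 [delta0 ed a01 sl]]]; have [[Yo sl0] y1 ym yl Yy] := resY.
exact: (served_with_slack qv Yo y1 ym yl Yy eps0 sl0 delta0 ed a01 sl erefl).
Qed.

Lemma realizes_positive_slack : positive_slack (fun i => 1 - d i) xi ->
  positive_slack d rho -> divergent (interior_weight d) -> realizes ip v d.
Proof.
move=> /lower_ready_slack[q0 [u0 l0]] /upper_served[q1 [u1 s1]].
exact: (realizes_interior ip_norm H_sep qv vM XY l0 s1).
Qed.

(** If only finitely many [d i] are at least 1/2, the divergence comes from entries in [(0, 1/2)],
    where the interior weight is [d i / 2]. Otherwise the infinite slack supplies divergent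
    raises. *)
Lemma realizes_infinite_slack q0 u0 : lower_ready ip v d X q0 u0 ->
  infinite_slack d rho -> divergent (fun i => Num.max 0 (d i)) -> realizes ip v d.
Proof.
move=> l0 inf dv; have [fin|infU] := pselect (finite_set [set i | 1 / 2 <= d i]).
  have [q1 [u1 s1]] := upper_served (infinite_positive_slack inf).
  apply: (realizes_interior ip_norm H_sep qv vM XY l0 s1).
  have /finite_seqP[s sE] := fin; pose C := \sum_(i <- s) Num.max 0 (d i).
  have p0 i : 0 <= Num.max 0 (d i) by rewrite le_max lexx.
  move=> B; have [n nP] := dv (2 * B + C); exists n.
  suff : \sum_(0 <= i < n) Num.max 0 (d i) <=
      2 * (\sum_(0 <= i < n) interior_weight d i) + C by lra.
  rewrite (bigID (fun i => 1 / 2 <= d i)) /= addrC lerD //; last first.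
    rewrite -big_filter; apply: ler_sum_subset => //; first by rewrite filter_uniq ?iota_uniq.
    move=> i; rewrite mem_filter => /andP[di _].
    by have := congr1 (fun A => A i) sE => /= <-.
  rewrite mulr_sumr [leRHS](bigID (fun i => 1 / 2 <= d i)) /= -[leLHS]add0r lerD //.
    by apply: sumr_ge0 => i _; rewrite mulr_ge0 ?interior_weight_ge0.
  apply: ler_sum => i; rewrite -ltNge => di; rewrite /interior_weight.
  have -> : Num.min (d i) (1 - d i) = d i by apply/min_idPl; lra.
  by rewrite mulrC divfK.
have [[Yo sl0] y1 ym yl Yy] := resY.
have [q1 [u1 [y [y14 yN dy s1]]]] := served_divergent qv Yo y1 ym yl Yy eps0 sl0 eps1
  inf erefl infU.
exact: (realizes_reserved ip_norm H_sep qv vM XY l0 s1 y14 yN dy).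
Qed.

Lemma realizes_upper_infinite : positive_slack (fun i => 1 - d i) xi ->
  infinite_slack d rho -> divergent (fun i => Num.max 0 (d i)) -> realizes ip v d.
Proof. by move=> /lower_ready_slack[q0 [u0 l0]]; exact: (realizes_infinite_slack l0). Qed.

Lemma realizes_upper_infinite_pos : (forall i, 0 < d i) ->
  infinite_slack d rho -> divergent (fun i => Num.max 0 (d i)) -> realizes ip v d.
Proof.
move=> d0; have [[Xo _] x1 _ _ Xx] := resX.
apply: realizes_infinite_slack; apply: (lower_ready_trivial d0 Xo x1 eps0) => n.
exact: (Xx n).1.
Qed.

End Fixed.

Lemma complementK (v : H -> R) : complement ip (complement ip v) = v.
Proof. by apply/funext => x; rewrite /complement; ring. Qed.

Lemma subKr_fun (I : Type) (d : I -> R) : (fun i => 1 - (1 - d i)) = d.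
Proof. by apply/funext => i; ring. Qed.

Lemma complement_bound v M : (forall x, sqnorm x = 1 -> `|v x| <= M) ->
  forall x, sqnorm x = 1 -> `|complement ip v x| <= M + 1.
Proof.
move=> vM x x1; rewrite /complement x1; have := vM x x1.
by rewrite !ler_norml => /andP[? ?]; apply/andP; split; lra.
Qed.

End CoreCases.

(** * From the majorization functions to partial sums *)

Section ExtendedSums.
Context {R : realType}.

Lemma sum_le_esum (I : choiceType) (S : set I) (a : I -> R) (G : seq I) :
  uniq G -> (forall i, i \in G -> S i) ->
  ((\sum_(i <- G) a i)%:E <= \esum_(i in S) (a i)%:E)%E.
Proof.
move=> uG GS; apply: esum_ge; exists [set` G]; first by split; [exact: finite_seq|].
by rewrite -fsbig_seq // sumEFin.
Qed.

Lemma fsets_seq (I : choiceType) (S X : set I) : fsets S X ->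
  exists G, [/\ uniq G, forall i, i \in G -> S i & X = [set` G]].
Proof.
move=> [/finite_seqP[s ->] sS]; exists (undup s); split; first exact: undup_uniq.
  by move=> i; rewrite mem_undup => /sS.
by apply/seteqP; split=> i /=; rewrite mem_undup.
Qed.

Lemma esum_le_bound (I : choiceType) (S : set I) (a : I -> R) (B : R) :
  (forall G : seq I, uniq G -> (forall i, i \in G -> S i) ->
    \sum_(i <- G) a i <= B) -> (\esum_(i in S) (a i)%:E <= B%:E)%E.
Proof.
move=> GB; apply: ge_ereal_sup => _ [X /fsets_seq[G [uG GS ->]] <-].
by rewrite -fsbig_seq // sumEFin lee_fin; exact: GB.
Qed.

Lemma esum_infty (I : choiceType) (S : set I) (a : I -> R) (B : R) :
  \esum_(i in S) (a i)%:E = +oo%E -> exists G : seq I,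
    [/\ uniq G, forall i, i \in G -> S i & B <= \sum_(i <- G) a i].
Proof.
move=> aoo; have : (B%:E < \esum_(i in S) (a i)%:E)%E by rewrite aoo ltry.
move=> /ereal_sup_gt[_ [X /fsets_seq[G [uG GS ->]] <-]].
by rewrite -fsbig_seq // sumEFin lte_fin => /ltW BG; exists G.
Qed.

Lemma esum_divergent (I : choiceType) (S : set I) (a : I -> R)
    (g : I -> nat) (h : nat -> R) : injective g -> (forall n, 0 <= h n) ->
  (forall i, S i -> a i <= h (g i)) -> \esum_(i in S) (a i)%:E = +oo%E ->
  divergent h.
Proof.
move=> gi h0 ah aoo B; have [G [uG GS BG]] := esum_infty B aoo.
exists (\max_(k <- map g G) k).+1; apply: le_trans BG _.
apply: (@le_trans _ _ (\sum_(k <- map g G) h k)).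
  by rewrite big_map big_seq [leRHS]big_seq; apply: ler_sum => i /GS /ah.
apply: ler_sum_subset => //; first by rewrite map_inj_uniq.
by move=> k kG; rewrite mem_index_iota /= ltnS (big_rem k) //= leq_maxl.
Qed.

Lemma divergentZ (h : nat -> R) (c : R) : 0 < c ->
  divergent (fun n => c * h n) -> divergent h.
Proof.
move=> c0 dh B; have [n nB] := dh (c * B); exists n.
by move: nB; rewrite -mulr_sumr ler_pM2l.
Qed.

Lemma divergent_infinite (U : set nat) (h : nat -> R) : infinite_set U ->
  (forall n, 0 <= h n) -> (forall n, U n -> 1 / 2 <= h n) -> divergent h.
Proof.
move=> iU h0 hU B; have [f [finj fP]] := injective_choice (fun=> iU).
pose n := (Num.truncn (2 * B)).+1; pose s := [seq f i | i <- index_iota 0 n].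
exists (\max_(k <- s) k).+1; apply: (@le_trans _ _ (\sum_(k <- s) h k)).
  rewrite big_map; apply: (@le_trans _ _ (\sum_(0 <= i < n) (1 / 2 : R))).
    rewrite sumr_const_nat subn0 -mulr_natl.
    have : 2 * B < n%:R by exact: Num.Theory.truncnS_gt.
    lra.
  by apply: ler_sum => i _; exact/hU/fP.
apply: ler_sum_subset => //; first by rewrite map_inj_uniq ?iota_uniq.
by move=> k ks; rewrite mem_index_iota /= ltnS (big_rem k) //= leq_maxl.
Qed.

Lemma limf_einf_gt (F : set (set R)) (h : R -> \bar R) (c : R) :
  (c%:E < limf_einf h F)%E -> exists V, F V /\ forall x, V x -> (c%:E <= h x)%E.
Proof.
rewrite /limf_einf lteNr => /ereal_inf_lt[_ [V FV <-] VN]; exists V; split=> // x Vx.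
rewrite -leeN2; apply: le_trans (ltW VN); apply: ereal_sup_ubound.
by exists x.
Qed.

Lemma near_right (a : R) (V : set R) : (a^'+) V ->
  exists2 b, a < b & forall x, a < x < b -> V x.
Proof.
move=> [e /= e0 eV]; exists (a + e); first by rewrite ltrDl.
move=> x /andP[ax xe]; apply: eV => //=.
by rewrite ltr_distlC; apply/andP; split; lra.
Qed.

Lemma near_left (a : R) (V : set R) : (a^'-) V ->
  exists2 b, b < a & forall x, b < x < a -> V x.
Proof.
move=> [e /= e0 eV]; exists (a - e); first by rewrite gtrBl.
move=> x /andP[xe ax]; apply: eV => //=.
by rewrite ltr_distlC; apply/andP; split; lra.
Qed.

(** The hypothesis [0 < x] sits inside, so that [c], and with it [eps], can be fixed before the
    cases of the theorem are separated. *)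
Lemma real_below (x : \bar R) : exists2 c : R, 0 < c & (0 < x)%E -> (c%:E < x)%E.
Proof.
case: x => [r| |].
- have [r0|r0] := ltP 0 r; last by exists 1 => //; rewrite lte_fin ltNge r0.
  by exists (r / 2); [rewrite divr_gt0|rewrite !lte_fin; lra].
- by exists 1 => // _; exact: ltry.
- by exists 1.
Qed.

Lemma maj_f_gt1 (I : choiceType) (d : I -> R) (a : R) : 1 < a ->
  maj_f d a = \esum_(i in [set i | a <= d i]) (d i - a)%:E.
Proof.
by move=> a1; rewrite /maj_f leNgt (lt_trans ltr01 a1) /= ltNge (ltW a1).
Qed.

Lemma maj_f_reflect (I : choiceType) (d : I -> R) (a : R) : 1 < a ->
  maj_f d (1 - a) = maj_f (fun i => 1 - d i) a.
Proof.
move=> a1; rewrite [RHS]maj_f_gt1 // /maj_f subr_le0 (ltW a1).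
have -> : [set i | d i <= 1 - a] = [set i | a <= 1 - d i].
  by apply/seteqP; split=> i /=; lra.
by apply: eq_esum => i _; congr (_%:E); ring.
Qed.

Section Levels.
Variables (J : choiceType) (g : J -> R) (rho : nat -> R).
Hypothesis gr : level_enumeration g rho.

Lemma maj_f_level_le (a : R) N : 1 < a -> rho N <= a ->
  (maj_f g a <= (\sum_(0 <= n < N) Num.max (rho n - a) 0)%:E)%E.
Proof.
move=> a1 Na; rewrite maj_f_gt1 //; apply: esum_le_bound => G uG _.
have [_ _ _ h] := gr; apply: le_trans (h a N G a1 Na uG).
by apply: ler_sum => j _; rewrite le_max lexx.
Qed.

Variables (I : choiceType) (d : I -> R).
Hypothesis maj : forall a, 1 < a -> (maj_f d a <= maj_f g a)%E.

Lemma maj_f_ge0 (a : R) : 1 < a -> (0 <= maj_f d a)%E.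
Proof.
by move=> a1; rewrite maj_f_gt1 //; apply: esum_ge0 => i /= h; rewrite lee_fin subr_ge0.
Qed.

(** Finiteness is inherited from [maj_f g a], which a finite sum bounds; it permits moving this term
    across inequalities in [\bar R]. *)
Lemma maj_f_fin_num (a : R) : 1 < a -> maj_f d a \is a fin_num.
Proof.
move=> a1; have [_ _ lim _] := gr; have [N Na] := lim a a1.
rewrite ge0_fin_numE ?maj_f_ge0 //.
exact: le_lt_trans (le_trans (maj a1) (maj_f_level_le a1 (ltW Na))) (ltry _).
Qed.

Lemma slack_of_maj (f : nat -> I) (c a0 : R) : injective f ->
  (forall a, 1 < a < a0 -> (c%:E <= maj_f g a - maj_f d a)%E) ->
  slack (d \o f) rho c a0.
Proof.
move=> fi cP a /[dup] aa0 /andP[a1 _] N F Na uF.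
have := cP a aa0; rewrite leeBrDr ?maj_f_fin_num // addeC => h.
rewrite -lee_fin (le_trans _ (maj_f_level_le a1 Na)) // (le_trans _ h) //.
rewrite EFinD leeD2r // (maj_f_gt1 _ a1).
have -> : \sum_(i <- F) Num.max ((d \o f) i - a) 0 =
    \sum_(i <- [seq f i | i <- F & a <= d (f i)]) (d i - a).
  rewrite big_map big_filter [LHS](bigID (fun i => a <= d (f i))) /=.
  rewrite [X in _ + X]big1 ?addr0.
    by apply: eq_bigr => i h'; apply/max_idPl; rewrite subr_ge0.
  by move=> i; rewrite -ltNge => h'; apply/max_idPr; rewrite subr_le0 ltW.
apply: sum_le_esum; first by rewrite map_inj_uniq ?filter_uniq.
by move=> _ /mapP[i + ->]; rewrite mem_filter => /andP[].
Qed.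

Lemma slack0_of_maj (f : nat -> I) (a0 : R) : injective f ->
  slack (d \o f) rho 0 a0.
Proof.
move=> fi; apply: slack_of_maj => // a /andP[a1 _].
by rewrite sube_ge0 ?maj ?maj_f_fin_num // orbT.
Qed.

End Levels.
End ExtendedSums.

Lemma enumerate_infinite (I : countType) : infinite_set [set: I] ->
  exists (f : nat -> I) (g : I -> nat), cancel f g /\ cancel g f.
Proof.
move=> iI; have : ([set: I] #= [set: nat])%card.
  by apply: eq_card_nat => //; exact: countableP.
move=> /card_set_bijP[g [_ gi gs]].
have /choice[f fP] n : exists i, g i = n by have [i _ <-] := gs n Logic.I; exists i.
exists f, g; split=> // i; apply: gi; rewrite ?inE // fP.
Qed.

(** * From the operator to its quadratic form, and the final case analysis *)

Section Operator.
Context {R : realType} {H : completeNormedModType R[i]}.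
Variable ip : {dot H for @Num.conj R[i]}.
Hypothesis ip_norm : norm_of_inner ip.
Notation sqnorm := (sqnorm ip).
Variable E : H -> H.

Lemma bounded_operator_sqnorm : bounded_operator E ->
  exists K, forall x, sqnorm (E x) <= K * sqnorm x.
Proof.
move=> [M MP]; exists (complex.Re M ^+ 2) => x.
have := MP x; rewrite !(norm_sqnorm ip_norm) lecE.
  rewrite complex_ReM /= mulr0 subr0 => /andP[_ h].
have := h; rewrite -(@ler_pXn2r _ 2) ?nnegrE ?sqrtr_ge0 //.
  by rewrite exprMn !sqr_sqrtr ?sqnorm_ge0.
by apply: le_trans h; exact: sqrtr_ge0.
Qed.

(** Orthogonality comes from the list within one eigenspace and from self-adjointness between
    different ones. *)
Lemma orthonormal_eigenvectors (J : countType) (lam : J -> R) :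
  self_adjoint ip E -> eigenvalue_list ip E lam -> exists v : J -> H,
  [/\ forall j, sqnorm (v j) = 1, forall i j, i <> j -> ip (v i) (v j) = 0
    & forall j, E (v j) = (lam j)%:C%C *: v j].
Proof.
move=> E_sa /choice[e eP]; pose v j := e (lam j)%:C%C j.
have Ev j : E (v j) = (lam j)%:C%C *: v j.
  have [_ _ cl] := eP (lam j)%:C%C.
  suff : Defs.eigenspace E (lam j)%:C%C (v j) by [].
  by rewrite -cl; apply: subset_closure; apply: linear_span_mem; exists j.
exists v; split=> // [j|i j ij].
  by have [h _ _] := eP (lam j)%:C%C; rewrite /sqnorm h.
have [lij|lij] := eqVneq (lam i) (lam j).
  rewrite /v lij; have [_ h _] := eP (lam j)%:C%C; apply: h => //=.
  by rewrite lij.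
have := E_sa (v i) (v j); rewrite !Ev ipZl ipZr.
have -> : ((lam j)%:C%C)^* = (lam j)%:C%C :> R[i].
  by apply/eqP; rewrite eq_complex /= oppr0 !eqxx.
move/eqP; rewrite -subr_eq0 -mulrBl -rmorphB mulf_eq0 => /orP[|/eqP //].
by rewrite eq_complex /= eqxx andbT subr_eq0 (negbTE lij).
Qed.

Hypothesis E_sa : self_adjoint ip E.

Lemma realizes_is_diagonal (I : Type) (d : I -> R) (f : nat -> I) (g : I -> nat) :
  cancel f g -> cancel g f ->
  realizes ip (diag ip E) (d \o f) -> is_diagonal ip E d.
Proof.
move=> fg gf [e [[e1 eo] ecl ed]]; exists (e \o g); split; last first.
  by move=> i; rewrite diag_real //= ed /= gf.
split=> [i _|i j _ _ ij|].
- by rewrite ip_sqnorm e1.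
- by apply: eo => gij; apply: ij; rewrite -(gf i) gij gf.
- rewrite -ecl; congr (closure (linear_span _)); apply/seteqP.
  split=> [_ [i _ <-]|_ [n _ <-]]; first by exists (g i).
  by exists (f n) => //=; rewrite fg.
Qed.

End Operator.

Theorem theorem8p3 (R : realType) (H : completeNormedModType R[i])
    (ip : {dot H for @Num.conj R[i]})
    (ip_norm : norm_of_inner ip)
    (H_sep : separable_space H)
    (H_inf : ~ finite_dim [set: H])
    (E : {linear H -> H})
    (E_bnd : bounded_operator E)
    (E_sa : self_adjoint ip E)
    (ess01 : [set 0; 1] `<=` essential_spectrum E)
    (essI : essential_spectrum E `<=` [set z : R[i] | 0 <= z <= 1])
    (J : countType) (lam : J -> R)
    (lam_eig : eigenvalue_list ip E lam)
    (I : countType) (I_inf : infinite_set [set: I]) (d : I -> R)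
    (maj : forall alpha : R, ~ (0 <= alpha <= 1) ->
       (maj_f d alpha <= maj_f lam alpha)%E)
    (cases :
       (* (a) *)
       [/\ (0 < delta_lower lam d)%E, (0 < delta_upper lam d)%E
         & exists alpha : R, 0 < alpha < 1 /\ maj_f d alpha = +oo%E] \/
       (* (b) *)
       [/\ (0 < delta_lower lam d)%E, delta_upper lam d = +oo%E
         & \esum_(i in [set i | 0 < d i]) (d i)%:E = +oo%E] \/
       (* (b') *)
       [/\ delta_lower lam d = 0%E, delta_upper lam d = +oo%E,
           \esum_(i in [set i | 0 < d i]) (d i)%:E = +oo%E
         & forall i, 0 < d i] \/
       (* (c) *)
       [/\ (0 < delta_upper lam d)%E, delta_lower lam d = +oo%E
         & \esum_(i in [set i | d i < 1]) (1 - d i)%:E = +oo%E] \/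
       (* (c') *)
       [/\ delta_upper lam d = 0%E, delta_lower lam d = +oo%E,
           \esum_(i in [set i | d i < 1]) (1 - d i)%:E = +oo%E
         & forall i, d i < 1] \/
       (* (d) *)
       (delta_lower lam d = +oo%E /\ delta_upper lam d = +oo%E)) :
  is_diagonal ip E d.
Proof.
have EP a x y : E (a *: x + y) = a *: E x + E y by exact: linearP.
have [K EK] := bounded_operator_sqnorm ip_norm E_bnd.
have nf0 : ~ fredholm (fun x => E x - 0%:C%C *: x) by apply: (ess01 0); left.
have nf1 : ~ fredholm (fun x => E x - 1%:C%C *: x) by apply: (ess01 1); right.
have fout (m : R) : ~ (0 <= m <= 1) -> fredholm (fun x => E x - m%:C%C *: x).
  move=> m01; apply: contrapT => nf; apply: m01.
  by have /= := essI _ nf; rewrite !lecR.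
have f_above m : 1 < m -> fredholm (fun x => E x - m%:C%C *: x).
  by move=> m1; apply: fout => /andP[_]; rewrite leNgt m1.
have f_below m : m < 0 -> fredholm (fun x => E x - m%:C%C *: x).
  by move=> m0; apply: fout => /andP[+ _]; rewrite leNgt m0.
have [v [v1 vo Ev]] := orthonormal_eigenvectors E_sa lam_eig.
have [f [g [fg gf]]] := enumerate_infinite I_inf.
have fi : injective f by exact: can_inj fg.
have gi : injective g by exact: can_inj gf.
apply: (realizes_is_diagonal E_sa fg gf).
have [cU cU0 cUP] := real_below (delta_upper lam d).
have [cL cL0 cLP] := real_below (delta_lower lam d).
(* Chosen so that [4 * eps] is at most 1 and at most the real number found below each positive
   slack. *)
pose eps := Num.min (1 / 4) (Num.min (cU / 4) (cL / 4)).
have eps0 : 0 < eps by rewrite !lt_min !divr_gt0.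
have eps1 : 4 * eps <= 1.
  have : eps <= 1 / 4 by rewrite ge_min lexx.
  lra.
have epsU : 4 * eps <= cU.
  have : eps <= cU / 4 by rewrite !ge_min lexx orbT.
  lra.
have epsL : 4 * eps <= cL.
  have : eps <= cL / 4 by rewrite !ge_min lexx !orbT.
  lra.
have [X [Y [xi [rho [[Xo Yo] XY [lxi lrho] Xxi Yrho]]]]] :=
  reserves ip_norm EP E_sa EK nf0 nf1 f_above f_below v1 vo Ev eps0.
pose dn := d \o f; pose vE := diag ip E.
have majU a : 1 < a -> (maj_f d a <= maj_f lam a)%E.
  by move=> a1; apply: maj => /andP[_]; rewrite leNgt a1.
have majL a : 1 < a -> (maj_f (fun i => 1 - d i)%R a <= maj_f (fun j => 1 - lam j)%R a)%E.
  by move=> a1; rewrite -!maj_f_reflect //; apply: maj => /andP[]; lra.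
have slU c : (c%:E < delta_upper lam d)%E -> exists2 a0, 1 < a0 & slack dn rho c a0.
  move=> /limf_einf_gt[V [/near_right[a0 a01 aV] VP]]; exists a0 => //.
  by apply: (slack_of_maj lrho majU fi) => a /aV; exact: VP.
have slL c : (c%:E < delta_lower lam d)%E ->
    exists2 a0, 1 < a0 & slack (fun i => 1 - dn i) xi c a0.
  move=> /limf_einf_gt[V [/near_left[b b0 bV] VP]]; exists (1 - b); first by lra.
  apply: (slack_of_maj lxi majL fi) => a /andP[a1 ab].
  rewrite -!maj_f_reflect //; apply: VP; apply: bV; lra.
have posU : (0 < delta_upper lam d)%E -> positive_slack eps dn rho.
  by move=> /cUP/slU[a0 a01 s]; exists cU, a0.
have posL : (0 < delta_lower lam d)%E -> positive_slack eps (fun i => 1 - dn i) xi.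
  by move=> /cLP/slL[a0 a01 s]; exists cL, a0.
have infU : delta_upper lam d = +oo%E -> infinite_slack dn rho.
  by move=> h c; apply: slU; rewrite h ltry.
have infL : delta_lower lam d = +oo%E -> infinite_slack (fun i => 1 - dn i) xi.
  by move=> h c; apply: slL; rewrite h ltry.
have qv : quadratic ip vE by exact: diag_quadratic.
have vM : forall x, sqnorm ip x = 1 -> `|vE x| <= K + 1 by exact: diag_bound.
have resY : reserve_for ip eps vE dn Y rho.
  have [r1 rm rl _] := lrho; split=> //; split=> // a0.
  exact: (slack0_of_maj lrho majU).
have resX : reserve_for ip eps (complement ip vE) (fun i => 1 - dn i) X xi.
  have [r1 rm rl _] := lxi; split=> //; last by move=> n; rewrite /complement Xo.1.
  by split=> // a0; exact: (slack0_of_maj lxi majL).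
have h0 (t : R) : 0 <= Num.max 0 t by rewrite le_max lexx.
have divU : \esum_(i in [set i | 0 < d i]) (d i)%:E = +oo%E ->
    divergent (fun i => Num.max 0 (dn i)).
  apply: (esum_divergent gi) => // i _; by rewrite /dn /= gf le_max lexx orbT.
have divL : \esum_(i in [set i | d i < 1]) (1 - d i)%:E = +oo%E ->
    divergent (fun i => Num.max 0 (1 - dn i)).
  apply: (esum_divergent gi) => // i _; by rewrite /dn /= gf le_max lexx orbT.
have caseU : positive_slack eps (fun i => 1 - dn i) xi \/ (forall i, 0 < dn i) ->
    infinite_slack dn rho -> divergent (fun i => Num.max 0 (dn i)) ->
    realizes ip vE dn.
  case=> h.
    exact: (realizes_upper_infinite ip_norm H_sep eps0 eps1 qv vM XY resX resY h).
  exact: (realizes_upper_infinite_pos ip_norm H_sep eps0 eps1 qv vM XY resX resY h).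
have YX i k : ip (Y i) (X k) = 0 by apply: ipC0; exact: XY.
have resY' : reserve_for ip eps (complement ip (complement ip vE))
    (fun i => 1 - (1 - dn i)) Y rho by rewrite complementK subKr_fun.
have qv' := quadratic_complement qv; have vM' := complement_bound vM.
(* The mirror image of [caseU]: [1 - E] and [1 - d] replace [E] and [d], and the two reserves change
   places. *)
have caseL : positive_slack eps dn rho \/ (forall i, dn i < 1) ->
    infinite_slack (fun i => 1 - dn i) xi ->
    divergent (fun i => Num.max 0 (1 - dn i)) -> realizes ip vE dn.
  case=> h inf dv; apply: realizes_complement.
    apply: (realizes_upper_infinite ip_norm H_sep eps0 eps1 qv' vM' YX resY' resX) => //.
    by rewrite subKr_fun.
  apply: (realizes_upper_infinite_pos ip_norm H_sep eps0 eps1 qv' vM' YX resY' resX) => //.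
  by move=> i; rewrite subr_gt0.
case: cases => [[dL dU [a [/andP[a0 a1] foo]]]|].
  apply: (realizes_positive_slack ip_norm H_sep eps0 qv vM XY resX resY);
    [exact: posL|exact: posU|].
  have w0 := interior_weight_ge0 dn.
  move: foo; rewrite /maj_f leNgt a0 /= a1.
  (* An infinite [maj_f d a] forces [maj_C] or [maj_D] to be infinite. For [0 <= d i < a] one has
     [d i * (1 - a) <= min (d i) (1 - d i)], and for [a <= d i <= 1] likewise [(1 - d i) * a]; so
     the interior weights diverge in both cases. *)
  have [Coo|CN] := eqVneq (maj_C d a) +oo%E.
    move=> _; apply: (@divergentZ _ _ (2 / (1 - a))); first by rewrite divr_gt0 ?subr_gt0.
    apply: (esum_divergent gi _ _ Coo) => [n|i /= /andP[di da]].
      by rewrite mulr_ge0 // divr_ge0 // subr_ge0 ltW.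
    rewrite /interior_weight /dn /= gf; set m := Num.max 0 _.
    have -> : 2 / (1 - a) * (m / 2) = m / (1 - a) by field; rewrite subr_eq0 gt_eqF.
    rewrite ler_pdivlMr ?subr_gt0 // le_max le_min.
    apply/orP; right; apply/andP; split; nra.
  have [Doo|DN] := eqVneq (maj_D d a) +oo%E.
    move=> _; apply: (@divergentZ _ _ (2 / a)); first by rewrite divr_gt0.
    apply: (esum_divergent gi _ _ Doo) => [n|i /= /andP[da d1]].
      by rewrite mulr_ge0 // divr_ge0 // ltW.
    rewrite /interior_weight /dn /= gf; set m := Num.max 0 _.
    have -> : 2 / a * (m / 2) = m / a by field; rewrite gt_eqF.
    rewrite ler_pdivlMr // le_max le_min.
    apply/orP; right; apply/andP; split; nra.
  have C0 : (0 <= maj_C d a)%E.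
    by apply: esum_ge0 => i /= /andP[h _]; rewrite lee_fin.
  have D0 : (0 <= maj_D d a)%E.
    by apply: esum_ge0 => i /= /andP[_ h]; rewrite lee_fin subr_ge0.
  have : maj_C d a \is a fin_num by rewrite ge0_fin_numE // ltey.
  have : maj_D d a \is a fin_num by rewrite ge0_fin_numE // ltey.
  by move=> /fineK <- /fineK <-; rewrite -!EFinM -EFinD.
case=> [[dL dU s]|]; first by apply: caseU; [left; exact: posL|exact: infU|exact: divU].
case=> [[_ dU s dpos]|].
  by apply: caseU; [right => i; exact: dpos|exact: infU|exact: divU].
case=> [[dU dL s]|]; first by apply: caseL; [left; exact: posU|exact: infL|exact: divL].
case=> [[_ dL s dlt]|].
  by apply: caseL; [right => i; exact: dlt|exact: infL|exact: divL].
(* No sum is assumed infinite here, but infinitely many [d i] are at least 1/2 or infinitely many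
   are below it, which gives the divergence required by [caseU] or [caseL]. *)
move=> [dL dU]; have [fin|inf] := pselect (finite_set [set i | 1 / 2 <= dn i]).
  apply: caseL; [by left; apply: posU; rewrite dU ltry|exact: infL|].
  apply: (@divergent_infinite _ [set i | dn i < 1 / 2]) => // [|n /= h].
    move=> fin'; apply: (infinite_nat); suff <- : [set i | 1 / 2 <= dn i] `|`
      [set i | dn i < 1 / 2] = [set: nat] by rewrite finite_setU.
    by apply/seteqP; split=> // i _ /=; have [|] := leP (1 / 2) (dn i); [left|right].
  by rewrite le_max; apply/orP; right; lra.
apply: caseU; [by left; apply: posL; rewrite dL ltry|exact: infU|].
apply: (divergent_infinite inf) => // n /= h.
by rewrite le_max h orbT.
Qed.
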